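(* Let $\mathcal{A}$ be the set of irrational $\alpha\in[0,1)$ whose continued fraction expansion $\alpha=[a_1,a_2,\dots]$ satisfies the following three conditions: (i) $a_n<n^{4/3}$ for all but finitely many $n$; (ii) $\displaystyle\lim_{C\to\infty}\limsup_{N\to\infty}\frac1N\Big(\sum_{i=1}^N\log a_i-\sum_{1\le i\le N,\ a_i<C}\log a_i\Big)=0$; (iii) $\displaystyle\sum_{k:\,a_k>k^{1/2}}\frac{\log k}{k^{2/3}}<\infty$. Then $\mathcal{A}$ has full Lebesgue measure in $[0,1)$, and for every $\alpha\in\mathcal{A}$, every sequence of real numbers $\{r_i\}_{i\ge1}$ such that $ir_i$ is non-increasing and $\sum_{i=1}^\infty r_i=\infty$, and every $a\in[0,1)$, one has $$\lim_{N\to\infty}\frac{\sum_{i=1}^N\chi_{B(a,r_i)}(R_\alpha^i x)}{\sum_{i=1}^N2r_i}=1$$ for (Lebesgue) almost every $x\in[0,1)$.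
   Context: $R_\alpha:[0,1)\to[0,1)$ is the rotation $R_\alpha(x)=x+\alpha \bmod 1$. The continued fraction expansion is $\alpha=[a_1,a_2,\dots]=1/(a_1+1/(a_2+\cdots))$ with positive integers $a_i$. $\chi_A$ is the indicator function of $A$, and $B(a,r)$ is the ball of radius $r$ about $a$, where $[0,1)$ is identified with the circle $\mathbb{R}/\mathbb{Z}$. *)

(* Defs.v *)
From HB Require Import structures.
From mathcomp Require Import all_boot all_order all_algebra.
From mathcomp Require Import all_classical all_reals all_analysis.

Set Implicit Arguments.
Unset Strict Implicit.
Unset Printing Implicit Defensive.

Import Order.TTheory GRing.Theory Num.Theory.
Import numFieldNormedType.Exports.

Local Open Scope classical_set_scope.
Local Open Scope ring_scope.

(* The circle R/Z is identified with [0,1) through the fractional part. *)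
Definition fract (R : realType) (t : R) : R := t - (Num.floor t)%:~R.

Definition rotation (R : realType) (alpha x : R) : R := fract (x + alpha).

(* The quotient metric of R/Z: distance from x - y to the nearest integer. *)
Definition circle_dist (R : realType) (x y : R) : R :=
  Num.min (fract (x - y)) (1 - fract (x - y)).

Definition circle_ball (R : realType) (a r : R) : set R :=
  [set x | 0 <= x < 1 /\ circle_dist a x < r].

(* 1/(a_k + 1/(a_{k+1} + ... + 1/a_{k+n-1})), with value 0 when n = 0. *)
Fixpoint cfrac (R : realType) (a : nat -> nat) (k n : nat) : R :=
  if n is m.+1 then ((a k)%:R + cfrac R a k.+1 m)^-1 else 0.

(* alpha = [a_1, a_2, ...]; the entry a 0 plays no role. *)
Definition cf_expansion (R : realType) (alpha : R) (a : nat -> nat) : Prop :=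
  (forall i, (1 <= i)%N -> (1 <= a i)%N) /\
  (cfrac R a 1 n @[n --> \oo] --> alpha).

(* The three conditions are imposed on a, which is unique given alpha. The
   limsup in the second and the series of nonnegative terms in the third are
   taken in the extended reals. *)
Definition calA (R : realType) : set R :=
  [set alpha : R | [/\ 0 <= alpha < 1, irrational alpha &
    exists a : nat -> nat,
      [/\ cf_expansion alpha a,
          \forall n \near \oo, (a n)%:R < n%:R `^ (4 / 3) :> R,
          limn_esup (fun N : nat =>
            (N%:R^-1 *
              (\sum_(1 <= i < N.+1) ln ((a i)%:R : R)
               - \sum_(1 <= i < N.+1 | (a i)%:R < C) ln ((a i)%:R : R)))%:E)
            @[C --> (+oo : set_system R)] --> (0%:E : \bar R)
        & (\sum_(1 <= k <oo | (k%:R `^ (1 / 2) < (a k)%:R :> R)%R)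
             (ln (k%:R : R) / k%:R `^ (2 / 3))%R%:E < +oo)%E]]].

(* Main.v *)
Require Import Defs.
From HB Require Import structures.
From mathcomp Require Import all_boot all_order all_algebra.
From mathcomp Require Import all_classical all_reals all_analysis.
From mathcomp Require Import measurable_realfun zify ring lra.

Set Implicit Arguments.
Unset Strict Implicit.
Unset Printing Implicit Defensive.

Import Order.TTheory GRing.Theory Num.Theory.
Import numFieldNormedType.Exports.

Local Open Scope classical_set_scope.
Local Open Scope ring_scope.

(** The second part of the theorem is a strong law of large numbers for the visit
    events [visit (i, r i)], proved by the second moment method; the first part
    is a metric statement on the digits of a random number.

    Let [q n] be the denominators of the convergents of [alpha], and cut the
    times into the blocks from [q n] to [q n.+1]. By the Denjoy-Koksma inequality
    ([count_orbit_arc]), [q n] consecutive points of an orbit visit an arc as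
    often as expected, up to a bounded error. Hence an event has a bounded
    covariance, relative to the radius, with a whole window of [q n] consecutive
    events of equal radius ([sum_visitI_window]). To have equal radii, the visits
    are enclosed between two systems of windows, with the largest and with the
    smallest radius of each window ([le_sum_sysup], [le_sum_syslow]). The windows
    of block [n] have length [q (n - 2 * s)]: the two means then differ by a factor
    close to one when [s] is large, as long as large entries are rare, which is
    what the second condition provides ([sparse_big_entries]).

    Put [b n = q n * r (q n)], a nonincreasing sequence. Covariances between
    different blocks sum up to a multiple of the mean. Inside block [n], distinct
    visits are disjoint events after time [6 * a n.+1 * b n * q n], by the law of
    best approximation ([visitI_disjoint]). So the variance is bounded by a
    multiple of the sum over the blocks of their means times [1 + a n.+1 * b n]
    ([variance_sys]). As [b] is nonincreasing, the total mean [M n] before block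
    [n] is at least of order [n * b n], and the mean of block [n] is at most
    [2 * b n * (2 + ln (a n.+1 + 1))]; the additional terms, divided by
    [M n ^+ 2], are therefore bounded by [a n.+1 * ln n / n ^+ 2], whose sum is
    finite by the first and third conditions ([lam_sum]). Chebyshev's inequality
    along the times where the mean grows geometrically, and monotonicity between
    these times, give the strong law ([strong_law]).

    For the first part, the conditional law of a digit given the previous ones
    is explicit, because a cylinder is the image of [0, 1] under a Moebius map,
    and it decreases like [1 / k ^+ 2] uniformly in the past. This yields
    Chernoff's bound for sums of functions of the digits ([covered_digit_sum]),
    and each of the three conditions follows from it: the first two with the
    Borel-Cantelli lemma, the third from a bound on the exponential moments that
    is uniform in the number of digits. *)

(** * Measure on the circle *)

Section Circle.
Variable R : realType.
Implicit Types (s t x rho : R).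
Local Notation mu := (@lebesgue_measure R).

Lemma fract_itv t : 0 <= fract t < 1.
Proof.
rewrite /fract; have := floor_itv t.
by rewrite intrD; lra.
Qed.

Lemma fractD (t : R) (m : int) : fract (t + m%:~R) = fract t.
Proof. by rewrite /fract floorDrz ?intr_int// intrKfloor intrD; lra. Qed.

Lemma fract_id t : 0 <= t < 1 -> fract t = t.
Proof.
by move=> t01; rewrite /fract (@floor_def _ _ 0) ?subr0// add0r.
Qed.

Lemma measurable_fract : measurable_fun setT (@fract R).
Proof.
rewrite /fract; apply: measurable_funB => //.
apply: nondecreasing_measurable => // x y xy.
by rewrite ler_int le_floor.
Qed.

Definition dist_int t := Num.min (fract t) (1 - fract t).

Lemma dist_intD t (m : int) : dist_int (t + m%:~R) = dist_int t.
Proof. by rewrite /dist_int fractD. Qed.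

Lemma dist_int_ltP t rho :
  dist_int t < rho <-> exists m : int, `|t - m%:~R| < rho.
Proof.
have := fract_itv t; rewrite /dist_int => ft; split.
  rewrite gt_min => /orP[h|h].
    exists (Num.floor t); move: ft h; rewrite /fract => /andP[h1 h2] h.
    by rewrite ger0_norm.
  exists (Num.floor t + 1); move: ft h; rewrite /fract intrD => /andP[h1 h2] h.
  by rewrite ltr0_norm; lra.
move=> [m h]; rewrite gt_min; apply/orP.
have [k kE] : exists k : int, fract t = t - m%:~R + k%:~R.
  by exists (m - Num.floor t); rewrite /fract intrB; lra.
move: h; rewrite ltr_norml => /andP[h1 h2].
have [k0|k0] := lerP k 0.
  have : k%:~R <= 0 :> R by rewrite lerz0.
  by left; lra.
have : 1 <= k%:~R :> R by rewrite ler1z -gtz0_ge1.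
by right; lra.
Qed.

Lemma measurable_dist_int : measurable_fun setT dist_int.
Proof.
apply: measurable_minr; first exact: measurable_fract.
by apply: measurable_funB => //; exact: measurable_fract.
Qed.

Lemma measurable_shift s : measurable_fun setT (fun x : R => x + s).
Proof. exact: measurable_funD. Qed.

Lemma lebesgue_measure_shift s (A : set R) : measurable A ->
  mu ((fun x => x + s) @^-1` A) = mu A.
Proof.
move=> mA; rewrite -[LHS]/(pushforward mu ((fun x => x + s) : R -> measurableTypeR R) A).
apply/esym/lebesgue_measure_unique => //=; first exact: measurable_shift.
move=> _ _ [[a b]] _ <-.
rewrite /pushforward.
rewrite [X in _ = mu X](_ : _ = `]a - s, b - s]%classic); last first.
  by apply/seteqP; split => x /=; rewrite !in_itv/=; lra.
rewrite !lebesgue_measure_itv/= !lte_fin ltrD2r -!EFinB.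
by case: ifP => // _; congr (_%:E); lra.
Qed.

Lemma measurable_preim_shift s (A : set R) :
  measurable A -> measurable ((fun x => x + s) @^-1` A).
Proof. by move=> mA; rewrite -[X in measurable X]setTI; exact: measurable_shift. Qed.

(** The rotation exchanges the two intervals of [0, 1) cut at [1 - s], and
    translates each of them. *)
Lemma lebesgue_measure_rotation s (A : set R) :
  measurable A -> (forall (x : R) (m : int), A (x + m%:~R) <-> A x) ->
  mu (`[0, 1[%classic `&` ((fun x => x + s) @^-1` A)) = mu (`[0, 1[%classic `&` A).
Proof.
move=> mA perA.
wlog s01 : s / 0 <= s < 1.
  move=> /(_ (fract s) (fract_itv s)) <-; congr (mu (_ `&` _)).
  apply/seteqP; split => x /=.
    by rewrite -(perA _ (- Num.floor s)) intrN -addrA.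
  by rewrite /fract addrA -intrN perA.
have -> : `[0, 1[%classic `&` ((fun x => x + s) @^-1` A) =
   (fun x => x + s) @^-1` (`[s, 1[%classic `&` A) `|`
   (fun x => x + (s - 1)) @^-1` (`[0, s[%classic `&` A).
  apply/seteqP; split => x /=; rewrite !in_itv/=.
  - move=> [x01 Ax]; have [xs|xs] := ltP (x + s) 1.
      by left; split=> //; lra.
    right; split; first by lra.
    by rewrite addrA -[-1]/((-1)%:~R : R)%R perA.
  - case=> [[h1 h2]|[h1 h2]]; first by split => //; lra.
    by split; [lra|move: h2; rewrite addrA -[-1]/((-1)%:~R : R)%R perA].
have -> : `[0, 1[%classic `&` A = (`[s, 1[%classic `&` A) `|` (`[0, s[%classic `&` A).
  apply/seteqP; split => x /=; rewrite !in_itv/=.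
    by move=> [x01 Ax]; case: (ltP x s) => xs; [right|left]; split => //; lra.
  by case=> [[h1 h2]|[h1 h2]]; split => //; lra.
rewrite !measureU//.
- by rewrite [X in (X + _)%E]lebesgue_measure_shift ?[X in (_ + X)%E]lebesgue_measure_shift//; exact: measurableI.
- exact: measurableI.
- exact: measurableI.
- by apply/seteqP; split => x //=; rewrite !in_itv/= => -[[h1 _] [h2 _]]; lra.
- by apply: measurable_preim_shift; exact: measurableI.
- by apply: measurable_preim_shift; exact: measurableI.
- by apply/seteqP; split => x //=; rewrite !in_itv/= => -[[h1 _] [h2 _]]; lra.
Qed.

Definition arc a s rho : set R :=
  `[0, 1[%classic `&` [set x | dist_int (x + s - a) < rho].

Lemma measurable_near a s rho : measurable [set x : R | dist_int (x + s - a) < rho].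
Proof.
have mf : measurable_fun setT (fun x : R => dist_int (x + s - a)).
  apply: measurableT_comp; first exact: measurable_dist_int.
  by apply: measurable_funB; first exact: measurable_shift.
have := @measurable_fun_ltr _ _ _ setT _ (fun=> rho) mf (measurable_cst _).
by move=> /(_ measurableT [set true]); rewrite setTI; apply.
Qed.

Lemma measurable_arc a s rho : measurable (arc a s rho).
Proof. by apply: measurableI => //; exact: measurable_near. Qed.

Lemma near_periodic a s rho (x : R) (m : int) :
  dist_int (x + m%:~R + s - a) < rho <-> dist_int (x + s - a) < rho.
Proof. by rewrite (_ : x + m%:~R + s - a = (x + s - a) + m%:~R) ?dist_intD//; ring. Qed.

(** By invariance the centre can be moved to [1/2], where the arc is an interval
    that does not wrap around the circle. *)
Lemma lebesgue_measure_arc a s rho : 0 <= rho <= 2^-1 ->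
  mu (arc a s rho) = (2 * rho)%:E.
Proof.
move=> rho0.
rewrite /arc.
have := @lebesgue_measure_rotation (a - s - 2^-1) [set x | dist_int (x + s - a) < rho]
  (measurable_near _ _ _) (near_periodic a s rho).
move=> <-.
rewrite [X in mu X](_ : _ = `]2^-1 - rho, 2^-1 + rho[%classic).
  rewrite lebesgue_measure_itv/= lte_fin; case: ltP => h; rewrite -?EFinB; congr (_%:E); lra.
apply/seteqP; split => x /=; rewrite !in_itv/=.
  move=> [x01]; rewrite (_ : x + _ + s - a = x - 2^-1); last by ring.
  move=> /dist_int_ltP [m]; rewrite ltr_norml => /andP[h1 h2].
  have m1 : m < 1 by rewrite -(ltr_int R) mulr1z; lra.
  have m2 : -1 < m by rewrite -(ltr_int R) mulrN1z; lra.
  have m0 : m = 0 by lia.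
  by move: h1 h2; rewrite m0; lra.
move=> /andP[h1 h2]; split; first by lra.
rewrite (_ : x + _ + s - a = x - 2^-1); last by ring.
by apply/dist_int_ltP; exists 0; rewrite subr0 ltr_norml; lra.
Qed.

Lemma lebesgue_measure_arcI_shift a s s' t rho rho' :
  mu (arc a (s + t) rho `&` arc a (s' + t) rho') = mu (arc a s rho `&` arc a s' rho').
Proof.
rewrite /arc setIACA [in RHS]setIACA !setIid.
rewrite -[RHS](@lebesgue_measure_rotation t).
- have h u (x : R) : x + (u + t) - a = x + t + u - a by ring.
  by congr (mu (_ `&` _)); apply/seteqP; split => x /=; rewrite !h.
- by apply: measurableI; exact: measurable_near.
- by move=> x m /=; rewrite !near_periodic.
Qed.

End Circle.

(** * Sums of indicators *)

Section Indicators.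
Context d (T : measurableType d) (R : realType) (mu : {measure set T -> \bar R}).

Lemma integral_indic_comb (s : seq (R * set T)) :
  (forall p, p \in s -> 0 <= p.1 /\ measurable p.2) ->
  (\int[mu]_x (\sum_(p <- s) p.1 * \1_(p.2) x)%:E =
   \sum_(p <- s) (p.1)%:E * mu p.2)%E.
Proof.
elim: s => [|p s ih] hs.
  by rewrite big_nil; under eq_integral do rewrite big_nil; rewrite integral0.
have [p0 mp] := hs p (mem_head _ _).
have hs' q : q \in s -> 0 <= q.1 /\ measurable q.2.
  by move=> qs; apply: hs; rewrite inE qs orbT.
rewrite big_cons -ih//; under eq_integral do rewrite big_cons EFinD.
have ms : measurable_fun setT (fun x => (\sum_(q <- s) q.1 * \1_(q.2) x)%:E).
  apply/measurable_EFinP; elim: (s) hs' => [|q t iht] ht.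
    by under eq_fun do rewrite big_nil; exact: measurable_cst.
  under eq_fun do rewrite big_cons.
  apply: measurable_funD.
    apply: measurable_funM => //; apply: measurable_indic.
    by have [] := ht q (mem_head _ _).
  by apply: iht => r rt; apply: ht; rewrite inE rt orbT.
rewrite ge0_integralD//.
- congr (_ + _)%E; under eq_integral do rewrite EFinM.
  rewrite ge0_integralZl_EFin//; last by apply/measurable_EFinP; exact: measurable_indic.
  by rewrite integral_indic// setIT.
- by move=> x _; rewrite lee_fin mulr_ge0.
- by apply/measurable_EFinP; apply: measurable_funM => //; exact: measurable_indic.
- move=> x _; rewrite lee_fin big_seq sumr_ge0// => q qs.
  by have [q0 _] := hs' q qs; rewrite mulr_ge0.
Qed.

(** The only use of integration in the variance estimates: a pointwise inequality
    between two nonnegative combinations of indicators can be integrated. *)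
Lemma le_indic_comb (s t : seq (R * set T)) :
  (forall p, p \in s -> 0 <= p.1 /\ measurable p.2) ->
  (forall p, p \in t -> 0 <= p.1 /\ measurable p.2) ->
  (forall x, \sum_(p <- s) p.1 * \1_(p.2) x <= \sum_(p <- t) p.1 * \1_(p.2) x) ->
  (\sum_(p <- s) (p.1)%:E * mu p.2 <= \sum_(p <- t) (p.1)%:E * mu p.2)%E.
Proof.
move=> hs ht st; rewrite -!integral_indic_comb//.
have mf (u : seq (R * set T)) : (forall p, p \in u -> 0 <= p.1 /\ measurable p.2) ->
    measurable_fun setT (fun x => (\sum_(q <- u) q.1 * \1_(q.2) x)%:E).
  move=> hu; apply/measurable_EFinP; elim: u hu => [|q u iht] hu.
    by under eq_fun do rewrite big_nil; exact: measurable_cst.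
  under eq_fun do rewrite big_cons.
  apply: measurable_funD.
    apply: measurable_funM => //; apply: measurable_indic.
    by have [] := hu q (mem_head _ _).
  by apply: iht => r rt; apply: hu; rewrite inE rt orbT.
have f0 (u : seq (R * set T)) x : (forall p, p \in u -> 0 <= p.1 /\ measurable p.2) ->
    (0%R <= (\sum_(q <- u) q.1 * \1_(q.2) x)%:E)%E.
  move=> hu; rewrite lee_fin big_seq sumr_ge0// => q qs.
  by have [q0 _] := hu q qs; rewrite mulr_ge0.
apply: ge0_le_integral => //.
all: by [exact: mf | move=> x _; exact: f0 | move=> x _; rewrite lee_fin].
Qed.

Variables (I : eqType) (A : I -> set T).
Hypothesis mA : forall i, measurable (A i).

Lemma le_sum_measureI (D : set T) (s : seq I) (c : R) : measurable D -> 0 <= c ->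
  (forall x, D x -> \sum_(i <- s) \1_(A i) x <= c :> R) ->
  (\sum_(i <- s) mu (D `&` A i) <= c%:E * mu D)%E.
Proof.
move=> mD c0 h.
have := @le_indic_comb [seq (1, D `&` A i) | i <- s] [:: (c, D)].
rewrite !big_map !big_seq1/=.
under eq_bigr do rewrite mul1e.
apply.
- by move=> _ /mapP[i _ ->]/=; split=> //; exact: measurableI.
- by move=> p; rewrite inE => /eqP ->.
- move=> x; rewrite big_map big_seq1 /=.
  under eq_bigr do rewrite mul1r indicI/=.
  rewrite -mulr_sumr mulrC; have [Dx|Dx] := boolP (x \in D).
    by rewrite !indicE Dx !mulr1; apply: h; exact: set_mem.
  by rewrite !indicE (negbTE Dx) !mulr0.
Qed.

Variables (D : set T) (s : seq I).
Hypothesis mD : measurable D.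
Hypothesis muD : mu D = 1%E.
Hypothesis AD : forall i, A i `<=` D.

Let fin i j : mu (A i `&` A j) \is a fin_num.
Proof.
rewrite ge0_fin_numE//; apply: (@le_lt_trans _ _ (mu D)); last by rewrite muD ltry.
by apply: le_measure; rewrite ?inE//; [exact: measurableI|move=> x [/AD]].
Qed.

Let fin1 i : mu (A i) \is a fin_num.
Proof. by rewrite -(setIid (A i)); exact: fin. Qed.

Lemma measurable_sum_indic : measurable_fun setT (fun x => \sum_(i <- s) \1_(A i) x : R).
Proof.
elim: (s) => [|i u ih]; first by under eq_fun do rewrite big_nil; exact: measurable_cst.
by under eq_fun do rewrite big_cons; apply: measurable_funD => //; exact: measurable_indic.
Qed.

(** On [E] one has [eta ^+ 2 <= (X - M) ^+ 2]. Expanding this square gives a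
    pointwise inequality between combinations of indicators, in which [X ^+ 2]
    is the sum of the indicators of the pairwise intersections. *)
Lemma chebyshev_sum_indic (eta : R) : 0 < eta ->
  let M := \sum_(i <- s) fine (mu (A i)) in
  let E := D `&` [set x | eta <= `|\sum_(i <- s) \1_(A i) x - M| ] in
  measurable E /\
  (mu E <= ((\sum_(i <- s) \sum_(j <- s) fine (mu (A i `&` A j)) - M ^+ 2)
             / eta ^+ 2)%:E)%E.
Proof.
move=> eta0 M E.
have M0 : 0 <= M by apply: sumr_ge0 => i _; exact: fine_ge0.
have mE : measurable E.
  apply: measurableI => //.
  have mf : measurable_fun setT (fun x => `|\sum_(i <- s) \1_(A i) x - M| : R).
    apply: measurableT_comp => //; apply: measurable_funB => //.
    exact: measurable_sum_indic.
  have := @measurable_fun_ler _ _ _ setT (fun=> eta) _ (measurable_cst _) mf.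
  by move=> /(_ measurableT [set true]); rewrite setTI; apply.
split=> //.
have finE : mu E \is a fin_num.
  rewrite ge0_fin_numE//; apply: (@le_lt_trans _ _ (mu D)); last by rewrite muD ltry.
  by apply: le_measure; rewrite ?inE//; move=> x [].
have := @le_indic_comb ((eta ^+ 2, E) :: [seq (2 * M, A i) | i <- s])
  ((M ^+ 2, D) :: [seq (1, A p.1 `&` A p.2) | p <- [seq (i, j) | i <- s, j <- s]]).
rewrite !big_cons !big_map/= big_allpairs/= muD mule1.
under [X in (_ -> _ -> _ -> _ <= _ + X)%E]eq_bigr => i _ do
  under eq_bigr => j _ do rewrite mul1e -(fineK (fin i j)).
under [X in (_ -> _ -> _ -> _ + X <= _)%E]eq_bigr => i _ do
  rewrite -(fineK (fin1 i)) -EFinM.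
under [X in (_ -> _ -> _ -> _ <= _ + X)%E]eq_bigr => i _ do rewrite sumEFin.
rewrite !sumEFin -(fineK finE) -EFinM -!EFinD !lee_fin -mulr_sumr -/M => h.
rewrite ler_pdivlMr ?exprn_gt0//.
suff : eta ^+ 2 * fine (mu E) + 2 * M * M <=
  M ^+ 2 + \sum_(i <- s) \sum_(i0 <- s) fine (mu (A i `&` A i0)) by lra.
apply: h.
- move=> p; rewrite inE => /orP[/eqP ->/=|/mapP[i _ ->]/=]; split => //.
    exact: sqr_ge0.
  by rewrite mulr_ge0.
- move=> p; rewrite inE => /orP[/eqP ->/=|/mapP[i _ ->]/=]; split => //.
    exact: sqr_ge0.
  exact: measurableI.
move=> x; rewrite !big_cons !big_map/= big_allpairs/=.
under [X in _ + X <= _]eq_bigr do rewrite -mulrC.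
rewrite -mulr_suml.
under [X in _ <= _ + X]eq_bigr => i _ do
  (under eq_bigr => j _ do rewrite mul1r indicI/=; rewrite -mulr_sumr).
rewrite -mulr_suml.
have [Dx|Dx] := boolP (x \in D); last first.
  have zA i : \1_(A i) x = 0 :> R.
    by rewrite indicE; case: (boolP (x \in A i)) => // /set_mem/AD/mem_set; rewrite (negbTE Dx).
  rewrite big1 ?mul0r ?addr0; last by move=> i _; exact: zA.
  rewrite !indicE (negbTE Dx) mulr0.
  case: (boolP (x \in E)) => [/set_mem[/mem_set]|_]; last by rewrite mulr0.
  by rewrite (negbTE Dx).
rewrite [\1_D x]indicE Dx mulr1 indicE.
set X := \sum_(i <- s) _.
have [/set_mem[_ /= h1]|_] := boolP (x \in E); last first.
  rewrite mulr0 add0r; have := sqr_ge0 (X - M).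
  by rewrite -/X !expr2; lra.
have : eta ^+ 2 <= `|X - M| ^+ 2 by rewrite lerXn2r// nnegrE// ltW.
by rewrite -normrX ger0_norm ?sqr_ge0// !expr2 mulr1; lra.
Qed.

End Indicators.

(** * Continued fractions *)

Fixpoint cf_den (a : nat -> nat) (n : nat) : nat :=
  if n is m.+1 then
    (if m is l.+1 then a n * cf_den a m + cf_den a l else a 1)%N
  else 1%N.

Fixpoint cf_num (a : nat -> nat) (n : nat) : nat :=
  if n is m.+1 then
    (if m is l.+1 then a n * cf_num a m + cf_num a l else 1)%N
  else 0%N.

Lemma cf_denSS a n : cf_den a n.+2 = (a n.+2 * cf_den a n.+1 + cf_den a n)%N.
Proof. by []. Qed.

Lemma cf_numSS a n : cf_num a n.+2 = (a n.+2 * cf_num a n.+1 + cf_num a n)%N.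
Proof. by []. Qed.

Section Denominators.
Variable a : nat -> nat.
Hypothesis a_gt0 : forall i, (1 <= i)%N -> (1 <= a i)%N.
Local Notation q := (cf_den a).

Lemma cf_den_gt0 n : (0 < q n)%N.
Proof.
elim/ltn_ind: n => -[|[|n]] ih //; first exact: a_gt0.
by rewrite cf_denSS addn_gt0 [X in _ || X]ih ?orbT.
Qed.

Lemma cf_den_leS n : (q n <= q n.+1)%N.
Proof.
case: n => [|n]; first exact: a_gt0.
by rewrite cf_denSS; have := @a_gt0 n.+2 isT; nia.
Qed.

Lemma cf_den_le m n : (m <= n)%N -> (q m <= q n)%N.
Proof. by apply: (homo_leq (r := leq)) => //; [exact: leq_trans|exact: cf_den_leS]. Qed.

Lemma cf_den_double n : (2 * q n <= q n.+2)%N.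
Proof.
by rewrite cf_denSS; have := cf_den_leS n; have := @a_gt0 n.+2 isT; nia.
Qed.

Lemma cf_den_leM n : (q n.+1 <= (a n.+1).+1 * q n)%N.
Proof.
case: n => [|n]; first by rewrite /= muln1; lia.
by rewrite cf_denSS; have := cf_den_leS n; nia.
Qed.

Lemma cf_den_sum n : (\sum_(0 <= m < n) q m <= 2 * q n)%N.
Proof.
suff h k : (\sum_(0 <= m < k.+1) q m <= q k.+1 + q k)%N.
  case: n => [|n]; first by rewrite big_geq.
  by apply: (leq_trans (h n)); have := cf_den_leS n; lia.
elim: k => [|k ih]; first by rewrite big_nat1 /=; lia.
rewrite big_nat_recr//; apply: (leq_trans (leq_add ih (leqnn _))).
by rewrite (cf_denSS a k); have := @a_gt0 k.+2 isT; nia.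
Qed.

Lemma cf_den_exp n s : (2 ^ s * q n <= q (n + 2 * s))%N.
Proof.
elim: s => [|s ih]; first by rewrite mul1n muln0 addn0.
rewrite expnS -mulnA mulnS addnCA addnC addn2.
by apply: leq_trans (cf_den_double _); rewrite leq_mul2l ih.
Qed.

Lemma cf_det n : ((cf_num a n.+1)%:Z * (q n)%:Z - (cf_num a n)%:Z * (q n.+1)%:Z = (-1) ^+ n)%R.
Proof.
elim: n => [|n ih]; first by rewrite /=; lia.
rewrite exprS -ih cf_denSS cf_numSS !PoszD !PoszM; ring.
Qed.

Lemma coprime_cf n : coprimez (cf_num a n)%:Z (q n)%:Z.
Proof.
apply/coprimezP.
exists (- (-1) ^+ n * (q n.+1)%:Z, (-1) ^+ n * (cf_num a n.+1)%:Z) => /=.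
transitivity ((-1) ^+ n * ((cf_num a n.+1)%:Z * (q n)%:Z - (cf_num a n)%:Z * (q n.+1)%:Z) : int).
  by ring.
by rewrite cf_det -expr2 sqrr_sign.
Qed.
End Denominators.

Section Expansion.
Variables (R : realType) (alpha : R) (a : nat -> nat).
Hypothesis alpha01 : 0 <= alpha < 1.
Hypothesis alphaI : irrational alpha.
Hypothesis alphaE : cf_expansion alpha a.
Local Notation q := (cf_den a).
Local Notation p := (cf_num a).

Let a_gt0 i : (1 <= i)%N -> (1 <= a i)%N. Proof. exact: alphaE.1. Qed.

(** The value of the continued fraction whose entries are [a n.+1], [a n.+2] and
    so on. *)
Fixpoint cf_tail n : R :=
  if n is m.+1 then (cf_tail m)^-1 - (a n)%:R else alpha.

Lemma irrational_neq0 (x : R) : irrational x -> x != 0.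
Proof. by apply: contra_notN => /eqP ->; exists 0 => //; rewrite rmorph0. Qed.

Lemma irrational_inv_sub (x : R) (m : nat) : irrational x -> irrational (x^-1 - m%:R).
Proof.
move=> xi [y _ xy]; apply: xi; exists ((y + m%:R)^-1) => //.
by rewrite fmorphV rmorphD /= xy rmorph_nat subrK invrK.
Qed.

Lemma cfrac_ge0 k n : 0 <= cfrac R a k n.
Proof.
by elim: n k => [|n ih] k //=; rewrite invr_ge0 addr_ge0.
Qed.

(** Convergence of the truncations passes from one tail to the next, and
    irrationality keeps every tail away from 0 and 1. *)
Lemma cf_tailP n : [/\ irrational (cf_tail n), 0 < cf_tail n < 1 &
  cfrac R a n.+1 m @[m --> \oo] --> cf_tail n].
Proof.
have pos x k : irrational x -> cfrac R a k m @[m --> \oo] --> x -> 0 < x.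
  move=> xi cx; rewrite lt_neqAle eq_sym irrational_neq0//=.
  rewrite -(cvg_lim _ cx)//; apply: limr_ge; first by apply/cvg_ex; exists x.
  by apply: nearW => m; exact: cfrac_ge0.
have step x k : irrational x -> cfrac R a k.+1 m @[m --> \oo] --> x ->
    cfrac R a k.+2 m @[m --> \oo] --> x^-1 - (a k.+1)%:R.
  move=> xi cx; have x0 := irrational_neq0 xi.
  have -> : (fun m => cfrac R a k.+2 m) =
            (fun m => (cfrac R a k.+1 m.+1)^-1 - (a k.+1)%:R).
    by apply/funext => m /=; rewrite invrK; ring.
  apply: cvgB; last exact: cvg_cst.
  by apply: cvgV => //; rewrite (cvg_shiftS (fun m => cfrac R a k.+1 m)).
elim: n => [|n [ti t01 ct]].
  have := alphaE.2 => ca; split => //=.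
  by rewrite (pos _ _ alphaI ca); case/andP: alpha01.
have ti' := @irrational_inv_sub _ (a n.+1) ti.
have ct' := step _ _ ti ct.
have p' := pos _ _ ti' ct'.
split => //=; rewrite p' /=.
have p'' := pos _ _ (@irrational_inv_sub _ (a n.+2) ti') (step _ _ ti' ct').
have : 1 < (cf_tail n.+1)^-1.
  have : 1 <= (a n.+2)%:R :> R by rewrite ler1n a_gt0.
  by move: p'' => /=; lra.
by rewrite invf_gt1//=; lra.
Qed.

(** This product of tails is the absolute value of [q n * alpha - p n], see
    [cf_errE]. *)
Fixpoint cf_err n : R := cf_tail n * (if n is m.+1 then cf_err m else 1).

Lemma cf_tailS n : cf_tail n.+1 = (cf_tail n)^-1 - (a n.+1)%:R.
Proof. by []. Qed.

Lemma cf_errS n : cf_err n.+1 = cf_tail n.+1 * cf_err n.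
Proof. by []. Qed.

Lemma cf_err0 : cf_err 0 = alpha.
Proof. by rewrite /= mulr1. Qed.

Lemma cf_err1 : cf_err 1 = 1 - (a 1)%:R * alpha.
Proof.
have [_ /andP[h _] _] := cf_tailP 0.
by rewrite cf_errS cf_tailS cf_err0 mulrBl mulVf// gt_eqF.
Qed.

Lemma cf_err_gt0 n : 0 < cf_err n.
Proof.
elim: n => [|n ih]; have [_ /andP[h _] _] := cf_tailP 0.
  by rewrite /= mulr1.
by have [_ /andP[h' _] _] := cf_tailP n.+1; exact: mulr_gt0.
Qed.

Lemma cf_err_rec n : cf_err n = (a n.+2)%:R * cf_err n.+1 + cf_err n.+2.
Proof.
have [_ /andP[h _] _] := cf_tailP n.+1.
rewrite !cf_errS (cf_tailS n.+1).
by move: (cf_tail n.+1) (cf_err n) h => x y x0; field; rewrite gt_eqF.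
Qed.

Lemma cf_err_bezout n : (q n.+1)%:R * cf_err n + (q n)%:R * cf_err n.+1 = 1.
Proof.
elim: n => [|n ih]; first by rewrite cf_err0 cf_err1 /=; ring.
rewrite -[RHS]ih (cf_denSS a n) natrD natrM [cf_err n in RHS]cf_err_rec; ring.
Qed.

Lemma cf_errE n : cf_err n = (-1) ^+ n * ((q n)%:R * alpha - (p n)%:R).
Proof.
elim/ltn_ind: n => -[|[|n]] ih.
- by rewrite cf_err0 /= expr0; ring.
- by rewrite cf_err1 expr1 /=; ring.
- have -> : cf_err n.+2 = cf_err n - (a n.+2)%:R * cf_err n.+1.
    by rewrite (cf_err_rec n); ring.
  rewrite (ih n.+1)// (ih n)// (cf_denSS a n) (cf_numSS a n) !natrD !natrM !exprS; ring.
Qed.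

Lemma cf_errS_lt n : cf_err n.+1 < cf_err n.
Proof.
have [_ /andP[h0 h1] _] := cf_tailP n.+1.
by rewrite cf_errS -[ltRHS]mul1r ltr_pM2r// cf_err_gt0.
Qed.

Lemma cf_err_lower n : 1 <= ((q n.+1)%:R + (q n)%:R) * cf_err n.
Proof.
rewrite -[leLHS](cf_err_bezout n) mulrDl lerD2l ler_wpM2l//.
exact/ltW/cf_errS_lt.
Qed.

Lemma cf_err_upper n : (q n)%:R * cf_err n <= 1.
Proof.
rewrite -[leRHS](cf_err_bezout n); apply: ler_wpDr.
  by rewrite mulr_ge0// ltW// cf_err_gt0.
by rewrite ler_wpM2r ?ler_nat ?cf_den_leS// ltW// cf_err_gt0.
Qed.

(** Law of best approximation: in the basis of [Z^2] formed by two consecutive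
    convergents, the coordinates [x, y] of [(d, m)] satisfy [x != 0] and
    [x * y <= 0], and the errors of these convergents have opposite signs, so
    that the two contributions to [d * alpha - m] add up in absolute value. *)
Lemma cf_best_approx n (d : nat) (m : int) : (0 < d < q n.+1)%N ->
  cf_err n <= `|d%:R * alpha - m%:~R|.
Proof.
move=> /andP[d0 dq].
set e : int := (-1) ^+ n.
have e2 : e * e = 1 by rewrite /e -expr2 sqrr_sign.
pose x : int := e * (d%:Z * (p n.+1)%:Z - m * (q n.+1)%:Z).
pose y : int := e * (m * (q n)%:Z - d%:Z * (p n)%:Z).
have det := cf_det a n; rewrite -/e in det.
have dE : d%:Z = x * (q n)%:Z + y * (q n.+1)%:Z.
  transitivity (e * (e * d%:Z)); first by rewrite mulrA e2 mul1r.
  by rewrite -[X in e * (X * _)]det /x /y; ring.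
have mE : m = x * (p n)%:Z + y * (p n.+1)%:Z.
  transitivity (e * (e * m)); first by rewrite mulrA e2 mul1r.
  by rewrite -[X in e * (X * _)]det /x /y; ring.
clearbody x y.
have eE : d%:R * alpha - m%:~R = (-1) ^+ n * (x%:~R * cf_err n - y%:~R * cf_err n.+1).
  have -> : d%:R = x%:~R * (q n)%:R + y%:~R * (q n.+1)%:R :> R.
    by rewrite -[d%:R]/(d%:Z%:~R) dE intrD !intrM.
  rewrite [in LHS]mE intrD !intrM !cf_errE exprS -!pmulrn.
  set s : R := (-1) ^+ n; have s2 : s * s = 1 by rewrite /s -expr2 sqrr_sign.
  transitivity (s * s * (x%:~R * ((q n)%:R * alpha - (p n)%:R) + y%:~R * ((q n.+1)%:R * alpha - (p n.+1)%:R))); last by ring.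
  by rewrite s2; ring.
rewrite eE normrM normrX normrN normr1 expr1n mul1r.
have q0 := cf_den_gt0 a_gt0 n.
have t0 := cf_err_gt0 n; have t1 := cf_err_gt0 n.+1.
have [y0|y0] := lerP y 0.
  have x0 : 0 < x by clear - dE d0 q0 y0 dq; nia.
  have x1 : 1 <= x%:~R :> R by rewrite ler1z; lia.
  have y1 : 0 <= - y%:~R :> R by rewrite oppr_ge0 lerz0.
  rewrite (le_trans _ (ler_norm _))//.
  have h1 : cf_err n <= x%:~R * cf_err n by rewrite ler_peMl// ltW.
  have h2 := mulr_ge0 y1 (ltW t1).
  by lra.
have x0 : x < 0 by clear - dE d0 q0 y0 dq; nia.
have x1 : 1 <= - x%:~R :> R by rewrite -intrN ler1z; lia.
have y1 : 0 <= y%:~R :> R by rewrite ler0z; lia.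
rewrite -normrN (le_trans _ (ler_norm _))//.
have h1 : cf_err n <= - x%:~R * cf_err n by rewrite ler_peMl// ltW.
have h2 := mulr_ge0 y1 (ltW t1).
by lra.
Qed.

End Expansion.

Arguments cf_den : simpl never.
Arguments cf_num : simpl never.

(** * Counting orbit points in an interval *)

Section Counting.
Variable R : realType.

Lemma size_int_in_itv (s : seq int) (c h : R) : 0 <= h -> uniq s ->
  (forall z, z \in s -> `|c - z%:~R| < h) -> (size s)%:R <= 2 * h + 1.
Proof.
move=> h0 us hs.
pose lo := Num.floor (c - h).
pose K := `|Num.floor (2 * h + 1)|%N.
have KE : (K%:R : R) = (Num.floor (2 * h + 1))%:~R.
  by rewrite /K -[K%:R]pmulrn natr_absz ger0_norm// floor_ge0; lra.
have loP := floor_itv (c - h); rewrite -/lo intrD in loP.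
have Kle : K%:R <= 2 * h + 1 :> R by rewrite KE floor_le_tmp.
apply: le_trans Kle; rewrite ler_nat.
rewrite -[K](size_iota 1) -(size_map (fun k : nat => lo + k%:Z)).
apply: uniq_leq_size => // z zs.
have := hs z zs; rewrite ltr_norml => /andP[z1 z2].
have zlo : 0 < z - lo by rewrite -(ltr_int R) intrB; lra.
have zhi : z - lo <= Num.floor (2 * h + 1).
  by rewrite floor_ge_int intrB; lra.
apply/mapP; exists `|z - lo|%N; last by lia.
by rewrite mem_iota; rewrite /K; lia.
Qed.

Variables (alpha : R) (a : nat -> nat).
Hypothesis alpha01 : 0 <= alpha < 1.
Hypothesis alphaI : irrational alpha.
Hypothesis alphaE : cf_expansion alpha a.
Local Notation q := (cf_den a).
Local Notation p := (cf_num a).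

(** The Denjoy-Koksma bound for an arc: since [q n * alpha] is within [1 / q n]
    of [p n], which is prime to [q n], the points [y - j * alpha] multiplied by
    [q n] are within distance [1] of [q n] distinct integers modulo [q n]. *)
Lemma count_orbit_arc n (y rho : R) : 0 <= rho ->
  (count (fun j => dist_int (y - j%:R * alpha) < rho) (iota 0 (q n)))%:R
    <= 2 * rho * (q n)%:R + 3.
Proof.
move=> rho0.
have q0 : (0 < q n)%N by apply: cf_den_gt0; exact: alphaE.1.
pose m j : int := xget 0 [set m : int | `|y - j%:R * alpha - m%:~R| < rho].
pose z j : int := j%:Z * (p n)%:Z + (q n)%:Z * m j.
rewrite -size_filter -(size_map z).
set s := [seq z j | j <- _].
apply: le_trans (_ : 2 * (rho * (q n)%:R + 1) + 1 <= _); last by lra.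
apply: (@size_int_in_itv s ((q n)%:R * y)).
- by rewrite addr_ge0// mulr_ge0.
- rewrite map_inj_in_uniq ?filter_uniq ?iota_uniq// => i j.
  rewrite !mem_filter !mem_iota/= !add0n => /andP[_ iq] /andP[_ jq] zij.
  have : ((q n)%:Z %| (i%:Z - j%:Z) * (p n)%:Z)%Z.
    apply/dvdzP; exists (m j - m i); move: zij; rewrite /z; move: (m i) (m j) (p n) (q n).
    by move=> u v w t; lia.
  rewrite Gauss_dvdzl; last by rewrite coprimez_sym coprime_cf//; exact: alphaE.1.
  move=> /dvdzP[k kE].
  suff : k = 0 by move=> k0; move: kE; rewrite k0 mul0r; lia.
  by clear -kE iq jq; nia.
- move=> w /mapP[j]; rewrite mem_filter mem_iota add0n/= => /andP[hj jq] ->.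
  have mj : `|y - j%:R * alpha - (m j)%:~R| < rho.
    by move/dist_int_ltP : hj => [m0 hm0]; exact: (@xgetPex _ 0 [set m : int | `|y - j%:R * alpha - m%:~R| < rho] (ex_intro _ m0 hm0)).
  rewrite [z j]/(_ + _) intrD !intrM -!pmulrn.
  have eE := cf_errE alpha01 alphaI alphaE n.
  have e1 := cf_err_upper alpha01 alphaI alphaE n.
  have e0 := cf_err_gt0 alpha01 alphaI alphaE n.
  have -> : (q n)%:R * y - (j%:R * (p n)%:R + (q n)%:R * (m j)%:~R) =
     (q n)%:R * (y - j%:R * alpha - (m j)%:~R) + j%:R * ((q n)%:R * alpha - (p n)%:R) by ring.
  apply: le_lt_trans (ler_normD _ _) _; rewrite !normrM !normr_nat.
  have -> : `|(q n)%:R * alpha - (p n)%:R| = cf_err alpha a n.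
    by rewrite -[RHS]gtr0_norm// eE normrM normrX normrN normr1 expr1n mul1r.
  apply: ltr_leD.
    by rewrite mulrC ltr_pM2r// ltr0n.
  apply: le_trans e1; apply: ler_wpM2r; first exact: ltW.
  by rewrite ler_nat ltnW.
Qed.

End Counting.

(** * Second moments of sums over windows *)

Section Windows.
Variables (R : realType) (alpha c : R) (a : nat -> nat).
Hypothesis alpha01 : 0 <= alpha < 1.
Hypothesis alphaI : irrational alpha.
Hypothesis alphaE : cf_expansion alpha a.
Local Notation q := (cf_den a).
Local Notation mu := (@lebesgue_measure R).

(** The pair [u = (i, rho)] stands for the event that the [i]-th iterate of the
    rotation falls within [rho] of [c]. *)
Definition visit (u : nat * R) : set R := arc c (u.1%:R * alpha) u.2.

Definition visitI (u v : nat * R) : R := fine (mu (visit u `&` visit v)).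

Definition mean (l : seq (nat * R)) : R := \sum_(u <- l) 2 * u.2.

Definition admissible (l : seq (nat * R)) := forall u, u \in l -> 0 <= u.2 <= 2^-1.

Definition window w L rho : seq (nat * R) := [seq ((w + j)%N, rho) | j <- iota 0 L].

Lemma visit_fin u : 0 <= u.2 <= 2^-1 -> mu (visit u) = (2 * u.2)%:E.
Proof. exact: lebesgue_measure_arc. Qed.

Lemma measurable_visit u : measurable (visit u).
Proof. exact: measurable_arc. Qed.

Lemma visitIC u v : visitI u v = visitI v u.
Proof. by rewrite /visitI setIC. Qed.

Lemma size_window w L rho : size (window w L rho) = L.
Proof. by rewrite size_map size_iota. Qed.

Lemma mean_window w L rho : mean (window w L rho) = 2 * rho * L%:R.
Proof.
rewrite /mean /window big_map /= big_const_seq count_predT size_iota.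
by rewrite iter_addr_0 mulr_natr.
Qed.

Lemma mean_cat l l' : mean (l ++ l') = mean l + mean l'.
Proof. by rewrite /mean big_cat. Qed.

(** Rotating back by the time of each event of the window turns the sum into the
    integral, over an arc of radius [rho], of the number of points of an orbit
    segment of length [q n] that lie in an arc of radius [u.2]. By
    [count_orbit_arc] the covariance is at most [6 * rho], whatever [n] is. *)
Lemma sum_visitI_window (u : nat * R) w n rho :
  0 <= u.2 <= 2^-1 -> 0 <= rho <= 2^-1 ->
  \sum_(v <- window w (q n) rho) visitI u v <= 2 * u.2 * (2 * rho * (q n)%:R) + 6 * rho.
Proof.
move=> u0 rho0.
pose B j := arc c (u.1%:R * alpha - (w + j)%:R * alpha) u.2.
have fD : mu (arc c 0 rho) = (2 * rho)%:E by exact: lebesgue_measure_arc.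
have vE j : visitI u ((w + j)%N, rho) = fine (mu (arc c 0 rho `&` B j)).
  rewrite /visitI /visit setIC -(lebesgue_measure_arcI_shift c 0 _ ((w + j)%:R * alpha)) add0r subrK.
  by [].
have fB j : mu (arc c 0 rho `&` B j) \is a fin_num.
  rewrite ge0_fin_numE//; apply: (@le_lt_trans _ _ (mu (arc c 0 rho))); last by rewrite fD ltry.
  apply: le_measure; rewrite ?inE; last by move=> x [].
    by apply: measurableI; exact: measurable_arc.
  exact: measurable_arc.
rewrite /window big_map; under eq_bigr do rewrite vE.
have h C : 0 <= C -> (forall x, arc c 0 rho x ->
    \sum_(j <- iota 0 (q n)) \1_(B j) x <= C) ->
    \sum_(j <- iota 0 (q n)) fine (mu (arc c 0 rho `&` B j)) <= C * (2 * rho).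
  move=> C0 hC; rewrite -lee_fin -sumEFin EFinM -fD.
  under eq_bigr do rewrite fineK//.
  by apply: le_sum_measureI => // *; exact: measurable_arc.
apply: le_trans (h (2 * u.2 * (q n)%:R + 3) _ _) _.
- by rewrite addr_ge0// !mulr_ge0//; case/andP: u0.
- move=> x _.
  have := count_orbit_arc alpha01 alphaI alphaE n (x + u.1%:R * alpha - w%:R * alpha - c).
  move=> /(_ u.2); case/andP: (u0) => u00 _ /(_ u00); apply: le_trans.
  rewrite -sum1_count natr_sum [leRHS]big_mkcond/=; apply: ler_sum => j _.
  rewrite indicE; case: (boolP (x \in B j)) => [|_]; last by case: ifP.
  move=> /set_mem[_ /=]; rewrite [X in dist_int X](_ : _ = x + u.1%:R * alpha - w%:R * alpha - c - j%:R * alpha) ?natrD; last by ring.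
  by move=> ->.
- by lra.
Qed.

Lemma sum_visitI_lwindow l w n rho :
  admissible l -> 0 <= rho <= 2^-1 ->
  \sum_(u <- l) \sum_(v <- window w (q n) rho) visitI u v
    <= mean l * mean (window w (q n) rho) + 6 * rho * (size l)%:R.
Proof.
move=> hl rho0; rewrite mean_window /mean mulr_suml.
have -> : 6 * rho * (size l)%:R = \sum_(u <- l) 6 * rho.
  by rewrite big_const_seq count_predT iter_addr_0 mulr_natr.
rewrite -big_split/= big_seq [leRHS]big_seq; apply: ler_sum => u ul.
by apply: sum_visitI_window => //; exact: hl.
Qed.

(** A common point of the two events would bring [(j - i) * alpha] closer to an
    integer than the law of best approximation allows. *)
Lemma visitI_disjoint n (i j : nat) (rho rho' : R) :
  i != j -> (i < j + q n.+1)%N -> (j < i + q n.+1)%N ->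
  rho + rho' <= cf_err alpha a n -> visitI (i, rho) (j, rho') = 0.
Proof.
wlog ij : i j rho rho' / (i < j)%N.
  move=> h ij h1 h2 h3; have [ltij|] := ltnP i j; first exact: h.
  rewrite leq_eqVlt eq_sym (negbTE ij)/= => ji; rewrite visitIC.
  by apply: h => //; rewrite 1?eq_sym// addrC.
move=> _ _ jq hr.
rewrite /visitI (_ : _ `&` _ = set0) ?measure0//.
apply/seteqP; split => x //= -[[_ /= /dist_int_ltP[m hm]] [_ /= /dist_int_ltP[m' hm']]].
have := @cf_best_approx _ _ _ alpha01 alphaI alphaE n (j - i)%N (m' - m).
move=> /(_ _); rewrite subn_gt0 ij ltn_subLR; last exact: ltnW.
move=> /(_ jq); rewrite natrB; last exact: ltnW.
apply/negP; rewrite -ltNge; apply: lt_le_trans hr.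
rewrite (_ : _ - _ = (x + j%:R * alpha - c - m'%:~R) - (x + i%:R * alpha - c - m%:~R)).
  by apply: le_lt_trans (ler_normB _ _) _; lra.
by rewrite intrB; ring.
Qed.

(** The radius is constant on each window because the bound on covariances holds
    only for sums over whole windows of length [q n] with a single radius. *)
Definition block w L K (rho : nat -> R) : seq (nat * R) :=
  flatten [seq window (w + k * L) L (rho k) | k <- iota 0 K].

Lemma mean_block w L K rho : mean (block w L K rho) = 2 * L%:R * \sum_(k <- iota 0 K) rho k.
Proof.
rewrite /mean /block big_flatten big_map mulr_sumr; apply: eq_bigr => k _.
by rewrite -/(mean _) mean_window; ring.
Qed.

Lemma size_block w L K rho : size (block w L K rho) = (K * L)%N.
Proof.
rewrite /block size_flatten /shape -map_comp sumnE big_map.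
under eq_bigr do rewrite /= size_window.
by rewrite big_const_seq count_predT size_iota iter_addn_0 mulnC.
Qed.

Lemma admissible_block w L K rho :
  (forall k, (k < K)%N -> 0 <= rho k <= 2^-1) -> admissible (block w L K rho).
Proof.
move=> h u /flatten_mapP[k]; rewrite mem_iota add0n => /andP[_ kK].
by move=> /mapP[j _ ->]/=; exact: h.
Qed.

End Windows.

(** * The variance of a system of windows *)

Section System.
Variables (R : realType) (alpha c : R) (a : nat -> nat).
Hypothesis alpha01 : 0 <= alpha < 1.
Hypothesis alphaI : irrational alpha.
Hypothesis alphaE : cf_expansion alpha a.
Local Notation q := (cf_den a).
Local Notation mu := (@lebesgue_measure R).
Local Notation visitI := (visitI alpha c).

Let a_gt0 : forall i, (1 <= i)%N -> (1 <= a i)%N. Proof. exact: alphaE.1. Qed.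

(** The expectation of the product of the numbers of visits counted by [l] and
    by [l']. *)
Definition cor l l' := \sum_(u <- l) \sum_(v <- l') visitI u v.

Lemma corC l l' : cor l l' = cor l' l.
Proof.
rewrite /cor exchange_big /=; apply: eq_bigr => u _; apply: eq_bigr => v _.
exact: visitIC.
Qed.

Lemma cor_catl l1 l2 l : cor (l1 ++ l2) l = cor l1 l + cor l2 l.
Proof. by rewrite /cor big_cat. Qed.

Lemma cor_catr l l1 l2 : cor l (l1 ++ l2) = cor l l1 + cor l l2.
Proof. by rewrite corC cor_catl !(corC _ l). Qed.

Variables (b : nat -> R) (CK : R) (L K kap : nat -> nat) (rho : nat -> nat -> R).
Hypothesis LE : forall n, L n = q (kap n).
Hypothesis LleQ : forall n, (L n <= q n)%N.
Hypothesis CKL : forall n, (q n)%:R <= CK * (L n)%:R.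
Hypothesis KL : forall n, (K n * L n + q n <= q n.+1 + L n)%N.
Hypothesis rho_adm : forall n k, (k < K n)%N -> 0 <= rho n k <= 2^-1.
Hypothesis rho_b : forall n k, (k < K n)%N -> rho n k * (q n + k * L n)%:R <= b n.

Let q_gt0 n : (0 < q n)%N. Proof. exact: cf_den_gt0. Qed.

Definition blk n := block (q n) (L n) (K n) (rho n).

Fixpoint sys N := if N is M.+1 then sys M ++ blk M else [::].

Lemma admissible_blk n : admissible (blk n).
Proof. by apply: admissible_block => k; exact: rho_adm. Qed.

Lemma admissible_sys N : admissible (sys N).
Proof.
elim: N => //= N ih u; rewrite mem_cat => /orP[]; first exact: ih.
exact: admissible_blk.
Qed.

Lemma mean_sys N : mean (sys N) = \sum_(0 <= n < N) mean (blk n).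
Proof.
elim: N => [|N ih]; first by rewrite /mean big_nil big_geq.
by rewrite /= mean_cat ih big_nat_recr.
Qed.

Lemma mean_blk_ge0 n : 0 <= mean (blk n).
Proof.
rewrite /mean big_seq; apply: sumr_ge0 => u /admissible_blk/andP[u0 _].
by rewrite mulr_ge0.
Qed.

Lemma size_sys N : (size (sys N) <= 3 * q N)%N.
Proof.
apply: (@leq_trans (q N + \sum_(0 <= m < N) q m)); last first.
  by have := cf_den_sum a_gt0 N; lia.
elim: N => [|N ih]; first by [].
rewrite [sys _]/(sys N ++ blk N) size_cat size_block.
have -> : (\sum_(0 <= m < N.+1) q m = \sum_(0 <= m < N) q m + q N)%N by rewrite big_nat_recr.
by have := KL N; have := LleQ N; lia.
Qed.

Lemma sum_rho_q n : (q n)%:R * \sum_(k <- iota 0 (K n)) rho n k <= CK / 2 * mean (blk n).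
Proof.
rewrite /blk mean_block.
have S0 : 0 <= \sum_(k <- iota 0 (K n)) rho n k.
  rewrite big_seq; apply: sumr_ge0 => k; rewrite mem_iota add0n => /andP[_ kK].
  by case/andP: (rho_adm kK).
by have := ler_wpM2r S0 (CKL n); lra.
Qed.

(** Each of the [O(q N)] visits counted by the earlier blocks has covariance
    [O(rho)] with each window of the new block, and the radii of these windows
    sum up to [O(mean / q N)]. *)
Lemma cor_sys_blk N :
  cor (sys N) (blk N) <= mean (sys N) * mean (blk N) + 9 * CK * mean (blk N).
Proof.
apply: (@le_trans _ _ (\sum_(k <- iota 0 (K N))
    (mean (sys N) * mean (window (q N + k * L N) (L N) (rho N k))
     + 18 * (q N)%:R * rho N k))).
  have step k : (k < K N)%N -> cor (window (q N + k * L N) (L N) (rho N k)) (sys N) <=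
      mean (sys N) * mean (window (q N + k * L N) (L N) (rho N k)) + 18 * (q N)%:R * rho N k.
    move=> kK; rewrite corC /cor [X in window _ X _]LE.
    have [r0 r1] := andP (rho_adm kK).
    apply: le_trans (sum_visitI_lwindow c alpha01 alphaI alphaE _ _ (@admissible_sys N) (rho_adm kK)) _.
    rewrite -LE lerD2l.
    have s3 : (size (sys N))%:R <= 3 * (q N)%:R :> R.
      by rewrite -natrM ler_nat size_sys.
    have := ler_wpM2l r0 s3; lra.
  rewrite corC {1}/cor /blk /block big_flatten big_map big_seq [leRHS]big_seq.
  by apply: ler_sum => k; rewrite mem_iota add0n => /andP[_ kK]; exact: step.
rewrite big_split/= -!mulr_sumr.
rewrite (_ : \sum_(k <- _) mean _ = mean (blk N)); last first.
  by rewrite [RHS]/mean /blk /block big_flatten big_map.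
by have := sum_rho_q N; lra.
Qed.

Definition win n k := window (q n + k * L n) (L n) (rho n k).

(** Two windows of the same block interact only if one of them starts close to
    the beginning of the block: further away, the radii are so small that no
    orbit visits both. *)
Lemma cor_window_window n k' k : (k' <= k < K n)%N ->
  cor (win n k') (win n k) <= mean (win n k') * mean (win n k) +
    (if (k' == k) || ((k' * L n)%:R < 6 * (a n.+1)%:R * b n * (q n)%:R)
     then 6 * rho n k * (L n)%:R else 0).
Proof.
move=> /andP[k'k kK]; set w := win n.
have k'K : (k' < K n)%N by exact: leq_ltn_trans kK.
have [r0 r1] := andP (rho_adm kK); have [r'0 r'1] := andP (rho_adm k'K).
have adm k0 : (k0 < K n)%N -> admissible (w k0).
  by move=> k0K u /mapP[j _ ->]/=; exact: rho_adm.
have bnd : cor (w k') (w k) <= mean (w k') * mean (w k) + 6 * rho n k * (L n)%:R.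
  rewrite /cor /w {2}/win [X in window _ X _]LE.
  apply: le_trans (sum_visitI_lwindow c alpha01 alphaI alphaE _ _ (adm _ k'K) (rho_adm kK)) _.
  by rewrite size_window -LE.
case: ifPn => // /norP[k'Nk]; rewrite -leNgt => tau.
have far : (\sum_(u <- w k') \sum_(v <- w k) visitI u v) = 0.
  have b0 : 0 <= b n.
    by apply: le_trans (rho_b kK); rewrite mulr_ge0.
  have A1 : 1 <= (a n.+1)%:R :> R by rewrite ler1n a_gt0.
  have q1 : 1 <= (q n)%:R :> R by rewrite ler1n.
  have qS : (q n.+1)%:R <= ((a n.+1)%:R + 1) * (q n)%:R :> R.
    by rewrite natr1 -natrM ler_nat cf_den_leM.
  (* Beyond time [6 * a * b * q] two radii add up to at most [1 / (3 * a * q)],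
     which is at most the best error [cf_err]. *)
  have small k0 : (k' <= k0 < K n)%N -> rho n k0 * (6 * (a n.+1)%:R * (q n)%:R) <= 1.
    move=> /andP[k'k0 k0K]; have := rho_b k0K; have [s0 s1] := andP (rho_adm k0K).
    have : (k' * L n)%:R <= (k0 * L n)%:R :> R by rewrite ler_nat leq_mul2r k'k0 orbT.
    rewrite natrD.
    move: tau s0 b0; set x := rho n k0; set T := (k0 * _)%:R; set T' := (k' * _)%:R.
    move: A1 q1; set A := (a n.+1)%:R; set Q := (q n)%:R => A1 q1 h1 h2 h3 h4 h5.
    have [b00|b00] := eqVneq (b n) 0.
      have : x * Q = 0.
        have Q0 : 0 <= Q by lra.
        apply/eqP; rewrite eq_le mulr_ge0 ?andbT//.
        have T0 : 0 <= x * T by rewrite mulr_ge0// /T.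
        by move: h5; rewrite b00 mulrDr; lra.
      by move=> xQ; rewrite mulrCA xQ mulr0.
    have bp : 0 < b n by rewrite lt_neqAle eq_sym b00.
    rewrite -(ler_pM2r bp) mul1r; apply: le_trans h5.
    have e : 6 * A * Q * b n <= Q + T by rewrite mulrAC; lra.
    by have := ler_wpM2l h2 e; lra.
  have S1 := small k' _; have S2 := small k _.
  rewrite big_map big1_seq// => i; rewrite mem_iota add0n/= => iL.
  rewrite big_map big1_seq// => j; rewrite mem_iota add0n/= => jL.
  have kL1 : (k'.+1 * L n <= k * L n)%N by rewrite leq_mul2r ltn_neqAle k'Nk k'k orbT.
  have kL2 : (k.+1 * L n <= K n * L n)%N by rewrite leq_mul2r kK orbT.
  have KLn := KL n.
  have [e1 e2 e3] : [/\ (q n + k' * L n + i != q n + k * L n + j)%N,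
      (q n + k' * L n + i < q n + k * L n + j + q n.+1)%N &
      (q n + k * L n + j < q n + k' * L n + i + q n.+1)%N].
    move: kL1 kL2 KLn iL jL (LleQ n); rewrite !mulSn.
    move: (k' * L n)%N (k * L n)%N (K n * L n)%N (q n) (q n.+1) (L n) => X Y Z Q Q' W.
    by clear; move=> *; split; lia.
  apply: (visitI_disjoint c alpha01 alphaI alphaE (n := n)) => //.
  have := cf_err_lower alpha01 alphaI alphaE n.
    have := S1; rewrite leqnn k'K => /(_ isT).
    have := S2; rewrite k'k kK => /(_ isT).
    have := cf_err_gt0 alpha01 alphaI alphaE n.
    move: qS A1 q1 r0 r'0; set t := cf_err _ _ _; set Q' := (q n.+1)%:R; set Q := (q n)%:R.
    set A := (a n.+1)%:R; set x := rho n k; set x' := rho n k' => qS A1 q1 r0 r'0 t0 h1 h2 h3.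
    have AQ0 : 0 < 6 * A * Q by rewrite !mulr_gt0//; lra.
    rewrite -(ler_pM2r AQ0) mulrDl.
    apply: (@le_trans _ _ 2); first by lra.
    have : (Q' + Q) * t <= (3 * A * Q) * t.
      apply: ler_wpM2r; first exact: ltW.
      have : 1 * Q <= A * Q by apply: ler_wpM2r => //; lra.
      by rewrite mulrDl in qS; lra.
    by lra.
by rewrite addr0 /cor far mulr_ge0// mean_window !mulr_ge0.
Qed.

Lemma count_scale_lt (K0 L0 : nat) (tau : R) : 0 <= tau ->
  (count (fun k => (k * L0)%:R < tau) (iota 0 K0))%:R * L0%:R <= tau + L0%:R.
Proof.
move=> t0; elim: K0 => [|K0 ih]; first by rewrite /= mul0r addr_ge0.
rewrite -addn1 iotaD count_cat add0n /= addn0.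
case: ltP => h; last by rewrite addn0.
apply: (@le_trans _ _ (K0.+1%:R * L0%:R)).
  by rewrite ler_wpM2r// ler_nat addn1 ltnS -{2}(size_iota 0 K0) count_size.
by rewrite -natr1 mulrDl mul1r lerD2r -natrM ltW.
Qed.

Lemma b_ge0 n : (0 < K n)%N -> 0 <= b n.
Proof.
by move=> K0; apply: le_trans (rho_b K0); case/andP: (rho_adm K0) => r0 _; rewrite mulr_ge0.
Qed.

(** A window has to be paired only with the windows that start among the first
    [6 * a * b * q] times of the block, and with itself. Compared with earlier
    blocks, this costs a factor [1 + a * b]. *)
Lemma cor_blk n :
  cor (blk n) (blk n) <= mean (blk n) ^+ 2 + (24 + 36 * CK * (a n.+1)%:R * b n) * mean (blk n).
Proof.
have [K0|K0] := posnP (K n).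
  by rewrite /cor /mean /blk /block K0 /= !big_nil mulr0 addr0 expr0n.
have b0 := b_ge0 K0.
set tau := 6 * (a n.+1)%:R * b n * (q n)%:R.
have tau0 : 0 <= tau by rewrite !mulr_ge0.
pose dl k' k := if (k' <= k)%N && ((k' == k) || ((k' * L n)%:R < tau))
  then 6 * rho n k * (L n)%:R else 0.
have rho0 k : k \in iota 0 (K n) -> 0 <= rho n k.
  by rewrite mem_iota add0n => /andP[_ kK]; case/andP: (rho_adm kK).
have dl0 k' k : k \in iota 0 (K n) -> 0 <= dl k' k.
  by move=> kK; rewrite /dl; case: ifP => // _; rewrite !mulr_ge0// rho0.
have pair k k' : k \in iota 0 (K n) -> k' \in iota 0 (K n) ->
    cor (win n k) (win n k') <= mean (win n k) * mean (win n k') + (dl k' k + dl k k').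
  move=> ki ki'; have := dl0 k' k ki; have := dl0 k k' ki'.
  move: ki ki'; rewrite !mem_iota !add0n/= => kK kK'.
  have [kk'|/ltnW kk'] := leqP k k'.
    have := @cor_window_window n k k'; rewrite kk' kK' => /(_ isT).
    by rewrite -/tau [dl k k']/dl kk' /=; lra.
  have := @cor_window_window n k' k; rewrite kk' kK => /(_ isT).
  rewrite corC [mean _ * mean _]mulrC.
  by rewrite -/tau [dl k' k]/dl kk' /=; lra.
have corE : cor (blk n) (blk n) =
    \sum_(k <- iota 0 (K n)) \sum_(k' <- iota 0 (K n)) cor (win n k) (win n k').
  rewrite {1}/cor {1}/blk /block big_flatten big_map; apply: eq_bigr => k _.
  rewrite -/(cor _ _) corC {1}/cor /blk /block big_flatten big_map.
  by apply: eq_bigr => k' _; rewrite -/(cor _ _) corC.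
have meanE : mean (blk n) = \sum_(k <- iota 0 (K n)) mean (win n k).
  by rewrite /mean /blk /block big_flatten big_map.
have sumdl k : k \in iota 0 (K n) ->
    \sum_(k' <- iota 0 (K n)) dl k' k <= 6 * rho n k * (2 * (L n)%:R + tau).
  move=> ki; have r0 := rho0 k ki.
  set X := 6 * rho n k * (L n)%:R.
  have X0 : 0 <= X by rewrite !mulr_ge0.
  have h1 : \sum_(k' <- iota 0 (K n)) dl k' k <=
     \sum_(k' <- iota 0 (K n)) ((k' == k)%:R * X + ((k' * L n)%:R < tau)%R%:R * X).
    apply: ler_sum => k' _; rewrite /dl -/X.
    by case: (k' <= k)%N; case: (k' == k); case: (_ < tau) => //=; lra.
  apply: le_trans h1 _; rewrite big_split/= -!mulr_suml -!natr_sum.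
  have -> : (\sum_(k' <- iota 0 (K n)) (k' == k) = 1)%N.
    rewrite (bigD1_seq k) ?iota_uniq//= eqxx big1 ?addn0// => k'; by move/negbTE ->.
  have -> : (\sum_(k' <- iota 0 (K n)) ((k' * L n)%:R < tau)%R =
     count (fun k' => (k' * L n)%:R < tau)%R (iota 0 (K n)))%N.
    by rewrite -sum1_count [RHS]big_mkcond/=; apply: eq_bigr => k' _; case: ifP.
  have := ler_wpM2l r0 (count_scale_lt (K n) (L n) tau0).
  rewrite /X; lra.
rewrite corE.
apply: (@le_trans _ _ (\sum_(k <- iota 0 (K n)) \sum_(k' <- iota 0 (K n))
   (mean (win n k) * mean (win n k') + (dl k' k + dl k k')))).
  rewrite big_seq [leRHS]big_seq; apply: ler_sum => k ki.
  by rewrite big_seq [leRHS]big_seq; apply: ler_sum => k' ki'; exact: pair.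
under eq_bigr do rewrite big_split/= big_split/= -mulr_sumr -meanE.
rewrite !big_split/= -mulr_suml -meanE -expr2 lerD2l.
rewrite [X in _ + X]exchange_big/=.
have S1 : \sum_(k <- iota 0 (K n)) \sum_(k' <- iota 0 (K n)) dl k' k <=
    6 * (2 * (L n)%:R + tau) * \sum_(k <- iota 0 (K n)) rho n k.
  rewrite mulr_sumr big_seq [leRHS]big_seq; apply: ler_sum => k ki.
  by apply: le_trans (sumdl k ki) _; lra.
have S2 := sum_rho_q n.
have S3 : mean (blk n) = 2 * (L n)%:R * \sum_(k <- iota 0 (K n)) rho n k by exact: mean_block.
have S4 : tau * \sum_(k <- iota 0 (K n)) rho n k <= 6 * (a n.+1)%:R * b n * (CK / 2 * mean (blk n)).
  rewrite /tau -mulrA ler_wpM2l// !mulr_ge0//.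
have m0 := mean_blk_ge0 n; by lra.
Qed.

Lemma variance_sys N :
  cor (sys N) (sys N) - mean (sys N) ^+ 2 <=
  \sum_(0 <= n < N) (24 + 18 * CK + 36 * CK * ((a n.+1)%:R * b n)) * mean (blk n).
Proof.
elim: N => [|N ih]; first by rewrite /cor /mean /= !big_nil expr0n subrr.
rewrite big_nat_recr//= cor_catl !cor_catr mean_cat [cor (blk N) (sys N)]corC.
by have := cor_sys_blk N; have := cor_blk N; rewrite !expr2; lra.
Qed.

End System.

(** * A strong law along a nondecreasing sequence *)

Section StrongLaw.
Context d (T : measurableType d) (R : realType) (mu : {measure set T -> \bar R}).

Lemma borel_cantelli_bound (E : nat -> set T) (f : nat -> R) (C : R) :
  (forall k, measurable (E k)) -> (forall k, (mu (E k) <= (f k)%:E)%E) ->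
  (forall m, \sum_(0 <= k < m) f k <= C) ->
  {ae mu, forall x, \forall k \near \oo, ~ E k x}.
Proof.
move=> mE Ef fC.
have S : (\sum_(k <oo) mu (E k) < +oo)%E.
  apply: (@le_lt_trans _ _ C%:E); last by rewrite ltry.
  apply: lime_le; first by apply: is_cvg_nneseries => n _ _; exact: measure_ge0.
  apply: nearW => m; apply: le_trans (_ : (\sum_(0 <= k < m) (f k)%:E <= _)%E).
    by apply: lee_sum => k _; exact: Ef.
  by rewrite sumEFin lee_fin.
exists (lim_sup_set E); split.
- apply: bigcap_measurable => // k _.
  by apply: bigcup_measurable => j _; exact: mE.
- exact: lim_sup_set_cvg0.
- move=> x /= h n _; apply: contrapT => hn; apply: h.
  exists n => // k /= nk Ek; apply: hn; exists k => //=.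
Qed.

(** Each increment of [sg] enters [G] once and is then discounted by a factor
    [tau] at every step, so it contributes at most [tau / (tau - 1)] in total. *)
Lemma geometric_weight_sum (tau S : R) (G sg : nat -> R) :
  1 < tau -> 0 <= S -> (forall m, sg m <= S) -> G 0%N <= sg 0%N ->
  (forall m, G m.+1 <= G m / tau + (sg m.+1 - sg m)) ->
  forall m, \sum_(0 <= k < m) G k <= S * (tau / (tau - 1)).
Proof.
move=> t1 S0 sgS G0 GS.
have t0 : 0 < tau by lra.
have step m : \sum_(0 <= k < m.+1) G k <= (\sum_(0 <= k < m) G k) / tau + sg m.
  elim: m => [|m ih]; first by rewrite big_nat1 big_geq// mul0r add0r.
  rewrite big_nat_recr//= [in leRHS]big_nat_recr//= mulrDl.
  by have := GS m; lra.
elim=> [|m ih].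
  by rewrite big_geq// mulr_ge0// divr_ge0//; lra.
apply: le_trans (step m) _.
apply: (@le_trans _ _ (S * (tau / (tau - 1)) / tau + S)).
  by apply: lerD => //; rewrite ler_wpM2r// invr_ge0 ltW.
by rewrite le_eqVlt; apply/orP; left; apply/eqP; field; rewrite !gt_eqF//; lra.
Qed.

Variables (D : set T) (X : nat -> T -> R) (M V s : nat -> R) (K C S : R).
Hypothesis X_mono : forall x N, D x -> X N x <= X N.+1 x.
Hypothesis M_mono : forall N, M N <= M N.+1.
Hypothesis M0 : 0 <= M 0%N.
Hypothesis M_infty : forall A, exists N, A <= M N.
Hypothesis cheb : forall N eta, 0 < eta -> exists E, [/\ measurable E,
  (mu E <= (V N / eta ^+ 2)%:E)%E &
  forall x, D x -> ~ E x -> `|X N x - M N| < eta].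
Hypothesis VM : forall N, V N <= K * M N + C + \sum_(0 <= n < N) s n * M n ^+ 2.
Hypothesis s0 : forall n, 0 <= s n.
Hypothesis sS : forall N, \sum_(0 <= n < N) s n <= S.
Hypothesis K0 : 0 <= K.
Hypothesis C0 : 0 <= C.
Hypothesis M_jump : forall dl, 0 < dl -> \forall N \near \oo, M N.+1 <= (1 + dl) * M N.

Let M_homo N N' : (N <= N')%N -> M N <= M N'.
Proof. by apply: (homo_leq (r := <=%R)) => //; exact: le_trans. Qed.

Let M_ge0 N : 0 <= M N. Proof. exact: le_trans (M_homo (leq0n N)). Qed.

Section Scale.
Variable dl : R.
Hypothesis dl0 : 0 < dl.
Hypothesis dl1 : dl <= 1.
Let th := 1 + dl.

Let idx_ex k : exists N, th ^+ k <= M N. Proof. exact: M_infty. Qed.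
(** The first time at which the mean reaches [th ^+ k]. Chebyshev's bounds along
    these times are summable: the part [K * M] of the variance gives a geometric
    series, and a term [s n * M n ^+ 2] enters only once [th ^+ k] exceeds
    [M n], from where on it is divided by [th ^+ (2 * k)]. *)
Let idx k := ex_minn (idx_ex k).

Let idxP k : th ^+ k <= M (idx k).
Proof. by rewrite /idx; case: ex_minnP. Qed.

Let idx_min k n : (n < idx k)%N -> M n < th ^+ k.
Proof.
rewrite /idx; case: ex_minnP => m _ h nm; rewrite ltNge; apply/negP => /h.
by rewrite leqNgt nm.
Qed.

Let th1 : 1 < th. Proof. by rewrite /th ltrDl. Qed.
Let th0 : 0 < th. Proof. exact: lt_trans ltr01 th1. Qed.
Let thk_gt0 k : 0 < th ^+ k. Proof. exact: exprn_gt0. Qed.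

Let idx_homo k : (idx k <= idx k.+1)%N.
Proof.
rewrite leqNgt; apply/negP => /idx_min; rewrite ltNge => /negP; apply.
by apply: le_trans (idxP k.+1); rewrite exprS ler_peMl// ltW.
Qed.

Let th_bernoulli k : 1 + k%:R * dl <= th ^+ k.
Proof.
elim: k => [|k ih]; first by rewrite mul0r addr0 expr0.
rewrite exprS; apply: le_trans (_ : th * (1 + k%:R * dl) <= _); last by rewrite ler_pM2l.
have : 0 <= k%:R * dl * dl by rewrite !mulr_ge0// ltW.
by rewrite /th -natr1; lra.
Qed.

Let th_infty A : exists k0, forall k, (k0 <= k)%N -> A < th ^+ k.
Proof.
exists (Num.trunc `|A / dl|).+1 => k hk.
apply: lt_le_trans (th_bernoulli k).
have : `|A / dl| < k%:R.
  apply: lt_le_trans (_ : ((Num.trunc `|A / dl|).+1%:R <= _)); last by rewrite ler_nat.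
  by rewrite truncnS_gt.
move=> /(le_lt_trans (ler_norm _)); rewrite ltr_pdivrMr//; lra.
Qed.

Let idx_infty N : exists k0, forall k, (k0 <= k)%N -> (N < idx k)%N.
Proof.
have [k0 hk0] := th_infty (M N); exists k0 => k /hk0 h.
rewrite ltnNge; apply/negP => /M_homo; have := idxP k; lra.
Qed.

Let M_idx_le : exists k0, forall k, (k0 <= k)%N -> M (idx k) <= th * th ^+ k.
Proof.
have [N0 _ hN0] := M_jump dl0; have [k0 hk0] := idx_infty N0.
exists k0 => k /hk0; case E : (idx k) => [//|n]; rewrite ltnS => N0n.
apply: le_trans (hN0 n N0n) _; rewrite ler_pM2l//.
by apply/ltW/idx_min; rewrite E.
Qed.

Let sg m := \sum_(0 <= n < idx m) s n.
Let G m := (\sum_(0 <= n < idx m) s n * M n ^+ 2) / (th ^+ 2) ^+ m.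

Let th2 : 1 < th ^+ 2. Proof. by rewrite exprn_egt1. Qed.

Let sum_G m : \sum_(0 <= k < m) G k <= S * (th ^+ 2 / (th ^+ 2 - 1)).
Proof.
have S0 : 0 <= S by have := sS 0; rewrite big_geq.
apply: (geometric_weight_sum th2 S0 (sg := sg)) => [k||k]; first exact: sS.
  rewrite /G expr0 divr1 /sg; apply: ler_sum_nat => n /andP[_ /idx_min].
  rewrite expr0 => Mn; rewrite -[leRHS]mulr1 ler_wpM2l//.
  by rewrite -(expr1n _ 2) lerXn2r ?nnegrE// ltW.
rewrite /G /sg (big_cat_nat (leq0n _) (idx_homo k))/=.
rewrite [X in _ <= _ + (X - _)](big_cat_nat (leq0n _) (idx_homo k))/= [X in _ <= _ + X]addrAC subrr add0r.
rewrite mulrDl; apply: lerD.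
  by rewrite exprSr invfM mulrA.
rewrite mulr_suml; apply: ler_sum_nat => n /andP[_ /idx_min Mn].
rewrite -mulrA -[leRHS]mulr1 ler_wpM2l// ler_pdivrMr ?exprn_gt0// mul1r.
by rewrite -exprM mulnC exprM lerXn2r ?nnegrE// ltW.
Qed.

Let sum_geo m : \sum_(0 <= k < m) (th ^+ k)^-1 <= th / dl.
Proof.
have -> : \sum_(0 <= k < m) (th ^+ k)^-1 = (1 - (th ^+ m)^-1) * (th / dl).
  elim: m => [|m ih]; first by rewrite big_geq// expr0 invr1 subrr mul0r.
  rewrite big_nat_recr//= ih exprS invfM /th.
  by field; rewrite !gt_eqF//= exprn_gt0.
rewrite -[leRHS]mul1r ler_wpM2r//; first by rewrite divr_ge0 ?ltW.
by rewrite lerBlDr lerDl invr_ge0 ltW.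
Qed.

Let ae_scale : {ae mu, forall x, D x -> \forall k \near \oo,
  `|X (idx k) x - M (idx k)| < dl * th ^+ k}.
Proof.
have eta0 k : 0 < dl * th ^+ k by rewrite mulr_gt0.
pose E k := projT1 (cid (cheb (idx k) (eta0 k))).
have EP k : [/\ measurable (E k), (mu (E k) <= (V (idx k) / (dl * th ^+ k) ^+ 2)%:E)%E &
  forall x, D x -> ~ E k x -> `|X (idx k) x - M (idx k)| < dl * th ^+ k].
  by rewrite /E; case: cid.
have [k0 hk0] := M_idx_le.
pose f k := (K * th * (th ^+ k)^-1 + C * (th ^+ k)^-1 + G k) / dl ^+ 2.
have bc : {ae mu, forall x, \forall k \near \oo, ~ E (k + k0)%N x}.
  apply: (@borel_cantelli_bound _ (fun k => f (k + k0)%N)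
    ((K * th * (th / dl) + C * (th / dl) + S * (th ^+ 2 / (th ^+ 2 - 1))) / dl ^+ 2)).
  - by move=> k; have [] := EP (k + k0)%N.
  - move=> k; have [_ h _] := EP (k + k0)%N; apply: le_trans h _.
    rewrite lee_fin /f; set m := (k + k0)%N.
    have hm := hk0 m (leq_addl _ _).
    rewrite exprMn invfM mulrA mulrAC [leLHS]mulrC [leRHS]mulrC ler_pM2l ?invr_gt0 ?exprn_gt0//.
    have e : (th ^+ m) ^+ 2 = (th ^+ 2) ^+ m by rewrite -!exprM mulnC.
    rewrite ler_pdivrMr ?exprn_gt0//.
    apply: le_trans (VM _) _; rewrite mulrDl; apply: lerD; last first.
      by rewrite /G e mulfVK// gt_eqF// !exprn_gt0.
    have t0 := thk_gt0 m.
    have -> : (K * th * (th ^+ m)^-1 + C * (th ^+ m)^-1) * (th ^+ m) ^+ 2 = K * (th * th ^+ m) + C * th ^+ m.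
      by field; rewrite gt_eqF.
    apply: lerD; first by rewrite ler_wpM2l.
    by rewrite ler_peMr// exprn_ege1// ltW.
  - move=> m; rewrite /f -mulr_suml ler_wpM2r//; first by rewrite invr_ge0 sqr_ge0.
    apply: (@le_trans _ _ (\sum_(0 <= k < m + k0) (K * th * (th ^+ k)^-1 + C * (th ^+ k)^-1 + G k))).
      have h0 k : 0 <= K * th * (th ^+ k)^-1 + C * (th ^+ k)^-1 + G k.
        rewrite /G !addr_ge0 ?mulr_ge0 ?invr_ge0 ?exprn_ge0 ?(ltW th0)//.
        by apply: sumr_ge0 => n _; rewrite mulr_ge0// exprn_ge0.
      rewrite (big_cat_nat (leq0n k0) (leq_addl m k0))/=.
      rewrite [X in _ <= _ + X](_ : _ = \sum_(0 <= k < m) (K * th * (th ^+ (k + k0))^-1 + C * (th ^+ (k + k0))^-1 + G (k + k0)%N)).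
        by rewrite lerDr; apply: sumr_ge0.
      by rewrite -{1}[k0]add0n big_addn addnK.
    rewrite !big_split/= -!mulr_sumr.
    have := sum_G (m + k0); have g := sum_geo (m + k0).
    by have := ler_wpM2l (mulr_ge0 K0 (ltW th0)) g; have := ler_wpM2l C0 g; lra.
apply: filterS bc => x [N _ hN] Dx; exists (N + k0)%N => // k /= hk.
have [_ _ h] := EP k; apply: h => //.
have k0k : (k0 <= k)%N by apply: leq_trans hk; exact: leq_addl.
by have := hN (k - k0)%N; rewrite /= subnK//; apply; rewrite leq_subRL// addnC.
Qed.

(** Between two consecutive times [idx k] and [idx k.+1] both [X] and [M] are
    monotone, and the mean grows by a factor close to [th]. *)
Lemma ae_scale_bound : {ae mu, forall x, D x -> \forall N \near \oo,
  (1 - dl) * M N <= th * X N x /\ X N x <= th ^+ 3 * M N}.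
Proof.
apply: filterS ae_scale => x hx Dx.
have X_homo N N' : (N <= N')%N -> X N x <= X N' x.
  apply: (homo_leq (f := fun N => X N x) (r := <=%R)) => //; first exact: le_trans.
  by move=> n; exact: X_mono.
have [k1 _ hk1] := hx Dx; have [k2 hk2] := M_idx_le.
pose k0 := maxn k1 k2.
exists (idx k0) => // N /= hN.
have [k3 hk3] := idx_infty N.
have ex3 : exists m, (N < idx m)%N by exists k3; exact: hk3.
have [m mP mmin] : exists2 m, (N < idx m)%N & forall j, (N < idx j)%N -> (m <= j)%N.
  by exists (ex_minn ex3); case: ex_minnP.
have k0m : (k0 < m)%N.
  rewrite ltnNge; apply/negP => mk0.
  have : (idx m <= idx k0)%N by apply: (homo_leq (r := leq)) mk0 => //; exact: leq_trans.
  by rewrite leqNgt (leq_ltn_trans hN mP).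
case: m mP mmin k0m => [//|k] mP mmin k0m.
have kN : (idx k <= N)%N.
  by rewrite leqNgt; apply/negP => /mmin; rewrite ltnn.
have k0k : (k0 <= k)%N by [].
have k1k : (k1 <= k)%N := leq_trans (leq_maxl _ _) k0k.
have k2k : (k2 <= k)%N := leq_trans (leq_maxr _ _) k0k.
have a1 := hk1 k k1k; have a2 := hk1 k.+1 (leqW k1k).
have a3 := hk2 k.+1 (leqW k2k).
have a4 := idx_min mP.
have a5 := le_trans (idxP k) (M_homo kN).
have a6 := X_homo _ _ kN; have a7 := X_homo _ _ (ltnW mP).
have a8 := idxP k.
move: a1 a2; rewrite /= !ltr_norml => /andP[b1 b2] /andP[b3 b4].
have t0 := thk_gt0 k.
rewrite exprS in a3 a4 b3 b4; set t := th ^+ k in a3 a4 a5 a8 b1 b2 b3 b4 t0.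
split.
  apply: (@le_trans _ _ ((1 - dl) * (th * t))).
    by rewrite ler_wpM2l ?subr_ge0// ltW.
  by rewrite mulrCA ler_pM2l//; lra.
apply: (@le_trans _ _ (th ^+ 3 * t)); last by rewrite ler_pM2l ?exprn_gt0.
have : 0 <= dl * dl * th * t by rewrite !mulr_ge0// ltW.
by rewrite /th !exprS expr0 in a3 b4 *; lra.
Qed.

End Scale.
Theorem strong_law eps : 0 < eps <= 1 -> {ae mu, forall x, D x ->
  \forall N \near \oo, (1 - eps) * M N <= X N x <= (1 + eps) * M N}.
Proof.
move=> /andP[e0 e1]; have dl0 : 0 < eps / 8 by rewrite divr_gt0.
have dl1 : eps / 8 <= 1 by lra.
apply: filterS (ae_scale_bound dl0 dl1) => x hx Dx.
have [N0 _ hN0] := hx Dx; exists N0 => // N /= /hN0[h1 h2].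
have m0 := M_ge0 N; apply/andP; split; last first.
  apply: le_trans h2 _; apply: ler_wpM2r => //.
  by rewrite !exprS expr0 mulr1; nra.
have [X0|X0] := leP 0 (X N x); last first.
  have : 0 <= (1 - eps / 8) * M N by rewrite mulr_ge0//; lra.
  have : (1 + eps / 8) * X N x < 0 by rewrite pmulr_rlt0//; lra.
  by lra.
have h : (1 - eps) * (1 + eps / 8) <= 1 - eps / 8 by nra.
rewrite -(ler_pM2l (_ : 0 < 1 + eps / 8)); last by lra.
apply: le_trans h1; rewrite mulrA; apply: ler_wpM2r => //; lra.
Qed.

End StrongLaw.

(** * The strong law for a system of windows *)

Section SystemLaw.
Variables (R : realType) (alpha c : R) (a : nat -> nat).
Hypothesis alpha01 : 0 <= alpha < 1.
Hypothesis alphaI : irrational alpha.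
Hypothesis alphaE : cf_expansion alpha a.
Local Notation q := (cf_den a).
Local Notation mu := (@lebesgue_measure R).
Local Notation visit := (visit alpha c).

Definition visits (l : seq (nat * R)) (x : R) : R := \sum_(u <- l) \1_(visit u) x.

Lemma visits_ge0 l x : 0 <= visits l x.
Proof. exact: sumr_ge0. Qed.

Lemma visits_cat l l' x : visits (l ++ l') x = visits l x + visits l' x.
Proof. by rewrite /visits big_cat. Qed.

Variables (b : nat -> R) (CK : R) (L K kap : nat -> nat) (rho : nat -> nat -> R).
Hypothesis LE : forall n, L n = q (kap n).
Hypothesis LleQ : forall n, (L n <= q n)%N.
Hypothesis CKL : forall n, (q n)%:R <= CK * (L n)%:R.
Hypothesis KL : forall n, (K n * L n + q n <= q n.+1 + L n)%N.
Hypothesis rho_adm : forall n k, (k < K n)%N -> 0 <= rho n k <= 2^-1.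
Hypothesis rho_b : forall n k, (k < K n)%N -> rho n k * (q n + k * L n)%:R <= b n.
Local Notation sys := (sys a L K rho).
Local Notation blk := (blk a L K rho).
Local Notation M := (fun N => mean (sys N)).

Variables (lam : nat -> R) (S : R).
Hypothesis b_pos : forall n, 0 <= b n.
Hypothesis lam0 : forall n, 0 <= lam n.
Hypothesis lam_small : forall dl, 0 < dl -> \forall N \near \oo, lam N <= dl * N%:R.
Hypothesis lam_sum : forall N, \sum_(0 <= n < N) (a n.+1)%:R * lam n / n%:R ^+ 2 <= S.
Hypothesis blk_lam : forall n, mean (blk n) <= 2 * b n * lam n.
Hypothesis M_infty : forall A, exists N, A <= mean (sys N).
Hypothesis M_lower : \forall N \near \oo, N%:R * b N <= 8 * mean (sys N).

Lemma mean_sys_leS N : mean (sys N) <= mean (sys N.+1).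
Proof. by rewrite /= mean_cat lerDl mean_blk_ge0. Qed.

Lemma mean_sys_ge0 N : 0 <= mean (sys N).
Proof. by rewrite mean_sys sumr_ge0// => n _; exact: mean_blk_ge0. Qed.

Lemma sum_mean_sys l : admissible l ->
  \sum_(u <- l) fine (mu (visit u)) = mean l.
Proof.
move=> hl; rewrite /mean big_seq [RHS]big_seq; apply: eq_bigr => u ul.
by rewrite visit_fin//; exact: hl.
Qed.

(** The variance bound has the form required by [strong_law]: its part
    proportional to the mean is the term [K * M], and the part with the factor
    [a * b] is at most [s n * M n ^+ 2] with [s] summable, because [n * b n] is
    at most [8 * M n]. *)
Theorem strong_law_sys eps : 0 < eps <= 1 -> {ae mu, forall x, 0 <= x < 1 ->
  \forall N \near \oo, (1 - eps) * mean (sys N) <= visits (sys N) x <= (1 + eps) * mean (sys N)}.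
Proof.
move=> e01.
have CK1 : 1 <= CK.
  have := CKL 0; rewrite (_ : (q 0)%:R = 1)//.
  have : (L 0)%:R <= 1 :> R by rewrite -[1]/(1%:R) ler_nat; exact: LleQ.
  have : 1 <= (L 0)%:R :> R by rewrite ler1n LE cf_den_gt0//; exact: alphaE.1.
  by move=> h1 h2; nra.
pose v n := (24 + 18 * CK + 36 * CK * ((a n.+1)%:R * b n)) * mean (blk n).
pose V N := \sum_(0 <= n < N) v n.
pose W := 36 * CK * (2 * (8 * 8)).
have W0 : 0 <= W by rewrite /W; lra.
pose s n := W * ((a n.+1)%:R * lam n / n%:R ^+ 2).
have [N1 _ hN1] := M_lower.
have s0 n : 0 <= s n.
  by rewrite /s; do !apply: mulr_ge0 => //; rewrite invr_ge0 exprn_ge0.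
pose C := \sum_(0 <= n < N1.+1) 36 * CK * ((a n.+1)%:R * b n) * mean (blk n).
have term0 n : 0 <= 36 * CK * ((a n.+1)%:R * b n) * mean (blk n).
  by rewrite !mulr_ge0 ?mean_blk_ge0//; lra.
have C0 : 0 <= C by apply: sumr_ge0.
have := @strong_law _ _ R mu `[0, 1[%classic (fun N => visits (sys N)) (fun N => mean (sys N))
  V s (24 + 18 * CK) C (W * S).
move=> sl; apply: filterS (sl _ _ _ _ _ _ _ _ _ _ _ _ e01) => {sl}.
- by move=> x hx x01; apply: hx; rewrite /= in_itv.
- by move=> x N _; rewrite /= visits_cat lerDl visits_ge0.
- exact: mean_sys_leS.
- exact: mean_sys_ge0.
- exact: M_infty.
- move=> N eta eta0.
  have mD : measurable (`[0, 1[%classic : set R) by exact: measurable_itv.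
  have muD : mu `[0, 1[%classic = 1%E.
    by rewrite lebesgue_measure_itv/= lte_fin ltr01 sube0.
  have vD u : visit u `<=` `[0, 1[%classic by move=> x [].
  have adm : admissible (sys N) by exact: admissible_sys.
  have := @chebyshev_sum_indic _ _ R mu _ visit (measurable_visit alpha c) _ (sys N)
    mD muD vD eta eta0.
  rewrite /= (sum_mean_sys adm) => -[mE hE].
  eexists; split; first exact: mE.
    apply: le_trans hE _; rewrite lee_fin ler_wpM2r ?invr_ge0 ?sqr_ge0//.
    exact: (variance_sys c alpha01 alphaI alphaE LE LleQ CKL KL rho_adm rho_b N).
  by move=> x Dx nE; rewrite ltNge; apply/negP => h; exact: nE.
- move=> N; rewrite /V /v mean_sys.
  under eq_bigr do rewrite mulrDl.
  rewrite big_split/= -mulr_sumr. rewrite -[leRHS]addrA lerD2l.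
  have tle n : (N1 < n)%N -> 36 * CK * ((a n.+1)%:R * b n) * mean (blk n) <=
      s n * mean (sys n) ^+ 2.
    move=> n1; have n0 : 0 < n%:R :> R by rewrite ltr0n (leq_ltn_trans _ n1).
    have Mb := hN1 n (ltnW n1); rewrite /= in Mb.
    have b2 : b n ^+ 2 <= 8 * 8 * (mean (sys n) ^+ 2 / n%:R ^+ 2).
      rewrite mulrA ler_pdivlMr ?exprn_gt0// -exprMn -expr2 -exprMn mulrC.
      by rewrite lerXn2r// nnegrE mulr_ge0// mean_sys_ge0.
    rewrite /s /W.
    apply: (@le_trans _ _ (36 * CK * ((a n.+1)%:R * b n) * (2 * b n * lam n))).
      by apply: ler_wpM2l => //; rewrite !mulr_ge0//; lra.
    have X0 : 0 <= 36 * CK * 2 * ((a n.+1)%:R * lam n).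
      by do !apply: mulr_ge0 => //; lra.
    by have := ler_wpM2l X0 b2; rewrite expr2; lra.
  have st : \sum_(0 <= n < N) 36 * CK * ((a n.+1)%:R * b n) * mean (blk n) <=
      \sum_(0 <= n < minn N N1.+1) 36 * CK * ((a n.+1)%:R * b n) * mean (blk n) +
      \sum_(0 <= n < N) s n * mean (sys n) ^+ 2.
    elim: N => [|N ih]; first by rewrite min0n !big_geq// addr0.
    have sM0 : 0 <= s N * mean (sys N) ^+ 2 by rewrite mulr_ge0// sqr_ge0.
    have [NN1|NN1] := leqP N N1.
      have e1 : minn N N1.+1 = N by apply/minn_idPl; exact: ltnW.
      have e2 : minn N.+1 N1.+1 = N.+1 by exact/minn_idPl.
      rewrite e2; rewrite e1 in ih.
      by rewrite !(@big_nat_recr _ _ _ N 0)//= lerDl addr_ge0// sumr_ge0// => n _; rewrite mulr_ge0// sqr_ge0.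
    have e1 : minn N N1.+1 = N1.+1 by exact/minn_idPr.
    have e2 : minn N.+1 N1.+1 = N1.+1 by apply/minn_idPr; exact: ltnW.
    rewrite e2; rewrite e1 in ih.
    by rewrite !(@big_nat_recr _ _ _ N 0)//=; have := tle N NN1; lra.
  apply: le_trans st _; rewrite lerD2r /C.
  rewrite [leRHS](big_cat_nat (n := minn N N1.+1))//= ?geq_minr// lerDl.
  exact: sumr_ge0.
- exact: s0.
- move=> N; by rewrite /s -mulr_sumr; apply: ler_wpM2l => //; exact: lam_sum.
- by lra.
- exact: C0.
- move=> dl dl0.
  have d16 : 0 < dl / 16 by rewrite divr_gt0.
  have := lam_small d16; case=> N2 _ hN2; exists (maxn N1 (maxn N2 1)) => // N /=; rewrite !geq_max => /and3P[n1 n2 n3].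
  rewrite /= mean_cat mulrDl mul1r lerD2l.
  apply: le_trans (blk_lam N) _.
  have := hN1 N n1; have := hN2 N n2; rewrite /= => l1 l2.
  have := ler_wpM2l (b_pos N) l1; have := ler_wpM2l (ltW dl0) l2; lra.
Qed.

End SystemLaw.

(** * Sandwiching between two systems of windows *)

Section Sandwich.
Variables (R : realType) (a : nat -> nat).
Hypothesis a_gt0 : forall i, (1 <= i)%N -> (1 <= a i)%N.
Local Notation q := (cf_den a).
Variable r : nat -> R.
Hypothesis r_ge0 : forall i, (1 <= i)%N -> 0 <= r i.
Hypothesis r_le : forall i j, (1 <= i)%N -> (i <= j)%N -> r j <= r i.
Variables (kap : nat -> nat) (n0 : nat).
Hypothesis kap_le : forall n, (kap n <= n)%N.

Let q_gt0 n : (0 < q n)%N. Proof. exact: cf_den_gt0. Qed.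

Definition wlen n := q (kap n).
(** The upper system keeps on each window the radius of its first time and
    completes the last window; the lower system takes the radius of the time
    that follows the window and drops an incomplete window. Blocks before [n0]
    are left empty, so that all radii can be made at most [1/2]. *)
Definition Kup n := if (n < n0)%N then 0%N else (((q n.+1 - q n) + wlen n).-1 %/ wlen n)%N.
Definition Klow n := if (n < n0)%N then 0%N else ((q n.+1 - q n) %/ wlen n)%N.
Definition rup n k := r (q n + k * wlen n)%N.
Definition rlow n k := r (q n + k.+1 * wlen n)%N.
Definition blkup n := blk a wlen Kup rup n.
Definition blklow n := blk a wlen Klow rlow n.
Definition sysup := sys a wlen Kup rup.
Definition syslow := sys a wlen Klow rlow.

Let wlen_gt0 n : (0 < wlen n)%N. Proof. exact: q_gt0. Qed.
Lemma wlen_le n : (wlen n <= q n)%N. Proof. exact: cf_den_le. Qed.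

Lemma Kup_le n : (Kup n * wlen n + q n <= q n.+1 + wlen n)%N.
Proof.
have := cf_den_leS a_gt0 n; have := wlen_le n; rewrite /Kup; case: ifP => _; first by rewrite mul0n; lia.
have := leq_trunc_div ((q n.+1 - q n) + wlen n).-1 (wlen n).
by move: (_ %/ _ * _)%N => X; have := wlen_gt0 n; lia.
Qed.

Lemma Kup_ge n : (n0 <= n)%N -> (q n.+1 <= q n + Kup n * wlen n)%N.
Proof.
rewrite /Kup leqNgt => /negbTE ->; have := cf_den_leS a_gt0 n.
have := divn_eq ((q n.+1 - q n) + wlen n).-1 (wlen n).
have := ltn_pmod ((q n.+1 - q n) + wlen n).-1 (wlen_gt0 n).
by move: (_ %/ _ * _)%N (_ %% _)%N => X Y; lia.
Qed.

Lemma Klow_le n : (q n + Klow n * wlen n <= q n.+1)%N.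
Proof.
have := cf_den_leS a_gt0 n; rewrite /Klow; case: ifP => _; first by rewrite mul0n; lia.
have := leq_trunc_div (q n.+1 - q n) (wlen n).
by move: (_ %/ _ * _)%N => X; lia.
Qed.

Lemma Klow_ge n : (n0 <= n)%N -> (q n.+1 <= q n + wlen n + Klow n * wlen n)%N.
Proof.
rewrite /Klow leqNgt => /negbTE ->; have := cf_den_leS a_gt0 n.
have := divn_eq (q n.+1 - q n) (wlen n); have := ltn_pmod (q n.+1 - q n) (wlen_gt0 n).
by move: (_ %/ _ * _)%N (_ %% _)%N => X Y; lia.
Qed.

Lemma sum_block (F : nat * R -> R) w L K rho :
  \sum_(u <- block w L K rho) F u =
  \sum_(0 <= k < K) \sum_(0 <= j < L) F ((w + k * L + j)%N, rho k).
Proof.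
rewrite /block big_flatten big_map /index_iota subn0; apply: eq_bigr => k _.
by rewrite /window big_map subn0.
Qed.

Lemma sum_windows (g : nat -> R) w L K :
  \sum_(0 <= k < K) \sum_(0 <= j < L) g (w + k * L + j)%N = \sum_(w <= i < w + K * L) g i.
Proof.
elim: K => [|K ih]; first by rewrite mul0n addn0 !big_geq.
rewrite big_nat_recr//= ih mulSn [(L + _)%N]addnC addnA.
rewrite [in RHS](@big_cat_nat _ _ _ (w + K * L))/= ?leq_addr//; congr (_ + _).
rewrite [RHS](_ : _ = \sum_(0 + (w + K * L) <= i < w + K * L + L) g i)//.
rewrite big_addn addKn.
by apply: eq_bigr => j _; rewrite addnC.
Qed.

Lemma le_sum_widen (g : nat -> R) m n n' : (forall i, (m <= i)%N -> 0 <= g i) ->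
  (n <= n')%N -> \sum_(m <= i < n) g i <= \sum_(m <= i < n') g i.
Proof.
move=> g0 nn'; have [mn|nm] := leqP m n.
  rewrite [leRHS](@big_cat_nat _ _ _ n)//= lerDl big_nat sumr_ge0// => i /andP[ni _].
  by apply: g0; exact: leq_trans ni.
rewrite big_geq; last exact: ltnW.
by rewrite big_nat sumr_ge0// => i /andP[ni _]; exact: g0.
Qed.

Lemma sysup_nil N : (N <= n0)%N -> sysup N = [::].
Proof.
elim: N => //= N ih Nn0; rewrite /sysup /= -/(sysup N) ih ?(ltnW Nn0)//.
by rewrite /blk /Kup Nn0.
Qed.

Lemma syslow_nil N : (N <= n0)%N -> syslow N = [::].
Proof.
elim: N => //= N ih Nn0; rewrite /syslow /= -/(syslow N) ih ?(ltnW Nn0)//.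
by rewrite /blk /Klow Nn0.
Qed.

Section Monotone.
Variable F : nat * R -> R.
Hypothesis F0 : forall u, 0 <= u.2 -> 0 <= F u.
Hypothesis F_homo : forall i s t, s <= t -> F (i, s) <= F (i, t).

Lemma le_sum_blkup n : (n0 <= n)%N ->
  \sum_(q n <= i < q n.+1) F (i, r i) <= \sum_(u <- blkup n) F u.
Proof.
move=> n0n.
have h : \sum_(q n <= i < q n.+1) F (i, r i) <= \sum_(q n <= i < q n + Kup n * wlen n) F (i, r i).
  apply: le_sum_widen; last exact: Kup_ge.
  by move=> i qi; apply: F0; apply: r_ge0; exact: leq_trans qi.
apply: le_trans h _; rewrite -sum_windows /blkup /blk sum_block.
apply: ler_sum => k _; apply: ler_sum => j _; apply: F_homo; apply: r_le.
  by rewrite addn_gt0 q_gt0.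
exact: leq_addr.
Qed.

Lemma le_sum_blklow n :
  \sum_(u <- blklow n) F u <= \sum_(q n <= i < q n.+1) F (i, r i).
Proof.
have h : \sum_(q n <= i < q n + Klow n * wlen n) F (i, r i) <= \sum_(q n <= i < q n.+1) F (i, r i).
  apply: le_sum_widen; last exact: Klow_le.
  by move=> i qi; apply: F0; apply: r_ge0; exact: leq_trans qi.
apply: le_trans h; rewrite -sum_windows /blklow /blk sum_block.
apply: ler_sum => k _; apply: ler_sum_nat => j /andP[_ jL]; apply: F_homo; apply: r_le.
  by rewrite !addn_gt0 q_gt0.
by rewrite -addnA leq_add2l mulSn addnC leq_add2r ltnW.
Qed.

Lemma le_sum_sysup N : (n0 <= N)%N ->
  \sum_(1 <= i < q N) F (i, r i) <= \sum_(1 <= i < q n0) F (i, r i) + \sum_(u <- sysup N) F u.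
Proof.
elim: N => [|N ih] n0N.
  by move: n0N; rewrite leqn0 => /eqP ->; rewrite lerDl /sysup /= big_nil.
have [n0N'|Nn0] := leqP n0 N; last first.
  have e : n0 = N.+1 by lia.
  by rewrite e sysup_nil ?e// big_nil addr0.
rewrite (@big_cat_nat _ _ _ (q N))/= ?cf_den_leS//.
rewrite big_cat/= addrA; apply: lerD; first exact: ih.
exact: le_sum_blkup.
Qed.

Lemma le_sum_syslow N : (n0 <= N)%N ->
  \sum_(1 <= i < q n0) F (i, r i) + \sum_(u <- syslow N) F u <= \sum_(1 <= i < q N) F (i, r i).
Proof.
elim: N => [|N ih] n0N.
  by move: n0N; rewrite leqn0 => /eqP ->; rewrite /syslow /= big_nil addr0.
have [n0N'|Nn0] := leqP n0 N; last first.
  have e : n0 = N.+1 by lia.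
  by rewrite e syslow_nil ?e// big_nil addr0.
rewrite [leRHS](@big_cat_nat _ _ _ (q N))/= ?cf_den_leS//.
rewrite big_cat/= addrA; apply: lerD; first exact: ih.
exact: le_sum_blklow.
Qed.

End Monotone.

(** Replacing the radii of a block by window-wise constant radii changes the
    mean by a telescoping sum, hence by at most one window of maximal radius. *)
Lemma mean_blkup_le n :
  mean (blkup n) <= \sum_(q n <= i < q n.+1) 2 * r i + 2 * (wlen n)%:R * r (q n).
Proof.
have S0 : 0 <= \sum_(q n <= i < q n.+1) 2 * r i.
  by rewrite big_nat sumr_ge0// => i /andP[qi _]; rewrite mulr_ge0// r_ge0// (leq_trans _ qi).
have rq := r_ge0 (q_gt0 n).
rewrite /mean /blkup /blk sum_block.
case E : (Kup n) => [|K]; first by rewrite big_geq// addr_ge0// !mulr_ge0.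
rewrite big_nat_recl//= addrC; apply: lerD; last first.
  rewrite sumr_const_nat subn0 -[leLHS]mulr_natr /rup mul0n addn0.
  by rewrite mulrAC.
apply: (@le_trans _ _ (\sum_(0 <= k < K) \sum_(0 <= j < wlen n) 2 * r (q n + k * wlen n + j)%N)).
  apply: ler_sum => k _; apply: ler_sum_nat => j /andP[_ jL].
  rewrite ler_pM2l//; apply: r_le; first by rewrite !addn_gt0 q_gt0.
  by rewrite -addnA leq_add2l mulSn addnC leq_add2r ltnW.
rewrite (sum_windows (fun i => 2 * r i)); apply: le_sum_widen.
  by move=> i qi; rewrite mulr_ge0// r_ge0// (leq_trans _ qi).
by have := Kup_le n; rewrite E mulSn; move: (K * wlen n)%N => X; lia.
Qed.

Lemma mean_blklow_ge n : (n0 <= n)%N ->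
  \sum_(q n <= i < q n.+1) 2 * r i <= mean (blklow n) + 2 * (wlen n)%:R * r (q n).
Proof.
move=> n0n.
have f0 i : (q n <= i)%N -> 0 <= 2 * r i by move=> qi; rewrite mulr_ge0// r_ge0// (leq_trans _ qi).
apply: (@le_trans _ _ (\sum_(q n <= i < q n + wlen n + Klow n * wlen n) 2 * r i)).
  by apply: le_sum_widen => //; exact: Klow_ge.
rewrite (@big_cat_nat _ _ _ (q n + wlen n))/= ?leq_addr// addrC; apply: lerD.
  rewrite -(sum_windows (fun i => 2 * r i)) /mean /blklow /blk sum_block.
  apply: ler_sum => k _; apply: ler_sum => j _ /=; rewrite ler_pM2l// /rlow.
  apply: r_le; first by rewrite !addn_gt0 q_gt0.
  by rewrite mulSn addnA leq_addr.
apply: (@le_trans _ _ (\sum_(q n <= i < q n + wlen n) 2 * r (q n))).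
  apply: ler_sum_nat => i /andP[qi _]; rewrite ler_pM2l//; exact: r_le.
by rewrite sumr_const_nat addKn -[leLHS]mulr_natr mulrAC.
Qed.

Lemma mean_sysup_le N :
  mean (sysup N) <= \sum_(1 <= i < q N) 2 * r i + \sum_(0 <= n < N) 2 * (wlen n)%:R * r (q n).
Proof.
elim: N => [|N ih].
  by rewrite /mean /sysup /= big_nil [X in _ <= _ + X]big_geq// addr0 big_geq.
rewrite /sysup /= mean_cat -/(sysup N) -/(blkup N).
rewrite (@big_cat_nat _ _ _ (q N))/= ?cf_den_leS// big_nat_recr//=.
by have := mean_blkup_le N; lra.
Qed.

Lemma mean_syslow_ge N : (n0 <= N)%N ->
  \sum_(1 <= i < q N) 2 * r i <=
  \sum_(1 <= i < q n0) 2 * r i + mean (syslow N) + \sum_(0 <= n < N) 2 * (wlen n)%:R * r (q n).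
Proof.
have g0 n : 0 <= 2 * (wlen n)%:R * r (q n) by rewrite !mulr_ge0// r_ge0.
elim: N => [|N ih] n0N.
  move: n0N; rewrite leqn0 => /eqP ->; rewrite /mean /syslow /= big_nil addr0.
  by rewrite [X in _ <= _ + X]big_geq// addr0.
have [n0N'|Nn0] := leqP n0 N; last first.
  have e : n0 = N.+1 by lia.
  rewrite e syslow_nil ?e// /mean big_nil addr0 lerDl.
  exact: sumr_ge0.
rewrite /syslow /= mean_cat -/(syslow N) -/(blklow N).
rewrite [leLHS](@big_cat_nat _ _ _ (q N))/= ?cf_den_leS// big_nat_recr//=.
by have := mean_blklow_ge n0N'; have := ih n0N'; lra.
Qed.

End Sandwich.

(** * Comparing the sandwich with the expected number of visits *)

Section Elementary.
Variable R : realType.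

(** Summation by parts: the partial sums of [x] are multiplied by the nonnegative
    decrements of [b]. *)
Lemma abel_le (b x : nat -> R) (A dl : R) :
  (forall n, 0 <= b n) -> (forall n, b n.+1 <= b n) ->
  (forall N, \sum_(0 <= n < N) x n <= A + dl * N%:R) ->
  forall N, \sum_(0 <= n < N) b n * x n <= A * b 0%N + dl * \sum_(0 <= n < N) b n.
Proof.
move=> b0 bS xA.
suff h N : \sum_(0 <= n < N) b n * x n + b N * (A + dl * N%:R - \sum_(0 <= n < N) x n)
    <= A * b 0%N + dl * \sum_(0 <= n < N) b n.
  move=> N; apply: le_trans (h N); rewrite lerDl mulr_ge0// subr_ge0; exact: xA.
elim: N => [|N ih]; first by rewrite !big_geq// !mulr0 subr0 addr0 add0r addr0 mulrC.
rewrite !big_nat_recr//=.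
have := xA N.+1; rewrite big_nat_recr//= => h.
have b1 := bS N.
have := ler_wpM2r (_ : 0 <= A + dl * N.+1%:R - (\sum_(0 <= i < N) x i + x N)) b1.
rewrite subr_ge0 => /(_ h).
rewrite -natr1; move: ih; move: (\sum_(_ <= _ < _) x _) (\sum_(_ <= _ < _) b _ * x _) (\sum_(_ <= _ < _) b _).
by move=> X Y Z; lra.
Qed.

(** From [1 / (m + 1) <= ln ((m + 1) / m)], a consequence of [ln (1 + u) <= u]. *)
Lemma harmonic_le (k m : nat) : (0 < k)%N -> (k <= m)%N ->
  \sum_(k <= i < m.+1) (i%:R : R)^-1 <= 1 + ln (m%:R / k%:R).
Proof.
move=> k0; elim: m => [|m ih] km; first by move: km; rewrite leqNgt k0.
have [km'|mk] := leqP k m; last first.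
  have -> : k = m.+1 by lia.
  rewrite big_nat1 divff// ln1 addr0 invf_le1// ler1n//.
rewrite big_nat_recr/=; last by rewrite (leq_trans km').
have m0 : (0 < m)%N by exact: leq_trans km'.
have mp : 0 < m%:R :> R by rewrite ltr0n.
have kp : 0 < k%:R :> R by rewrite ltr0n.
have -> : m.+1%:R / k%:R = (m%:R / k%:R) * (m.+1%:R / m%:R) :> R.
  by field; rewrite !gt_eqF.
rewrite lnM ?posrE ?divr_gt0//.
apply: le_trans (lerD (ih km') (lexx _)) _; rewrite -addrA lerD2l lerD2l.
rewrite -[X in ln X]invrK lnV ?posrE ?invr_gt0 ?divr_gt0//.
rewrite invf_div lerNr.
have -> : m%:R / m.+1%:R = 1 + (- m.+1%:R^-1) :> R.
  by rewrite -natr1; field; rewrite natr1 gt_eqF.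
apply: le_ln1Dx; rewrite ltrN2 invf_lt1// ltr1n ltnS//.
Qed.

End Elementary.

Section Comparison.
Variables (R : realType) (a : nat -> nat).
Hypothesis a_gt0 : forall i, (1 <= i)%N -> (1 <= a i)%N.
Local Notation q := (cf_den a).
Variable r : nat -> R.
Hypothesis r_ge0 : forall i, (1 <= i)%N -> 0 <= r i.
Hypothesis ir_le : forall i j, (1 <= i)%N -> (i <= j)%N -> j%:R * r j <= i%:R * r i.

Let q_gt0 n : (0 < q n)%N. Proof. exact: cf_den_gt0. Qed.

Lemma radius_le i j : (1 <= i)%N -> (i <= j)%N -> r j <= r i.
Proof.
move=> i1 ij; have j0 : 0 < j%:R :> R by rewrite ltr0n (leq_trans i1).
rewrite -(ler_pM2l j0); apply: le_trans (ir_le i1 ij) _.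
by rewrite ler_wpM2r ?r_ge0// ler_nat.
Qed.

(** The values at the times [q n] of the nonincreasing sequence [i * r i]. *)
Definition bweight n := (q n)%:R * r (q n).

Lemma bweight_ge0 n : 0 <= bweight n.
Proof. by rewrite mulr_ge0// r_ge0. Qed.

Lemma bweight_leS n : bweight n.+1 <= bweight n.
Proof. by apply: ir_le => //; exact: cf_den_leS. Qed.

Lemma bweight_le m n : (m <= n)%N -> bweight n <= bweight m.
Proof. by move=> mn; apply: ir_le => //; exact: cf_den_le. Qed.

(** The expected number of visits before time [q N], up to the finitely many
    times at which the radius exceeds [1/2]. *)
Definition Mq N := \sum_(1 <= i < q N) 2 * r i.

Lemma Mq_leS N : Mq N <= Mq N.+1.
Proof.
apply: le_sum_widen; last exact: cf_den_leS.
by move=> i i1; rewrite mulr_ge0// r_ge0.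
Qed.

Lemma Mq_ge0 N : 0 <= Mq N.
Proof. by rewrite /Mq big_nat sumr_ge0// => i /andP[i1 _]; rewrite mulr_ge0// r_ge0. Qed.

(** At least half of the times before [q N.+2] come after [q N], and each of them
    has a radius at least [r (q N.+2)]. *)
Lemma bweight_le_Mq N : bweight N.+2 <= Mq N.+2 - Mq N.
Proof.
have q2 := cf_den_double a_gt0 N.
have qle : (q N <= q N.+2)%N by apply: cf_den_le => //; lia.
rewrite /Mq [X in X - _](@big_cat_nat _ _ _ (q N))//= [X in _ <= X - _]addrC addrK.
apply: (@le_trans _ _ (\sum_(q N <= i < q N.+2) 2 * r (q N.+2))).
  rewrite sumr_const_nat -[leRHS]mulr_natr natrB// /bweight.
  have : 2 * (q N)%:R <= (q N.+2)%:R :> R by rewrite -natrM ler_nat.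
  by have := r_ge0 (q_gt0 N.+2); nra.
apply: ler_sum_nat => i /andP[qi iq]; rewrite ler_pM2l//.
by apply: radius_le; [exact: leq_trans qi|exact: ltnW].
Qed.

Lemma sum_bweight_le N : \sum_(0 <= n < N) bweight n <= 2 * Mq N + 2 * bweight 0.
Proof.
have b1 := bweight_leS 0; have b0 := bweight_ge0 0.
case: N => [|[|N]].
- by rewrite big_geq// addr_ge0// mulr_ge0// Mq_ge0.
- by rewrite big_nat1; have := Mq_ge0 1; lra.
suff h : \sum_(0 <= n < N.+2) bweight n <= bweight 0 + bweight 1 + Mq N.+1 + Mq N.
  by have := Mq_leS N.+1; have := Mq_leS N; have := Mq_ge0 N; lra.
elim: N => [|N ih].
  by rewrite !big_nat_recr//= big_geq// add0r; have := Mq_ge0 1; have := Mq_ge0 0; lra.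
by rewrite big_nat_recr//=; have := bweight_le_Mq N; lra.
Qed.

Lemma bweight_mul_le N : N%:R * bweight N <= 2 * Mq N + 2 * bweight 0.
Proof.
apply: le_trans (sum_bweight_le N).
apply: (@le_trans _ _ (\sum_(0 <= n < N) bweight N)).
  by rewrite sumr_const_nat subn0 mulr_natl.
by apply: ler_sum_nat => n /andP[_ /ltnW]; exact: bweight_le.
Qed.

(** Up to the factor [2 * bweight n], a bound for the expected number of visits
    during a block, including the errors due to the windows. *)
Definition lam n : R := 2 + ln ((a n.+1)%:R + 1).

Lemma lam_ge0 n : 0 <= lam n.
Proof. by rewrite addr_ge0// ln_ge0// lerDr. Qed.

Lemma sum_radius_block n :
  \sum_(q n <= i < q n.+1) 2 * r i + 2 * bweight n <= 2 * bweight n * lam n.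
Proof.
have qq := cf_den_leS a_gt0 n; have b0 := bweight_ge0 n.
have h : \sum_(q n <= i < q n.+1) 2 * r i <= 2 * bweight n * \sum_(q n <= i < (q n.+1).+1) (i%:R)^-1.
  apply: (@le_trans _ _ (\sum_(q n <= i < q n.+1) 2 * bweight n * (i%:R)^-1)).
    apply: ler_sum_nat => i /andP[qi _]; rewrite -mulrA ler_pM2l//.
    have i0 : 0 < i%:R :> R by rewrite ltr0n (leq_trans _ qi).
    by rewrite ler_pdivlMr// mulrC; exact: ir_le.
  rewrite -mulr_sumr; apply: ler_wpM2l; first by rewrite mulr_ge0// bweight_ge0.
  by apply: le_sum_widen => // i _; rewrite invr_ge0.
have hq := @harmonic_le R _ _ (q_gt0 n) qq.
have hl : ln ((q n.+1)%:R / (q n)%:R) <= ln ((a n.+1)%:R + 1 : R).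
  have hp : 0 < (a n.+1)%:R + 1 :> R by rewrite ltr_wpDl.
  have hp2 : 0 < (q n.+1)%:R / (q n)%:R :> R by rewrite divr_gt0 ?ltr0n.
  rewrite ler_ln ?posrE//.
  by rewrite ler_pdivrMr ?ltr0n// natr1 -natrM ler_nat cf_den_leM.
have b20 : 0 <= 2 * bweight n by rewrite mulr_ge0.
have := ler_wpM2l b20 (le_trans hq (lerD (lexx 1) hl)).
by rewrite /lam; lra.
Qed.

(** ** The choice of the windows *)

Variables (s C : nat).
Hypothesis C1 : (1 <= C)%N.

Definition big_entry m := (C <= a m)%N.

(** Windows of length [q (n - 2 * s)] are short compared with the times [q n] of
    the block, which makes the sandwich tight, and yet comparable to [q n], which
    keeps the variance under control, unless one of the last [2 * s] entries is
    large. In such rare blocks, and in the first ones, the length is [q n]. *)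
Definition kap n := if (2 * s <= n)%N && ~~ has (fun d => big_entry (n - d)) (iota 0 (2 * s))
  then (n - 2 * s)%N else n.

Lemma kap_le n : (kap n <= n)%N.
Proof. by rewrite /kap; case: ifP => // _; exact: leq_subr. Qed.

Lemma cf_den_kap n : (q n)%:R <= (C ^ (2 * s))%:R * (q (kap n))%:R :> R.
Proof.
rewrite -natrM ler_nat /kap; case: ifPn => [/andP[sn /hasPn h]|_]; last first.
  by rewrite leq_pmull// expn_gt0 C1.
suff H d : (d <= 2 * s)%N -> (q n <= C ^ d * q (n - d))%N by exact: H.
elim: d => [|d ih] ds; first by rewrite subn0 mul1n.
apply: leq_trans (ih (ltnW ds)) _.
rewrite expnSr -mulnA leq_mul2l; apply/orP; right.
have -> : (n - d = (n - d.+1).+1)%N by lia.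
apply: leq_trans (cf_den_leM a_gt0 _) _; rewrite leq_mul2r; apply/orP; right.
have -> : ((n - d.+1).+1 = n - d)%N by lia.
by have := h d; rewrite mem_iota add0n ds /big_entry -ltnNge => /(_ isT).
Qed.

(** The ratio is exponentially small in [s], except for the first [2 * s] blocks
    and for those that follow a large entry within [2 * s] steps. *)
Lemma kap_ratio n : (q (kap n))%:R / (q n)%:R <=
  (2 ^ s)%:R^-1 + (n < 2 * s)%:R + \sum_(d <- iota 0 (2 * s)) ((d <= n) && big_entry (n - d))%N%:R :> R.
Proof.
have qn : 0 < (q n)%:R :> R by rewrite ltr0n.
have S0 : 0 <= \sum_(d <- iota 0 (2 * s)) ((d <= n) && big_entry (n - d))%N%:R :> R.
  exact: sumr_ge0.
have p0 : 0 < (2 ^ s)%:R :> R by rewrite ltr0n expn_gt0.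
rewrite /kap; case: ifPn => [/andP[sn _]|].
  apply: (@le_trans _ _ (2 ^ s)%:R^-1); last by rewrite -addrA lerDl addr_ge0.
  rewrite ler_pdivrMr// mulrC ler_pdivlMr// -natrM ler_nat mulnC.
  by have := cf_den_exp a_gt0 (n - 2 * s) s; rewrite subnK.
rewrite divff ?gt_eqF// negb_and -ltnNge negbK => /orP[ns|/hasP[d di hd]].
  by rewrite ns -addrA addrCA lerDl addr_ge0// invr_ge0 ltW.
have [ns|sn] := ltnP n (2 * s).
  by rewrite -addrA addrCA lerDl addr_ge0// invr_ge0 ltW.
rewrite addr0 (big_rem d)//=.
have dn : (d <= n)%N.
  by move: di; rewrite mem_iota add0n => /andP[_ ds]; exact: leq_trans (ltnW ds) sn.
rewrite dn hd/= addrCA lerDl; apply: addr_ge0; last exact: sumr_ge0.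
by rewrite invr_ge0 ltW.
Qed.

Lemma sum_kap_ratio (A dl : R) : 0 <= dl ->
  (forall N, \sum_(0 <= m < N) (big_entry m)%:R <= A + dl * N%:R) ->
  forall N, \sum_(0 <= n < N) (q (kap n))%:R / (q n)%:R <=
    (2 * s)%:R * (1 + A) + ((2 ^ s)%:R^-1 + (2 * s)%:R * dl) * N%:R.
Proof.
move=> dl0 hA N.
have A0 : 0 <= A by have := hA 0%N; rewrite big_geq// mulr0 addr0.
apply: le_trans (ler_sum _ (fun n _ => kap_ratio n)) _.
rewrite !big_split/=.
have -> : \sum_(0 <= i < N) (2 ^ s)%:R^-1 = (2 ^ s)%:R^-1 * N%:R :> R.
  by rewrite sumr_const_nat subn0 mulr_natr.
have h1 : \sum_(0 <= i < N) (i < 2 * s)%N%:R <= (2 * s)%:R :> R.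
  rewrite -natr_sum ler_nat; elim: N => [|N ih]; first by rewrite big_geq.
  suff : (\sum_(0 <= i < N) (i < 2 * s) <= minn N (2 * s))%N.
    by rewrite big_nat_recr//=; case: ltnP; rewrite ?addn0 ?addn1; lia.
  elim: (N) => [|M IH]; first by rewrite big_geq.
  by rewrite big_nat_recr//=; case: ltnP; rewrite ?addn0 ?addn1; lia.
have h2 : \sum_(0 <= n < N) \sum_(d <- iota 0 (2 * s)) ((d <= n) && big_entry (n - d))%N%:R
    <= (2 * s)%:R * (A + dl * N%:R).
  rewrite exchange_big/=.
  have -> : (2 * s)%:R * (A + dl * N%:R) = \sum_(d <- iota 0 (2 * s)) (A + dl * N%:R).
    by rewrite big_const_seq count_predT size_iota iter_addr_0 mulr_natl.
  apply: ler_sum => d _; apply: le_trans (hA N).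
  have [dN|Nd] := leqP d N; last first.
    rewrite big_nat big1 ?sumr_ge0// => n /andP[_ nN].
    by rewrite leqNgt (leq_trans nN (ltnW Nd)).
  rewrite (@big_cat_nat _ _ _ d)//= [X in X + _]big_nat [X in X + _]big1 ?add0r; last first.
    by move=> n /andP[_ nd]; rewrite leqNgt nd.
  rewrite -{1}[d]add0n big_addn.
  under eq_bigr do rewrite leq_addl addnK/=.
  by apply: le_sum_widen => //; exact: leq_subr.
by lra.
Qed.

End Comparison.

(** * The strong law for the visits *)

Section VisitLaw.
Variables (R : realType) (alpha c : R) (a : nat -> nat).
Hypothesis alpha01 : 0 <= alpha < 1.
Hypothesis alphaI : irrational alpha.
Hypothesis alphaE : cf_expansion alpha a.
Local Notation q := (cf_den a).
Local Notation mu := (@lebesgue_measure R).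
Variable r : nat -> R.
Hypothesis r_ge0 : forall i, (1 <= i)%N -> 0 <= r i.
Hypothesis ir_le : forall i j, (1 <= i)%N -> (i <= j)%N -> j%:R * r j <= i%:R * r i.
Local Notation Mq := (Mq a r).
Local Notation bw := (bweight a r).
Local Notation lam := (lam R a).
Hypothesis Mq_infty : forall A, exists N, A <= Mq N.
Hypothesis lam_small : forall dl, 0 < dl -> \forall N \near \oo, lam N <= dl * N%:R.
Hypothesis lam_sum : exists S, forall N, \sum_(0 <= n < N) (a n.+1)%:R * lam n / n%:R ^+ 2 <= S.
Hypothesis sparse : forall dl : R, 0 < dl -> exists C : nat, (1 <= C)%N /\
  exists A : R, forall N, \sum_(0 <= m < N) (big_entry a C m)%:R <= A + dl * N%:R.

Let a_gt0 : forall i, (1 <= i)%N -> (1 <= a i)%N. Proof. exact: alphaE.1. Qed.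
Let q_gt0 n : (0 < q n)%N. Proof. exact: cf_den_gt0. Qed.
Let r_le i j : (1 <= i)%N -> (i <= j)%N -> r j <= r i.
Proof. exact: radius_le. Qed.

Let Mq_homo m n : (m <= n)%N -> Mq m <= Mq n.
Proof.
apply: (homo_leq (r := <=%R)) => //; first exact: le_trans.
by move=> k; exact: Mq_leS.
Qed.

Lemma Mq_large A : \forall N \near \oo, A <= Mq N.
Proof.
have [N hN] := Mq_infty A; exists N => // n /= Nn.
by apply: le_trans hN _; exact: Mq_homo.
Qed.

Lemma exists_small_radius : exists n0, r (q n0) <= 2^-1.
Proof.
exists (2 * (Num.trunc (2 * bw 0)).+1)%N.
set s := (Num.trunc _).+1.
have qs : s%:R <= (q (2 * s))%:R :> R.
  rewrite ler_nat; apply: leq_trans (cf_den_exp a_gt0 0 s).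
  have -> : q 0 = 1%N by [].
  by rewrite muln1 ltnW// ltn_expl.
have b0 := bweight_le a_gt0 ir_le (leq0n (2 * s)).
have s2 : 2 * bw 0 < s%:R by exact: truncnS_gt.
have q0 : 0 < (q (2 * s))%:R :> R by rewrite ltr0n.
rewrite -(ler_pM2l q0); rewrite /bweight in b0 *.
by apply: le_trans b0 _; rewrite /bweight in s2; lra.
Qed.

Definition Xq N x : R := \sum_(1 <= i < q N) \1_(visit alpha c (i, r i)) x.

Lemma visit_homo (x : R) i (s t : R) : s <= t ->
  \1_(visit alpha c (i, s)) x <= \1_(visit alpha c (i, t)) x :> R.
Proof.
move=> st; rewrite !indicE; case: (boolP (x \in visit alpha c (i, s))) => // /set_mem[xD /= xs].
by rewrite mem_set//; split => //=; exact: lt_le_trans st.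
Qed.

Lemma Xq_le N x : Xq N x <= (q N)%:R.
Proof.
apply: (@le_trans _ _ (\sum_(1 <= i < q N) 1)).
  by apply: ler_sum => i _; rewrite indicE; case: (_ \in _).
by rewrite sumr_const_nat ler_nat leq_subr.
Qed.

Lemma Xq_ge0 N x : 0 <= Xq N x. Proof. exact: sumr_ge0. Qed.

(** The means of the two systems differ from [Mq] by the sum of the weights
    [bweight n] times the relative window lengths, which summation by parts
    bounds by [O(eps)] times the sum of the weights, hence by [O(eps) * Mq].
    Both systems satisfy the strong law and they enclose the visits. *)
Lemma law_along_den eps : 0 < eps <= 8^-1 -> {ae mu, forall x, 0 <= x < 1 ->
  \forall N \near \oo, (1 - 16 * eps) * Mq N <= Xq N x <= (1 + 16 * eps) * Mq N}.
Proof.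
move=> /andP[e0 e8].
have [s hs] : exists s, (2 ^ s)%:R^-1 <= eps / 2.
  exists (Num.trunc (2 / eps)).+1.
  have : 2 / eps < (2 ^ (Num.trunc (2 / eps)).+1)%:R.
    apply: (lt_le_trans (truncnS_gt _)); rewrite ler_nat ltnW// ltn_expl//.
  move=> /ltW h; rewrite -(invf_div 2 eps); set X := (2 ^ _)%:R in h *.
  have X0 : 0 < X by rewrite /X ltr0n expn_gt0.
  have p1 : 0 < 2 / eps by rewrite divr_gt0.
  by rewrite lef_pV2 ?posrE.
pose dl := eps / (4 * s.+1%:R).
have s0 : 0 < s.+1%:R :> R by [].
have dl0 : 0 < dl by rewrite divr_gt0// mulr_gt0.
have [C [C1 [A hA]]] := sparse dl0.
have [n0 hn0] := exists_small_radius.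
pose kp := kap a s C.
have kple : forall n, (kp n <= n)%N by exact: kap_le.
have ratio N : \sum_(0 <= n < N) (q (kp n))%:R / (q n)%:R <= (2 * s)%:R * (1 + A) + eps * N%:R.
  apply: le_trans (sum_kap_ratio a_gt0 s C1 (ltW dl0) hA N) _.
  rewrite lerD2l ler_wpM2r//.
  suff : (2 * s)%:R * dl <= eps / 2 by lra.
  rewrite /dl mulrA ler_pdivrMr; last by rewrite mulr_gt0.
  rewrite natrM -[s.+1%:R]natr1; have : 0 <= s%:R :> R by [].
  by nra.
set A1 := (2 * s)%:R * (1 + A) in ratio.
have gap N : \sum_(0 <= n < N) 2 * (wlen a kp n)%:R * r (q n) <=
    4 * eps * Mq N + (2 * A1 + 4 * eps) * bw 0.
  have -> : \sum_(0 <= n < N) 2 * (wlen a kp n)%:R * r (q n) =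
      2 * \sum_(0 <= n < N) bw n * ((q (kp n))%:R / (q n)%:R).
    rewrite mulr_sumr; apply: eq_bigr => n _; rewrite /wlen /bweight.
    have : (q n)%:R != 0 :> R by rewrite pnatr_eq0 -lt0n.
    by move=> qn; field.
  have h1 := abel_le (bweight_ge0 a_gt0 r_ge0) (bweight_leS a_gt0 ir_le) ratio N.
  have h2 := sum_bweight_le a_gt0 r_ge0 ir_le N.
  by have := ler_wpM2l (ltW e0) h2; lra.
set A2 := (2 * A1 + 4 * eps) * bw 0 in gap.
have wle n : (wlen a kp n)%:R * r (q n) <= bw n.
  by rewrite /bweight ler_wpM2r ?r_ge0// ler_nat wlen_le.
have CKL n : (q n)%:R <= (C ^ (2 * s))%:R * (wlen a kp n)%:R :> R.
  exact: cf_den_kap.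
have adm i n : (n0 <= n)%N -> 0 <= r (q n + i)%N <= 2^-1.
  move=> nn; rewrite r_ge0 ?addn_gt0 ?q_gt0//=; apply: le_trans hn0; apply: r_le => //.
  by apply: leq_trans (leq_addr _ _); exact: cf_den_le.
have [S hS] := lam_sum.
have good (m : nat -> R) A3 :
    (forall N, (n0 <= N)%N -> Mq N <= 2 * m N + A3) ->
    (forall B, exists N, B <= m N) /\ (\forall N \near \oo, N%:R * bw N <= 8 * m N).
  move=> hm.
  have big B : exists N1, forall N, (N1 <= N)%N -> B <= m N.
    have [N1 _ hN1] := Mq_large (2 * B + A3); exists (maxn N1 n0) => N; rewrite geq_max => /andP[h1 h2].
    by have := hN1 N h1; have := hm N h2; rewrite /=; lra.
  split; first by move=> B; have [N1 h] := big B; exists N1; exact: h.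
  have [N1 h] := big `|2 * A3 + 2 * bw 0|; exists (maxn N1 n0) => // N /=; rewrite geq_max => /andP[h1 h2].
  have := h N h1; have := hm N h2; have := bweight_mul_le a_gt0 r_ge0 ir_le N.
  have := ler_norm (2 * A3 + 2 * bw 0); have := normr_ge0 (2 * A3 + 2 * bw 0).
  by lra.
have F2 (u : nat * R) : 0 <= u.2 -> 0 <= 2 * u.2 by move=> ?; rewrite mulr_ge0.
have F2h (i : nat) (s1 t1 : R) : s1 <= t1 -> 2 * s1 <= 2 * t1 by move=> ?; rewrite ler_pM2l.
have Mup N : (n0 <= N)%N -> Mq N <= Mq n0 + mean (sysup a r kp n0 N).
  move=> nN; have h := @le_sum_sysup _ _ a_gt0 _ r_ge0 r_le kp n0 (fun u => 2 * u.2) F2 F2h N nN.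
  exact: h.
have Mup2 N : mean (sysup a r kp n0 N) <= Mq N + (4 * eps * Mq N + A2).
  apply: le_trans (mean_sysup_le a_gt0 r_ge0 r_le n0 kple N) _.
  by rewrite lerD2l.
have Mlow N : (n0 <= N)%N -> Mq N <= Mq n0 + mean (syslow a r kp n0 N) + (4 * eps * Mq N + A2).
  move=> nN; have h := mean_syslow_ge a_gt0 r_ge0 r_le kp nN.
  apply: le_trans h _.
  by rewrite lerD2l.
have bq : Mq n0 <= Mq n0 by [].
have [gup1 gup2] : (forall B, exists N, B <= mean (sysup a r kp n0 N)) /\
    (\forall N \near \oo, N%:R * bw N <= 8 * mean (sysup a r kp n0 N)).
  apply: (good _ (2 * Mq n0)) => N /Mup; have := Mq_ge0 a r_ge0 N; lra.
have [glow1 glow2] : (forall B, exists N, B <= mean (syslow a r kp n0 N)) /\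
    (\forall N \near \oo, N%:R * bw N <= 8 * mean (syslow a r kp n0 N)).
  apply: (good _ (2 * Mq n0 + 2 * A2)) => N /Mlow.
  have : eps * Mq N <= 8^-1 * Mq N by rewrite ler_wpM2r// Mq_ge0.
  by lra.
have lam0 := lam_ge0 R a.
have blkup_lam n : mean (blkup a r kp n0 n) <= 2 * bw n * lam n.
  apply: le_trans (mean_blkup_le a_gt0 r_ge0 r_le n0 kple n) _.
  apply: le_trans (sum_radius_block a_gt0 r_ge0 ir_le n).
  by rewrite lerD2l -mulrA ler_pM2l.
have blklow_lam n : mean (blklow a r kp n0 n) <= 2 * bw n * lam n.
  have h := @le_sum_blklow _ _ a_gt0 _ r_ge0 r_le kp n0 (fun u => 2 * u.2) F2 F2h n.
  apply: le_trans h _.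
  apply: le_trans (sum_radius_block a_gt0 r_ge0 ir_le n).
  by rewrite lerDl mulr_ge0// bweight_ge0.
have e1 : 0 < eps <= 1 by rewrite e0/=; lra.
have Kup_n0 n k : (k < Kup a kp n0 n)%N -> (n0 <= n)%N.
  by rewrite /Kup [(n0 <= n)%N]leqNgt; case: ifP.
have Klow_n0 n k : (k < Klow a kp n0 n)%N -> (n0 <= n)%N.
  by rewrite /Klow [(n0 <= n)%N]leqNgt; case: ifP.
have rb_up n k : (k < Kup a kp n0 n)%N -> rup a r kp n k * (q n + k * wlen a kp n)%:R <= bw n.
  by move=> _; rewrite mulrC; apply: ir_le => //; exact: leq_addr.
have rb_low n k : (k < Klow a kp n0 n)%N -> rlow a r kp n k * (q n + k * wlen a kp n)%:R <= bw n.
  move=> _; rewrite mulrC.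
  apply: (@le_trans _ _ ((q n + k.+1 * wlen a kp n)%:R * rlow a r kp n k)).
    rewrite ler_wpM2r ?ler_nat ?leq_add2l ?leq_mul2r ?leqnSn ?orbT// r_ge0//.
    by rewrite addn_gt0 q_gt0.
  by apply: ir_le => //; exact: leq_addr.
have adm_up n k : (k < Kup a kp n0 n)%N -> 0 <= rup a r kp n k <= 2^-1.
  by move=> /Kup_n0; exact: adm.
have adm_low n k : (k < Klow a kp n0 n)%N -> 0 <= rlow a r kp n k <= 2^-1.
  by move=> /Klow_n0; exact: adm.
have KL_up n : (Kup a kp n0 n * wlen a kp n + q n <= q n.+1 + wlen a kp n)%N by exact: Kup_le.
have KL_low n : (Klow a kp n0 n * wlen a kp n + q n <= q n.+1 + wlen a kp n)%N.
  by rewrite addnC; apply: leq_trans (leq_addr _ _); exact: Klow_le.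
have wq n : (wlen a kp n <= q n)%N by exact: wlen_le.
have law_up := strong_law_sys c alpha01 alphaI alphaE (fun n => erefl (wlen a kp n))
  wq CKL KL_up adm_up rb_up
  (bweight_ge0 a_gt0 r_ge0) lam0 lam_small hS blkup_lam gup1 gup2 e1.
have law_low := strong_law_sys c alpha01 alphaI alphaE (fun n => erefl (wlen a kp n))
  wq CKL KL_low adm_low rb_low
  (bweight_ge0 a_gt0 r_ge0) lam0 lam_small hS blklow_lam glow1 glow2 e1.
have FF := ae_filter_ringOfSetsType mu.
apply: filterS (filterI law_up law_low) => x [hup hlow] x01.
have {hup} [N1 _ hN1] := hup x01; have {hlow} [N2 _ hN2] := hlow x01.
have Fv (u : nat * R) : 0 <= u.2 -> 0 <= \1_(visit alpha c u) x :> R by [].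
have Fvh i s1 t1 := @visit_homo x i s1 t1.
set A3 := (q n0)%:R + 2 * `|A2|.
have [N3 _ hN3] := Mq_large (A3 / eps + Mq n0 / eps).
exists (maxn N1 (maxn N2 (maxn N3 n0))) => // N /=; rewrite !geq_max => /and4P[n1 n2 n3 n4].
have /andP[_ u1] := hN1 N n1; have /andP[l1 _] := hN2 N n2.
have big := hN3 N n3; rewrite /= -mulrDl ler_pdivrMr// in big.
have U := @le_sum_sysup _ _ a_gt0 _ r_ge0 r_le kp n0 _ Fv Fvh N n4.
have W := @le_sum_syslow _ _ a_gt0 _ r_ge0 r_le kp n0 _ Fv Fvh N n4.
rewrite -/(Xq N x) -/(Xq n0 x) -/(visits _ _ _ _) in U W.
have p0 := Xq_ge0 n0 x; have p1 := Xq_le n0 x.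
have m0 := Mq_ge0 a r_ge0 N; have m00 := Mq_ge0 a r_ge0 n0.
have up2 := Mup2 N; have lo := Mlow N n4.
have aA := ler_norm A2; have aA0 := normr_ge0 A2.
have eA : eps * `|A2| <= 8^-1 * `|A2| by rewrite ler_wpM2r.
have em0 : 0 <= eps * Mq N by rewrite mulr_ge0// ltW.
have eem : eps * (eps * Mq N) <= 8^-1 * (eps * Mq N) by rewrite ler_wpM2r.
have eem0 : 0 <= eps * (eps * Mq N) by rewrite mulr_ge0// ltW.
apply/andP; split.
  apply: le_trans W; apply: (@le_trans _ _ ((1 - eps) * mean (syslow a r kp n0 N))).
    have e10 : 0 <= 1 - eps by lra.
    have h : (1 - eps) * (Mq N - Mq n0 - 4 * eps * Mq N - A2) <= (1 - eps) * mean (syslow a r kp n0 N).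
      by apply: ler_wpM2l => //; lra.
    apply: le_trans h.
    have emn : eps * Mq n0 <= 8^-1 * Mq n0 by rewrite ler_wpM2r.
    have : eps * (- A2) <= eps * `|A2| by rewrite ler_wpM2l ?(ltW e0)// -normrN ler_norm.
    have emn0 : 0 <= eps * Mq n0 by rewrite mulr_ge0// ltW.
    rewrite /A3 in big; have qn0 : 0 <= (q n0)%:R :> R by [].
    by lra.
  by apply: le_trans l1 _; rewrite lerDr.
apply: (le_trans U); apply: (@le_trans _ _ ((q n0)%:R + (1 + eps) * mean (sysup a r kp n0 N))).
  exact: lerD.
have e10 : 0 <= 1 + eps by lra.
have := ler_wpM2l e10 up2.
have : eps * A2 <= eps * `|A2| by rewrite ler_wpM2l ?(ltW e0)// ler_norm.
by rewrite /A3 in big; lra.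
Qed.

End VisitLaw.

(** * Elementary estimates *)

Section Estimates.
Variable R : realType.
Implicit Types (x y p : R).

Lemma ln_le_powR p y : 0 < p -> 0 < y -> ln y <= p^-1 * y `^ p.
Proof.
move=> p0 y0; have := ln_sublinear (powR_gt0 p y0).
rewrite ln_powR => /ltW h; rewrite -(ler_pM2l p0); apply: le_trans h _.
by rewrite mulrA divff ?gt_eqF// mul1r.
Qed.

Lemma powRN_step p (n : nat) : 0 < p -> (0 < n)%N ->
  p * n.+1%:R `^ (- (1 + p)) <= n%:R `^ (- p) - n.+1%:R `^ (- p).
Proof.
move=> p0 n0; set x := n.+1%:R : R; have x0 : 0 < x by rewrite ltr0n.
have nE : n%:R = x * (1 - x^-1) :> R by rewrite mulrBr mulr1 divff ?gt_eqF// /x -natr1 addrK.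
have u0 : 0 < 1 - x^-1.
  by rewrite subr_gt0 invf_lt1// /x ltr1n ltnS.
have -> : n%:R `^ (- p) = x `^ (- p) * (1 - x^-1) `^ (- p).
  by rewrite nE powRM// ltW.
have -> : x `^ (- (1 + p)) = x `^ (- p) * x^-1.
  rewrite (_ : - (1 + p) = - p + -1); last by ring.
  by rewrite powRD ?(gt_eqF x0) ?implybT// powR_inv1// ltW.
rewrite -[X in _ <= _ - X]mulr1 -mulrBr mulrCA ler_pM2l ?powR_gt0//.
rewrite lerBrDr /powR gt_eqF//.
apply: le_trans (expR_ge1Dx _); rewrite addrC lerD2l.
have : ln (1 + (- x^-1)) <= - x^-1 by apply: le_ln1Dx; rewrite -subr_gt0 opprK addrC.
by move=> h; rewrite mulNr lerNr -mulrN; apply: ler_wpM2l => //; exact: ltW.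
Qed.

Lemma pseries_le p N : 0 < p ->
  \sum_(1 <= k < N) (k%:R : R) `^ (- (1 + p)) <= 1 + p^-1.
Proof.
move=> p0; have pi0 : 0 < p^-1 by rewrite invr_gt0.
case: N => [|[|N]]; try by rewrite big_geq// addr_ge0// ltW.
suff h : \sum_(1 <= k < N.+2) (k%:R : R) `^ (- (1 + p)) <= 1 + p^-1 * (1 - N.+1%:R `^ (- p)).
  apply: le_trans h _.
  by have := mulr_ge0 (ltW pi0) (powR_ge0 N.+1%:R (- p)); lra.
elim: N => [|N ih]; first by rewrite big_nat1 !powR1 subrr mulr0 addr0.
rewrite big_nat_recr//=.
have := powRN_step p0 (ltn0Sn N).
rewrite -(ler_pM2l pi0) mulrA mulVf ?gt_eqF// mul1r => h.
by lra.
Qed.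

Lemma limn_esup_lt (u : nat -> \bar R) (l : \bar R) : (limn_esup u < l)%E ->
  \forall n \near \oo, (u n < l)%E.
Proof.
move=> /ereal_inf_lt[_ [A Aoo <-] h].
apply: filterS Aoo => n An; apply: le_lt_trans h.
by apply: ereal_sup_ubound; exists n.
Qed.

Lemma le_limn_esup (u : nat -> \bar R) (l : \bar R) :
  (\forall n \near \oo, (u n <= l)%E) -> (limn_esup u <= l)%E.
Proof.
move=> h; apply: le_trans (ereal_inf_lbound _) _; first by exists [set n | (u n <= l)%E].
by apply: ge_ereal_sup => _ [n /= hn <-].
Qed.

End Estimates.

(** * Consequences of the three conditions *)

Section Conditions.
Variables (R : realType) (a : nat -> nat).
Hypothesis a_gt0 : forall i, (1 <= i)%N -> (1 <= a i)%N.
Local Notation lam := (lam R a).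

Lemma near_inftyR (x : R) : \forall n \near \oo, x <= n%:R.
Proof.
exists (Num.trunc x).+1 => // n /= h.
apply/ltW/(lt_le_trans (truncnS_gt x)); by rewrite ler_nat.
Qed.

Hypothesis a_lt : \forall n \near \oo, (a n)%:R < n%:R `^ (4 / 3) :> R.

Lemma lam_le_ln : \forall n \near \oo, lam n <= 3 * ln (n.+1%:R).
Proof.
have [n1 _ h1] := a_lt; have [n2 _ h2] := near_inftyR (expR 2).
exists (maxn n1 n2) => // n /=; rewrite geq_max => /andP[n1n n2n].
have ak := h1 n.+1 (leqW n1n); rewrite /= in ak.
have k2 := h2 n.+1 (leqW n2n); rewrite /= in k2.
set k := n.+1%:R : R in ak k2 *.
have k1 : 1 <= k by rewrite ler1n.
have k0 : 0 < k by rewrite ltr0n.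
have lk : 2 <= ln k by rewrite -[2]expRK ler_ln ?posrE ?expR_gt0.
have K1 : 1 <= k `^ (4 / 3) by rewrite -[leLHS](powRr0 k) ler_powR// divr_ge0.
have : ln ((a n.+1)%:R + 1) <= ln (2 * k `^ (4 / 3)).
  by rewrite ler_ln ?posrE ?ltr_wpDl ?mulr_gt0 ?powR_gt0//; lra.
rewrite lnM ?posrE ?powR_gt0// ln_powR /lam.
have l2 : ln 2 <= 1 :> R.
  by rewrite (_ : 2 = 1 + 1 :> R)//; apply: le_ln1Dx; lra.
by lra.
Qed.

Lemma lam_small (dl : R) : 0 < dl -> \forall n \near \oo, lam n <= dl * n%:R.
Proof.
move=> dl0; have [n1 _ h1] := lam_le_ln; have [n2 _ h2] := near_inftyR ((12 / dl) ^+ 2).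
exists (maxn n1 (maxn n2 1)) => // n /=; rewrite !geq_max => /and3P[n1n n2n n0].
apply: le_trans (h1 n n1n) _.
have k0 : 0 < n.+1%:R :> R by rewrite ltr0n.
have kn : n.+1%:R <= 2 * n%:R :> R by rewrite -natrM ler_nat; lia.
have h := @ln_le_powR R 2^-1 n.+1%:R (_ : 0 < 2^-1) k0.
have {}h : ln n.+1%:R <= 2 * (n.+1%:R `^ (2^-1)) :> R by rewrite -[X in X * _](invrK 2) h.
set y := n.+1%:R `^ (2^-1) in h.
have y0 : 0 < y by exact: powR_gt0.
have y2 : y * y = n.+1%:R.
  by rewrite -powRD ?gt_eqF ?implybT// (_ : 2^-1 + 2^-1 = 1) ?powRr1//; lra.
have yd : 12 / dl <= y.
  have d12 : 0 <= 12 / dl by rewrite divr_ge0// ltW.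
  rewrite -ler_sqr ?nnegrE//; last exact: ltW.
  have := h2 n.+1 (leqW n2n); rewrite /= => h3.
  by rewrite [leRHS]expr2 y2.
rewrite ler_pdivrMr// in yd.
have := ler_wpM2l (ltW y0) yd; have := ler_wpM2l (ltW dl0) kn.
by have := congr1 ( *%R dl) y2; lra.
Qed.

Lemma sum_eventually_le (t w : nat -> R) n1 N :
  (forall n, 0 <= t n) -> (forall n, 0 <= w n) ->
  (forall n, (n1 <= n)%N -> t n <= w n.+1) ->
  \sum_(0 <= n < N) t n <= \sum_(0 <= n < n1) t n + \sum_(1 <= k < N.+1) w k.
Proof.
move=> t0 w0 tw; have W0 : 0 <= \sum_(1 <= k < N.+1) w k by exact: sumr_ge0.
have [Nn|nN] := leqP N n1.
  by apply: ler_wpDr => //; exact: le_sum_widen.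
rewrite (@big_cat_nat _ _ _ n1)/= ?(ltnW nN)// lerD2l big_add1/=.
rewrite [leRHS](@big_cat_nat _ _ _ n1)/= ?(ltnW nN)//; apply: ler_wpDl.
  exact: sumr_ge0.
by apply: ler_sum_nat => n /andP[n1n _]; exact: tw.
Qed.

Hypothesis a_sum : (\sum_(1 <= k <oo | (k%:R `^ (1 / 2) < (a k)%:R :> R)%R)
             (ln (k%:R : R) / k%:R `^ (2 / 3))%R%:E < +oo)%E.

Lemma large_entries_bound : exists T : R, forall N,
  \sum_(1 <= k < N | k%:R `^ (1 / 2) < (a k)%:R :> R) ln (k%:R : R) / k%:R `^ (2 / 3) <= T.
Proof.
have aS := a_sum; set S := (\sum_(1 <= k <oo | _) _)%E in aS.
have u0 k : (1 <= k)%N -> 0 <= ln (k%:R : R) / k%:R `^ (2 / 3).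
  by move=> k1; rewrite divr_ge0 ?powR_ge0// ln_ge0// ler1n.
have S0 : (0 <= S)%E.
  by apply: nneseries_ge0 => k k1 _; rewrite lee_fin u0.
exists (fine S) => N; rewrite -lee_fin fineK; last by rewrite ge0_fin_numE.
rewrite -sumEFin; apply: nneseries_lim_ge => k k1 _; rewrite lee_fin u0//.
Qed.

(** The entries that are at most [k `^ (1 / 2)] contribute a convergent series of
    powers. By the first condition the larger ones contribute
    [O(ln k / k `^ (2 / 3))], which is summable by the third condition. *)
Lemma lam_sum : exists S, forall N,
  \sum_(0 <= n < N) (a n.+1)%:R * lam n / n%:R ^+ 2 <= S.
Proof.
have [T hT] := large_entries_bound.
have [n1 _ h1] := lam_le_ln; have [n2 _ h2] := a_lt.
pose w k : R := 48 * k%:R `^ (- (1 + 4^-1)) +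
  12 * (if k%:R `^ (1 / 2) < (a k)%:R :> R then ln (k%:R : R) / k%:R `^ (2 / 3) else 0).
pose t n : R := (a n.+1)%:R * lam n / n%:R ^+ 2.
have t0 n : 0 <= t n by rewrite /t !mulr_ge0 ?lam_ge0// invr_ge0 exprn_ge0.
have u0 k : 0 <= ln (k%:R : R) / k%:R `^ (2 / 3).
  case: k => [|k]; first by rewrite ln0// mul0r.
  by rewrite divr_ge0 ?powR_ge0// ln_ge0// ler1n.
have w0 n : 0 <= w n.
  by rewrite /w addr_ge0 ?mulr_ge0 ?powR_ge0//; case: ifP.
exists (\sum_(0 <= n < maxn (maxn n1 n2) 1) t n + (48 * (1 + 4) + 12 * T)) => N.
apply: le_trans (@sum_eventually_le t w (maxn (maxn n1 n2) 1) N t0 w0 _) _; last first.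
  rewrite lerD2l big_split/= -!mulr_sumr -big_mkcond/=.
  have q0 : 0 < 4^-1 :> R by rewrite invr_gt0.
  by have := pseries_le N.+1 q0; have := hT N.+1; rewrite invrK; lra.
move=> n; rewrite !geq_max -andbA => /and3P[n1n n2n n0].
have k0 : 0 < n.+1%:R :> R by rewrite ltr0n.
have kn : n.+1%:R <= 2 * n%:R :> R by rewrite -natrM ler_nat; lia.
have n0' : 0 < n%:R :> R by rewrite ltr0n.
have lb := h1 n n1n; have ab := h2 n.+1 (leqW n2n); rewrite /= in lb ab.
rewrite /t /w; set k := n.+1%:R : R in k0 kn lb ab *.
have k1 : 1 <= k by rewrite ler1n.
have lk : 0 <= ln k by rewrite ln_ge0.
have step1 : (a n.+1)%:R * lam n / n%:R ^+ 2 <= (a n.+1)%:R * (12 * ln k / k ^+ 2).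
  rewrite -mulrA; apply: ler_wpM2l => //.
  rewrite ler_pdivrMr ?exprn_gt0// mulrAC ler_pdivlMr ?exprn_gt0//.
  apply: (@le_trans _ _ (3 * ln k * k ^+ 2)); first by rewrite ler_wpM2r// exprn_ge0// ltW.
  have : k ^+ 2 <= (2 * n%:R) ^+ 2 by rewrite lerXn2r// nnegrE ?ltW// mulr_gt0.
  have lk3 : 0 <= 3 * ln k by rewrite mulr_ge0.
  by move=> h; have := ler_wpM2l lk3 h; rewrite exprMn !expr2; lra.
apply: (le_trans step1).
have k2 : k ^+ 2 = k `^ 2 by rewrite powR_mulrn// ltW.
have pk s u : k `^ (s + u) = k `^ s * k `^ u.
  by rewrite powRD// (gt_eqF k0) implybT.
case: ifPn => [_|]; last first.
  rewrite -leNgt mulr0 addr0 => ha.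
  have q0 : 0 < 4^-1 :> R by rewrite invr_gt0.
  have l4 := ln_le_powR q0 k0.
  rewrite invrK in l4.
  apply: (@le_trans _ _ (k `^ (1 / 2) * (12 * (4 * k `^ (4^-1)) / k ^+ 2))).
    apply: ler_pM => //; first by rewrite !mulr_ge0// invr_ge0 exprn_ge0// ltW.
    rewrite ler_wpM2r ?invr_ge0 ?exprn_ge0 ?(ltW k0)// ler_pM2l//.
  rewrite k2 -powRN (_ : - (1 + 4^-1) = 1 / 2 + (4^-1 + - 2)); last by field.
  by rewrite !pk; lra.
rewrite ler_wpDl ?mulr_ge0 ?powR_ge0//.
apply: (@le_trans _ _ (k `^ (4 / 3) * (12 * ln k / k ^+ 2))).
  by apply: ler_wpM2r; [rewrite !mulr_ge0// invr_ge0 exprn_ge0// ltW|exact: ltW].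
rewrite k2 -!powRN (_ : - (2 / 3) = 4 / 3 + - 2); last by field.
by rewrite pk; lra.
Qed.

Hypothesis a_tail : limn_esup (fun N : nat =>
            (N%:R^-1 *
              (\sum_(1 <= i < N.+1) ln ((a i)%:R : R)
               - \sum_(1 <= i < N.+1 | (a i)%:R < C) ln ((a i)%:R : R)))%:E)
            @[C --> (+oo : set_system R)] --> (0%:E : \bar R).

(** Once [C] exceeds [e], each entry at least [C] adds at least [1] to the sum of
    logarithms that the second condition makes small. *)
Lemma sparse_big_entries (dl : R) : 0 < dl -> exists C : nat, (1 <= C)%N /\
  exists A : R, forall N, \sum_(0 <= m < N) (big_entry a C m)%:R <= A + dl * N%:R.
Proof.
move=> dl0.
have : \forall C \near (+oo : set_system R), (limn_esup (fun N : nat =>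
            (N%:R^-1 *
              (\sum_(1 <= i < N.+1) ln ((a i)%:R : R)
               - \sum_(1 <= i < N.+1 | ((a i)%:R < C)%R) ln ((a i)%:R : R)))%:E) < dl%:E)%E.
  have dlE : (0%:E < dl%:E)%E by rewrite lte_fin.
  exact: (a_tail (open_ereal_lt' dlE)).
move=> [M [_ hM]].
pose C := maxn (Num.trunc (expR 1 : R)).+1 (Num.trunc M).+1.
have MC : M < C%:R.
  by apply: (lt_le_trans (truncnS_gt M)); rewrite ler_nat leq_maxr.
have eC : expR 1 <= C%:R :> R.
  by apply/ltW/(lt_le_trans (truncnS_gt _)); rewrite ler_nat leq_maxl.
exists C; split; first by rewrite (leq_trans _ (leq_maxl _ _)).
have [N1 _ h] := limn_esup_lt (hM _ MC).
exists (N1.+1)%:R => N.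
have big0 m : 0 <= (big_entry a C m)%:R :> R by [].
have count_le N' : (0 < N')%N -> (N1 <= N')%N ->
    \sum_(1 <= m < N'.+1) (big_entry a C m)%:R <= dl * N'%:R.
  move=> N'0 N1N'; have := h N' N1N'; rewrite /= lte_fin.
  have Np : 0 < N'%:R :> R by rewrite ltr0n.
  rewrite mulrC ltr_pdivrMr// => /ltW; apply: le_trans.
  rewrite [X in _ <= _ - X]big_mkcond/= -sumrB; apply: ler_sum_nat => m /andP[m1 _].
  have am1 : 1 <= (a m)%:R :> R by rewrite ler1n a_gt0.
  rewrite /big_entry ltr_nat ltnNge; case: leqP => Cm /=; last by rewrite subrr.
  rewrite subr0 -[leLHS]expRK ler_ln ?posrE ?expR_gt0//; last by rewrite (lt_le_trans ltr01).
  by apply: (le_trans eC); rewrite ler_nat.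
case: N => [|N]; first by rewrite big_geq// mulr0 addr0.
have [NN1|N1N] := ltnP N N1.+1.
  apply: (@le_trans _ _ N.+1%:R); last first.
    by apply: ler_wpDr; [rewrite mulr_ge0// ltW|rewrite ler_nat].
  apply: (@le_trans _ _ (\sum_(0 <= m < N.+1) 1)).
    by apply: ler_sum => m _; case: (big_entry a C m).
  by rewrite sumr_const_nat subn0.
rewrite big_ltn//; apply: lerD.
  by case: (big_entry a C 0); rewrite ?ler1n.
have := count_le N (leq_ltn_trans (leq0n _) N1N) (ltnW N1N) => h1.
by apply: (le_trans h1); rewrite ler_wpM2l ?(ltW dl0)// ler_nat.
Qed.

End Conditions.

(** * From denominators to all times *)

Section Interpolation.
Variables (R : realType) (q : nat -> nat).
Hypothesis q0 : q 0%N = 1%N.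
Hypothesis q_infty : forall N, exists n, (N < q n)%N.
Variables (X M : nat -> R) (eps : R).
Hypothesis X_homo : forall m n, (m <= n)%N -> X m <= X n.
Hypothesis M_homo : forall m n, (m <= n)%N -> M m <= M n.
Hypothesis eps0 : 0 < eps <= 8^-1.
Hypothesis M_pos : \forall n \near \oo, 0 < M (q n).
Hypothesis M_jump : \forall n \near \oo, M (q n.+1) <= (1 + eps) * M (q n).
Hypothesis law : \forall n \near \oo,
  (1 - 16 * eps) * M (q n) <= X (q n) <= (1 + 16 * eps) * M (q n).

Lemma interpolate_law : \forall N \near \oo, `|X N / M N - 1| <= 19 * eps.
Proof.
have [n1 _ h1] := M_pos; have [n2 _ h2] := M_jump; have [n3 _ h3] := law.
pose n0 := maxn n1 (maxn n2 n3).
exists (\max_(n < n0.+1) q n)%N => // N /= hN.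
have exn := q_infty N.
have [m mP mmin] : exists2 m, (N < q m)%N & forall j, (N < q j)%N -> (m <= j)%N.
  by exists (ex_minn exn); case: ex_minnP.
have n0m : (n0 < m)%N.
  rewrite ltnNge; apply/negP => mn0.
  have := @leq_bigmax _ (fun n : 'I_n0.+1 => q n) (Ordinal (mn0 : (m < n0.+1)%N)).
  by rewrite leqNgt (leq_ltn_trans hN mP).
case: m mP mmin n0m => [//|n] mP mmin; rewrite ltnS => n0n.
have qnN : (q n <= N)%N by rewrite leqNgt; apply/negP => /mmin; rewrite ltnn.
have n1n : (n1 <= n)%N by apply: leq_trans n0n; exact: leq_maxl.
have n2n : (n2 <= n)%N by apply: leq_trans n0n; rewrite leq_max leq_maxl orbT.
have n3n : (n3 <= n)%N by apply: leq_trans n0n; rewrite leq_max leq_maxr orbT.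
have Mp := h1 n n1n; have Mj := h2 n n2n.
have /andP[l1 l2] := h3 n n3n; have /andP[l3 l4] := h3 n.+1 (leqW n3n).
rewrite /= in Mp Mj.
have a1 := X_homo qnN; have a2 := X_homo (ltnW mP).
have b1 := M_homo qnN; have b2 := M_homo (ltnW mP).
have MN : 0 < M N by exact: lt_le_trans b1.
have /andP[e0 e8] := eps0.
rewrite ler_norml lerBrDr lerBlDr; apply/andP; split.
  rewrite ler_pdivlMr//; apply: le_trans (le_trans l1 a1).
  have eM : 0 <= eps * M (q n) by rewrite mulr_ge0// ltW.
  have [u0|u0] := lerP (- (19 * eps) + 1) 0.
    by apply: (@le_trans _ _ ((- (19 * eps) + 1) * M (q n))); [exact: ler_wnM2l|lra].
  have h := le_trans b2 Mj.
  apply: (le_trans (ler_wpM2l (ltW u0) h)).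
  by have := mulr_ge0 (ltW e0) eM; lra.
rewrite ler_pdivrMr//; apply: (le_trans a2); apply: (le_trans l4).
have e16 : 0 <= 1 + 16 * eps by lra.
have ee : eps * M (q n) * eps <= eps * M (q n) * 8^-1.
  by rewrite ler_wpM2l// mulr_ge0// ltW.
apply: (le_trans (ler_wpM2l e16 Mj)).
apply: (@le_trans _ _ ((19 * eps + 1) * M (q n))); first by lra.
by rewrite ler_wpM2l//; lra.
Qed.

End Interpolation.

Section VisitTheorem.
Variable R : realType.
Local Notation mu := (@lebesgue_measure R).

Lemma dist_intN (t : R) : dist_int (- t) = dist_int t.
Proof.
suff le_dist u : dist_int (- u) <= dist_int u :> R.
  by apply/eqP; rewrite eq_le le_dist -{1}[t]opprK le_dist.
rewrite leNgt; apply/negP => /dist_int_ltP[m hm].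
suff : dist_int (- u) < dist_int (- u) by rewrite ltxx.
by apply/dist_int_ltP; exists (- m); rewrite intrN -opprD normrN.
Qed.

Lemma iter_rotation (alpha x : R) i : 0 <= x < 1 ->
  iter i (rotation alpha) x = fract (x + i%:R * alpha).
Proof.
move=> x01; elim: i => [|i ih]; first by rewrite mul0r addr0 fract_id.
rewrite iterS ih /rotation /fract.
set f := Num.floor (x + i%:R * alpha).
rewrite -[RHS]/(fract _) -[LHS]/(fract _).
rewrite -[in RHS](fractD _ (- f)) intrN; congr fract.
by rewrite -natr1; ring.
Qed.

Lemma indic_circle_ball (alpha a rho x : R) i : 0 <= x < 1 ->
  \1_(circle_ball a rho) (iter i (rotation alpha) x) =
  \1_(visit alpha a (i, rho)) x :> R.
Proof.
move=> x01; rewrite iter_rotation// !indicE; congr (_%:R); congr nat_of_bool.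
have E : circle_dist a (fract (x + i%:R * alpha)) = dist_int (x + i%:R * alpha - a).
  rewrite /circle_dist -/(dist_int _) -dist_intN opprB /fract.
  by rewrite addrAC -intrN dist_intD.
apply/idP/idP => /set_mem h; apply/mem_set.
  case: h => _; rewrite E => h; split; last exact: h.
  by rewrite /= in_itv.
case: h => _ /= h; split; last by rewrite E.
exact: fract_itv.
Qed.

Lemma radius_ge0 (r : nat -> R) :
  (forall i j : nat, (1 <= i)%N -> (i <= j)%N -> j%:R * r j <= i%:R * r i) ->
  (\sum_(1 <= i < N.+1) r i) @[N --> \oo] --> (+oo : set_system R) ->
  forall i, (1 <= i)%N -> 0 <= r i.
Proof.
move=> ir_le /cvgryPge div i i1; rewrite leNgt; apply/negP => ri.
have neg j : (i <= j)%N -> r j <= 0.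
  move=> ij; have j0 : 0 < j%:R :> R by rewrite ltr0n (leq_trans i1).
  have := ir_le i j i1 ij.
  have : i%:R * r i <= 0 by rewrite mulr_ge0_le0// ltW.
  by move=> h1 h2; rewrite -(ler_pM2l j0) mulr0; exact: le_trans h1.
have [N0 _ hN0] := div (\sum_(1 <= k < i) r k + 1).
have := hN0 (maxn N0 i) (leq_maxl _ _); rewrite /=.
have iN : (i <= (maxn N0 i).+1)%N by rewrite leqW// leq_maxr.
rewrite [leRHS](@big_cat_nat _ _ _ i)//= lerD2l => h.
have : \sum_(i <= k < (maxn N0 i).+1) r k <= 0.
  by rewrite big_nat sumr_le0// => k /andP[ik _]; exact: neg.
by lra.
Qed.

(** It suffices to know the law along the denominators, since the expected number
    of visits during one block is negligible before the total. *)
Theorem visits_strong_law (alpha : R) : calA alpha ->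
   forall r : nat -> R,
     (forall i j : nat, (1 <= i)%N -> (i <= j)%N -> j%:R * r j <= i%:R * r i) ->
     (\sum_(1 <= i < N.+1) r i) @[N --> \oo] --> (+oo : set_system R) ->
   forall a : R, 0 <= a < 1 ->
   {ae @lebesgue_measure R, forall x : R, 0 <= x < 1 ->
     (((\sum_(1 <= i < N.+1)
          \1_(circle_ball a (r i)) (iter i (rotation alpha) x))
       / (\sum_(1 <= i < N.+1) 2 * r i)) @[N --> \oo] --> (1 : R))}.
Proof.
move=> [alpha01 alphaI [a [alphaE a_lt a_tail a_sum]]] r ir_le div c _.
have r0 := radius_ge0 ir_le div.
have a_gt0 : forall i, (1 <= i)%N -> (1 <= a i)%N := alphaE.1.
have q_infty N : exists n, (N < cf_den a n)%N.
  exists (0 + 2 * N)%N; apply: leq_trans (cf_den_exp a_gt0 0 N).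
  by have -> : cf_den a 0 = 1%N by []; rewrite muln1 ltn_expl.
pose M N := \sum_(1 <= i < N) 2 * r i.
have Mhomo m n : (m <= n)%N -> M m <= M n.
  by move=> mn; apply: le_sum_widen => // i i1; rewrite mulr_ge0// r0.
have Mq_infty A : exists N, A <= Mq a r N.
  have /cvgryPge/(_ A)[N0 _ hN0] := div.
  have [n hn] := q_infty N0; exists n.
  have h := hN0 N0 (leqnn _); rewrite /= in h.
  apply: (le_trans h).
  apply: (@le_trans _ _ (M N0.+1)); last exact: Mhomo.
  by apply: ler_sum_nat => i /andP[i1 _]; have := r0 i i1; lra.
have lsm := lam_small a_lt; have lsu := lam_sum a_lt a_sum.
have sp := sparse_big_entries a_gt0 a_tail.
have FF := ae_filter_ringOfSetsType mu.
have eps01 k : 0 < ((k + 8)%:R^-1 : R) <= 8^-1.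
  by rewrite invr_gt0 ltr0n addn_gt0 orbT/= lef_pV2 ?posrE ?ltr0n ?addn_gt0 ?orbT// ler_nat leq_addl.
have law k := law_along_den c alpha01 alphaI alphaE r0 ir_le Mq_infty lsm lsu sp (eps01 k).
have {}law : {ae mu, forall x, forall k, 0 <= x < 1 -> \forall N \near \oo,
   (1 - 16 * (k + 8)%:R^-1) * Mq a r N <= Xq alpha c a r N x <= (1 + 16 * (k + 8)%:R^-1) * Mq a r N}.
  exact: ae_foralln.
apply: filterS law => x law x01.
pose X N := \sum_(1 <= i < N) (\1_(visit alpha c (i, r i)) x : R).
have XE N : \sum_(1 <= i < N.+1) \1_(circle_ball c (r i)) (iter i (rotation alpha) x) = X N.+1.
  by apply: eq_bigr => i _; exact: indic_circle_ball.
under eq_fun do rewrite XE.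
suff : X N / M N @[N --> \oo] --> (1 : R) by rewrite -cvg_shiftS.
have Xhomo m n : (m <= n)%N -> X m <= X n by move=> mn; exact: le_sum_widen.
have Mpos : \forall n \near \oo, 0 < M (cf_den a n).
  apply: filterS (Mq_large alphaE r0 Mq_infty 1) => n; exact: lt_le_trans.
apply/cvgrPdist_le => e e0.
have [k hk] : exists k, 19 * (k + 8)%:R^-1 <= e.
  exists (Num.trunc (19 / e)).+1.
  rewrite ler_pdivrMr ?ltr0n ?addn_gt0// -ler_pdivrMl// mulrC.
  apply/ltW/(lt_le_trans (truncnS_gt _)); by rewrite ler_nat leq_addr.
set eps := (k + 8)%:R^-1 in hk.
have Mjump : \forall n \near \oo, M (cf_den a n.+1) <= (1 + eps) * M (cf_den a n).
  have /andP[ep0 _] := eps01 k; rewrite -/eps in ep0.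
  have e6 : 0 < eps / 6 by rewrite divr_gt0.
  apply: filterS (filterI (lsm _ e6) (Mq_large alphaE r0 Mq_infty (2 * bweight a r 0))) => n [h1 h2].
  have h3 := sum_radius_block a_gt0 r0 ir_le n.
  have h4 := bweight_mul_le a_gt0 r0 ir_le n.
  have b0 := bweight_ge0 a_gt0 r0 n.
  rewrite mulrDl mul1r /M (@big_cat_nat _ _ _ (cf_den a n))/=; last 2 first.
  - exact: cf_den_gt0.
  - exact: cf_den_leS.
  rewrite lerD2l -/(Mq a r n).
  have := ler_wpM2l b0 h1.
  have : eps * (n%:R * bweight a r n) <= eps * (3 * Mq a r n) by rewrite ler_pM2l//; lra.
  by lra.
have := @interpolate_law R (cf_den a) q_infty X M eps Xhomo Mhomo (eps01 k) Mpos Mjump (law k x01).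
by apply: filterS => N hN; rewrite distrC (le_trans hN).
Qed.

End VisitTheorem.

(** * The digits of a random number *)

Section Digits.
Variable R : realType.

(** The Gauss map, whose iterates are the tails of the continued fraction. *)
Definition gauss (x : R) : R := fract x^-1.

Definition digit (n : nat) (x : R) : nat :=
  if n is m.+1 then Num.trunc (iter m gauss x)^-1 else 0%N.

Lemma cfracS (a : nat -> nat) k m :
  cfrac R a k m.+1 = ((a k)%:R + cfrac R a k.+1 m)^-1.
Proof. by []. Qed.

Definition unit_irr : set R := [set x | 0 < x < 1 /\ irrational x].

Lemma gaussE x : unit_irr x -> x^-1 = (Num.trunc x^-1)%:R + gauss x.
Proof.
move=> [/andP[x0 x1] _]; rewrite /gauss /fract.
have xi : 0 <= x^-1 by rewrite invr_ge0 ltW.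
rewrite (@floor_def _ _ (Posz (Num.trunc x^-1))); first by rewrite addrC subrK.
have := truncn_itv xi; rewrite -natr1 intrD.
by [].
Qed.

Lemma trunc_inv_gt0 x : unit_irr x -> (0 < Num.trunc x^-1)%N.
Proof.
move=> [/andP[x0 x1] _].
by rewrite truncn_gt0 invf_ge1// ltW.
Qed.

Lemma gauss_unit_irr x : unit_irr x -> unit_irr (gauss x).
Proof.
move=> ux; have [/andP[x0 x1] xi] := ux.
have gE : gauss x = x^-1 - (Num.trunc x^-1)%:R by have := gaussE ux; lra.
have gi : irrational (gauss x) by rewrite gE; exact: irrational_inv_sub.
split => //; have /andP[g0 ->] := fract_itv x^-1.
by rewrite andbT lt_neqAle g0 andbT eq_sym irrational_neq0.
Qed.

Lemma iter_gauss_unit_irr n x : unit_irr x -> unit_irr (iter n gauss x).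
Proof. by move=> ux; elim: n => //= n ih; exact: gauss_unit_irr. Qed.

Lemma digitS n x : digit n.+2 x = digit n.+1 (gauss x).
Proof. by rewrite /digit -iterSr. Qed.

Lemma digit_gt0 n x : unit_irr x -> (1 <= n)%N -> (1 <= digit n x)%N.
Proof. by case: n => // n ux _; apply: trunc_inv_gt0; exact: iter_gauss_unit_irr. Qed.

Lemma iter_gaussE n x : unit_irr x ->
  iter n gauss x = ((digit n.+1 x)%:R + iter n.+1 gauss x)^-1.
Proof.
by move=> ux; rewrite iterS -gaussE ?invrK//; exact: iter_gauss_unit_irr.
Qed.

(** Two steps of the expansion contract distances by a factor [2], because the
    product of two consecutive tails is at most [1/2]. *)
Lemma cfrac_digit_dist x n k : unit_irr x ->
  `|cfrac R (digit ^~ x) k.+1 n - iter k gauss x| <= (2^-1) ^+ n./2.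
Proof.
move=> ux.
have rec m j : cfrac R (digit ^~ x) j.+1 m.+1 - iter j gauss x =
    - (cfrac R (digit ^~ x) j.+2 m - iter j.+1 gauss x) *
    (cfrac R (digit ^~ x) j.+1 m.+1 * iter j gauss x).
  rewrite cfracS (iter_gaussE j ux).
  have c0 := cfrac_ge0 R (digit ^~ x) j.+2 m.
  have [/andP[y0 y1] _] := iter_gauss_unit_irr j.+1 ux.
  have d1 : 1 <= (digit j.+1 x)%:R :> R by rewrite ler1n digit_gt0.
  move: c0 y0 d1; move: (cfrac _ _ _ _) (iter _ _ _) (_%:R) => c y d c0 y0 d1.
  by field; apply/andP; split; rewrite gt_eqF//; lra.
have c1 m j : 0 <= cfrac R (digit ^~ x) j.+1 m <= 1.
  rewrite cfrac_ge0/=; case: m => [|m]; first exact: ler01.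
  rewrite cfracS.
  rewrite invf_le1 ?ltr_wpDr ?cfrac_ge0 ?ltr0n ?digit_gt0//.
  by rewrite -[leLHS]addr0 lerD ?cfrac_ge0// ler1n digit_gt0.
have y01 j : 0 < iter j gauss x < 1 by have [] := iter_gauss_unit_irr j ux.
have yy j : iter j gauss x * iter j.+1 gauss x <= 2^-1.
  have := iter_gaussE j ux => yE; have d1 : 1 <= (digit j.+1 x)%:R :> R by rewrite ler1n digit_gt0.
  have /andP[z0 z1] := y01 j.+1; rewrite yE.
  move: z0 z1 d1; move: (iter _ _ _) (_%:R) => z d z0 z1 d1.
  by rewrite mulrC ler_pdivrMr; lra.
elim/ltn_ind: n k => -[|[|n]] ih k.
- by rewrite expr0 /= add0r normrN gtr0_norm; have /andP[] := y01 k => // _ /ltW.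
- rewrite expr0 ler_norml; have /andP[] := c1 1%N k; have /andP[] := y01 k; lra.
rewrite rec rec [(n.+2)./2]/= exprS !(normrM, normrN).
have /andP[p0 p1] := c1 n.+2 k; have /andP[s0 s1] := c1 n.+1 k.+1.
have /andP[y0 y1] := y01 k; have /andP[z0 z1] := y01 k.+1.
rewrite (ger0_norm p0) (ger0_norm s0) (gtr0_norm y0) (gtr0_norm z0).
have h := ih n (ltnW (ltnSn _)) k.+2; have h2 := yy k.
set X := `|_ - _|; have X0 : 0 <= X by exact: normr_ge0.
rewrite mulrC; set P := cfrac _ _ _ _ in p0 p1 *; set S := cfrac _ _ _ _ in s0 s1 *.
set y := iter k _ _ in y0 y1 h2 *; set z := iter k.+1 _ _ in z0 z1 h2 *.
apply: (@le_trans _ _ (2^-1 * X)); last by rewrite ler_pM2l.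
rewrite [leLHS](_ : _ = (P * S) * (y * z) * X); last by ring.
apply: ler_wpM2r => //; rewrite -[leRHS]mul1r; apply: ler_pM => //.
- exact: mulr_ge0.
- by rewrite mulr_ge0// ltW.
- by rewrite -[leRHS]mul1r; exact: ler_pM.
Qed.

Lemma digit_expansion x : unit_irr x -> cf_expansion x (digit ^~ x).
Proof.
move=> ux; split; first by move=> i; exact: digit_gt0.
apply/cvgrPdist_le => e e0.
have [m hm] : exists m, (2^-1) ^+ m <= e.
  exists (Num.trunc e^-1).+1; set m := (Num.trunc e^-1).+1.
  have em : e^-1 <= 2 ^+ m.
    apply/ltW/(lt_le_trans (truncnS_gt _)).
    by rewrite -natrX ler_nat ltnW// ltn_expl.
  by rewrite exprVn -[leRHS]invrK lef_pV2 ?posrE ?invr_gt0 ?exprn_gt0.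
exists (2 * m)%N => // n /= mn; rewrite distrC.
apply: (le_trans (cfrac_digit_dist n 0 ux)); apply: le_trans hm.
apply: ler_wiXn2l => //; first by rewrite invf_le1// ler1n.
by rewrite -(doubleK m) half_leq// -mul2n.
Qed.

End Digits.

(** * Exponential moments of the digits *)

Arguments digit : simpl never.

Section Covering.
Variable R : realType.
Local Notation mu := (@lebesgue_measure R).

(** A stable substitute for the outer measure, inherited by subsets and countable
    unions. *)
Definition covered (A : set R) (C : R) :=
  exists H : set R, [/\ measurable H, A `<=` H & (mu H <= C%:E)%E].

Lemma covered_sub (A B : set R) C : A `<=` B -> covered B C -> covered A C.
Proof. by move=> AB [H [mH BH HC]]; exists H; split => //; exact: subset_trans BH. Qed.

Lemma covered_le (A : set R) C C' : C <= C' -> covered A C -> covered A C'.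
Proof.
move=> CC [H [mH BH HC]]; exists H; split => //.
by apply: le_trans HC _; rewrite lee_fin.
Qed.

Lemma covered_bigcup (A : nat -> set R) (f : nat -> R) (C : R) :
  (forall k, covered (A k) (f k)) -> (forall m, \sum_(0 <= k < m) f k <= C) ->
  covered (\bigcup_k A k) C.
Proof.
move=> cA fC; pose H k := projT1 (cid (cA k)).
have HP k : [/\ measurable (H k), A k `<=` H k & (mu (H k) <= (f k)%:E)%E].
  by rewrite /H; case: cid.
have mU : measurable (\bigcup_k H k).
  by apply: bigcup_measurable => k _; have [] := HP k.
exists (\bigcup_k H k); split => //.
  by move=> x [k _ Ax]; exists k => //; have [_ + _] := HP k; exact.
have mH k : measurable (H k) by have [] := HP k.
have sub : \bigcup_k H k `<=` \bigcup_k H k by [].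
have h1 := @measure_sigma_subadditive _ _ _ mu _ H mH mU sub. apply: (le_trans h1).
apply: lime_le; first by apply: is_cvg_nneseries => n _ _; exact: measure_ge0.
apply: nearW => m; apply: le_trans (_ : (\sum_(0 <= k < m) (f k)%:E <= _)%E).
  by apply: lee_sum => k _; have [] := HP k.
by rewrite sumEFin lee_fin.
Qed.

(** Covers of an increasing sequence of sets can be replaced by increasing
    covers, so a uniform bound passes to the union. *)
Lemma covered_nondecreasing_bigcup (A : nat -> set R) (C : R) :
  (forall m n, (m <= n)%N -> A m `<=` A n) -> (forall k, covered (A k) C) ->
  covered (\bigcup_k A k) C.
Proof.
move=> Amono cA; pose H k := projT1 (cid (cA k)).
have HP k : [/\ measurable (H k), A k `<=` H k & (mu (H k) <= C%:E)%E].
  by rewrite /H; case: cid.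
pose K n := \bigcap_(k >= n) H k.
have mK n : measurable (K n).
  by apply: bigcap_measurable => [|k _]; [exists n => /=|have [] := HP k].
have mU : measurable (\bigcup_n K n) by apply: bigcup_measurable.
exists (\bigcup_n K n); split => //.
  move=> x [n _ Ax]; exists n => // k /= nk; have [_ + _] := HP k; apply.
  exact: Amono nk _ Ax.
have := @nondecreasing_cvg_mu _ _ R mu K mK mU.
have Kmono : nondecreasing_seq K.
  move=> m n mn; apply/subsetPset => x Kx k /= nk; apply: Kx => /=.
  exact: leq_trans nk.
move=> /(_ Kmono) /cvg_lim <- //; apply: lime_le.
  by apply/cvg_ex; eexists; exact: (@nondecreasing_cvg_mu _ _ R mu K mK mU Kmono).
apply: nearW => n; have [mH _ hH] := HP n; apply: le_trans hH.
have KH : K n `<=` H n by move=> x Kx; exact: (Kx n (leqnn n)).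
by apply: le_measure; rewrite ?inE; [exact: mK|exact: mH|exact: KH].
Qed.

Lemma negligible_covered (A : set R) (f : nat -> R) :
  (forall n, covered A (f n)) -> (forall e, 0 < e -> exists n, f n <= e) ->
  mu.-negligible A.
Proof.
move=> cA fe; pose H k := projT1 (cid (cA k)).
have HP k : [/\ measurable (H k), A `<=` H k & (mu (H k) <= (f k)%:E)%E].
  by rewrite /H; case: cid.
have mI : measurable (\bigcap_k H k).
  by apply: bigcapT_measurable => k; have [] := HP k.
exists (\bigcap_k H k); split => //; last first.
  by move=> x Ax k _; have [_ + _] := HP k; exact.
apply/eqP; rewrite eq_le measure_ge0 andbT; apply/lee_addgt0Pr => e e0.
have [n fn] := fe e e0; have [mH _ hH] := HP n.
rewrite add0e; apply: le_trans (_ : (mu (H n) <= _)%E); last first.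
  by apply: le_trans hH _; rewrite lee_fin.
have IH : \bigcap_k H k `<=` H n by move=> x Ix; exact: (Ix n I).
by apply: le_measure; rewrite ?inE; [exact: mI|exact: mH|exact: IH].
Qed.

(** The relative length, inside a cylinder with [q'/q = s] for its last two
    denominators, of the subcylinder where the next digit is [k]. *)
Definition digit_prob (s : R) (k : nat) : R := (1 + s) / ((k%:R + s) * (k%:R + s + 1)).

Lemma digit_prob_ge0 s k : 0 <= s -> 0 <= digit_prob s k.
Proof. by move=> s0; rewrite divr_ge0// ?mulr_ge0// ?addr_ge0. Qed.

Lemma sum_digit_prob s m M : 0 <= s -> (1 <= m)%N -> (m <= M)%N ->
  \sum_(m <= k < M) digit_prob s k = (1 + s) * ((m%:R + s)^-1 - (M%:R + s)^-1).
Proof.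
move=> s0 m1; elim: M => [|M ih]; first by rewrite leqn0 => /eqP m0; rewrite m0 in m1.
rewrite leq_eqVlt => /orP[/eqP <-|]; first by rewrite big_geq// subrr mulr0.
rewrite ltnS => mM; rewrite big_nat_recr//= ih// /digit_prob -natr1.
have M1 : 1 <= M%:R :> R by rewrite ler1n (leq_trans m1).
have m1' : 1 <= m%:R :> R by rewrite ler1n.
by field; rewrite !gt_eqF//; lra.
Qed.

Lemma sum_digit_prob_le s m M : 0 <= s <= 1 -> (1 <= m)%N ->
  \sum_(m <= k < M) digit_prob s k <= 2 / m%:R.
Proof.
move=> /andP[s0 s1] m1; have m1' : 1 <= m%:R :> R by rewrite ler1n.
have [Mm|mM] := leqP M m; first by rewrite big_geq// divr_ge0.
rewrite sum_digit_prob// ?(ltnW mM)//.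
have M0 : 0 <= (M%:R + s)^-1 by rewrite invr_ge0 addr_ge0.
apply: (@le_trans _ _ ((1 + s) / (m%:R + s))).
  by rewrite ler_wpM2l ?addr_ge0// lerBlDr lerDl.
by rewrite ler_pdivrMr ?ltr_wpDr//; [rewrite mulrAC ler_pdivlMr; nra|lra].
Qed.

Lemma sum_digit_prob1 s M : 0 <= s -> \sum_(1 <= k < M) digit_prob s k <= 1.
Proof.
move=> s0; have [M1|M1] := leqP M 1; first by rewrite big_geq// ler01.
rewrite sum_digit_prob// ?(ltnW M1)//.
have M0 : 0 <= (M%:R + s)^-1 by rewrite invr_ge0 addr_ge0.
rewrite mulrBr mulfV ?gt_eqF ?ltr_wpDr// gerBl mulr_ge0// addr_ge0//.
Qed.

Lemma digit_prob_le s k : 0 <= s <= 1 -> (1 <= k)%N -> digit_prob s k <= 2 / k%:R ^+ 2.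
Proof.
move=> /andP[s0 s1] k1; have k1' : 1 <= k%:R :> R by rewrite ler1n.
rewrite /digit_prob ler_pdivrMr; last by rewrite mulr_gt0//; lra.
rewrite mulrAC ler_pdivlMr ?exprn_gt0//; last by lra.
have h : k%:R ^+ 2 <= (k%:R + s) * (k%:R + s + 1) :> R by rewrite expr2; nra.
by apply: ler_pM => //; first [lra|rewrite exprn_ge0//; lra].
Qed.

Definition digit_sum (h : nat -> nat -> R) N (x : R) : R :=
  \sum_(1 <= i < N.+1) h i (digit i x).

Lemma digit_sumS h N x : digit_sum h N.+1 x =
  h 1%N (digit 1 x) + digit_sum (fun i => h i.+1) N (gauss x).
Proof.
rewrite /digit_sum big_ltn// big_add1 [N.+2.-1]/=; congr (_ + _).
by apply: eq_big_nat => -[//|i] _; rewrite digitS.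
Qed.

Definition mobius (p p' q q' t : R) : R := (p + p' * t) / (q + q' * t).

Lemma mobius_inv (p p' q q' t : R) k : 0 < q -> 0 <= q' -> 0 < t -> (1 <= k)%N ->
  mobius p p' q q' (k%:R + t)^-1 = mobius (p * k%:R + p') p (q * k%:R + q') q t.
Proof.
move=> q0 q'0 t0 k1; have k1' : 1 <= k%:R :> R by rewrite ler1n.
have kt : 0 < k%:R + t by lra.
rewrite /mobius.
have d1 : 0 < q * (k%:R + t) + q' by rewrite ltr_wpDr// mulr_gt0.
by field; rewrite !gt_eqF//=; lra.
Qed.

Lemma covered_mobius (p p' q q' : R) : 0 < q -> 0 <= q' -> `|p * q' - p' * q| = 1 ->
  covered [set mobius p p' q q' t | t in @unit_irr R] (q * (q + q'))^-1.
Proof.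
move=> q0 q'0 det.
have qq : 0 < q + q' by lra.
have len0 : 0 < (q * (q + q'))^-1 by rewrite invr_gt0 mulr_gt0.
have mE t : 0 < t < 1 -> exists2 u, 0 <= u <= (q * (q + q'))^-1 &
    mobius p p' q q' t = p / q - (p * q' - p' * q) * u.
  move=> /andP[t0 t1]; have d0 : 0 < q + q' * t by rewrite ltr_wpDr// mulr_ge0// ltW.
  exists (t / (q * (q + q' * t))); last first.
    by rewrite /mobius; field; rewrite !gt_eqF.
  have D0 : 0 < q * (q + q' * t) by exact: mulr_gt0.
  apply/andP; split; first by rewrite divr_ge0// ltW.
  rewrite ler_pdivrMr// mulrC ler_pdivlMr; last exact: mulr_gt0.
  have : t * (q * q) <= q * q by rewrite ger_pMl ?mulr_gt0// ltW.
  by lra.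
move: det; case: (lerP 0 (p * q' - p' * q)) => det0 det.
  rewrite ger0_norm// in det.
  exists `[p / q - (q * (q + q'))^-1, p / q]%classic; split => //.
    move=> _ [t [t01 _] <-]; have [u u01 ->] := mE t t01.
    by rewrite det mul1r /= in_itv/=; lra.
  rewrite lebesgue_measure_itv/= lte_fin; case: ifP => _; last by rewrite lee_fin ltW.
  by rewrite -EFinB lee_fin; lra.
rewrite ltr0_norm// in det.
exists `[p / q, p / q + (q * (q + q'))^-1]%classic; split => //.
  move=> _ [t [t01 _] <-]; have [u u01 ->] := mE t t01.
  have -> : p * q' - p' * q = -1 by lra.
  by rewrite /= in_itv/=; lra.
rewrite lebesgue_measure_itv/= lte_fin; case: ifP => _; last by rewrite lee_fin ltW.
by rewrite -EFinB lee_fin; lra.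
Qed.

(** Chernoff's bound for sums of functions of the digits, conditionally on any
    initial block of digits: the conditioning is the Moebius map, and the next
    digit has conditional law [digit_prob (q' / q)]. *)
Lemma covered_digit_sum N (h : nat -> nat -> R) (kappa : nat -> R) (c p p' q q' : R) :
  (forall i s m, (1 <= i)%N -> 0 <= s <= 1 ->
     \sum_(1 <= k < m) digit_prob s k * expR (h i k) <= kappa i) ->
  0 < q -> 0 <= q' <= q -> `|p * q' - p' * q| = 1 ->
  covered [set mobius p p' q q' t | t in [set t | unit_irr t /\ c <= digit_sum h N t]]
    ((q * (q + q'))^-1 * expR (- c) * \prod_(1 <= i < N.+1) kappa i).
Proof.
elim: N h kappa c p p' q q' => [|N ih] h kappa c p p' q q' hk q0 /andP[q'0 q'q] det.
  have qq : 0 < q + q' by lra.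
  rewrite big_geq// mulr1.
  have [c0|c0] := lerP c 0.
    apply: covered_sub (covered_le _ (covered_mobius q0 q'0 det)).
      by move=> _ [t [ut _] <-]; exists t.
    have e1 : 1 <= expR (- c) by rewrite -[leLHS]expR0 ler_expR oppr_ge0.
    by apply: ler_peMr => //; rewrite invr_ge0 mulr_ge0// ltW.
  exists set0; split => //; last by rewrite measure0 lee_fin !mulr_ge0 ?invr_ge0 ?mulr_ge0 ?expR_ge0 ?ltW.
  by move=> x [t [_ ht] _]; move: ht; rewrite /digit_sum big_geq// leNgt c0.
pose s := q' / q.
have s01 : 0 <= s <= 1.
  by apply/andP; split; [rewrite divr_ge0// ltW|rewrite /s ler_pdivrMr// mul1r].
have k0 i : (1 <= i)%N -> 0 <= kappa i by move=> i1; have := hk i s 1%N i1 s01; rewrite big_geq.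
set P := \prod_(2 <= i < N.+2) kappa i.
have P0 : 0 <= P.
  by rewrite /P big_nat; apply: prodr_ge0 => i /andP[i1 _]; apply: k0; exact: ltnW.
pose h' i := h i.+1; pose kap' i := kappa i.+1.
have PE : \prod_(1 <= i < N.+1) kap' i = P by rewrite /P [RHS]big_add1.
pose A k := [set mobius (p * k.+1%:R + p') p (q * k.+1%:R + q') q t
  | t in [set t | unit_irr t /\ c - h 1%N k.+1 <= digit_sum h' N t]].
pose f k := (q * (q + q'))^-1 * expR (- c) * P * (digit_prob s k.+1 * expR (h 1%N k.+1)).
have cA k : covered (A k) (f k).
  have k1 : 1 <= k.+1%:R :> R by rewrite ler1n.
  have qk : q <= q * k.+1%:R by rewrite ler_peMr// ltW.
  apply: covered_le (ih h' kap' _ _ _ _ _ _ _ _ _); last 4 first.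
  - by move=> i s' m i1 hs; apply: hk.
  - lra.
  - lra.
  - by rewrite -det -normrN; congr `|_|; ring.
  have lenE : ((q * k.+1%:R + q') * (q * k.+1%:R + q' + q))^-1 =
      (q * (q + q'))^-1 * digit_prob s k.+1.
    rewrite /digit_prob /s; field; rewrite !gt_eqF//; lra.
  by rewrite PE /f lenE opprB addrC expRD le_eqVlt; apply/orP; left; apply/eqP; ring.
apply: covered_sub (covered_bigcup cA _).
  move=> _ [t [ut ht] <-]; exists (Num.trunc t^-1).-1 => //.
  have t1 := trunc_inv_gt0 ut.
  exists (gauss t); last first.
    rewrite prednK// -mobius_inv//; last by have [/andP[]] := gauss_unit_irr ut.
    by rewrite -gaussE// invrK.
  split; first exact: gauss_unit_irr.
  by move: ht; rewrite digit_sumS prednK// /h'/= lerBlDl.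
move=> m; rewrite /f -mulr_sumr big_ltn//.
rewrite -/P [kappa 1%N * P]mulrC mulrA ler_wpM2l//.
  have l0 : 0 <= (q * (q + q'))^-1 by rewrite invr_ge0; apply: mulr_ge0; lra.
  by rewrite mulr_ge0// mulr_ge0// expR_ge0.
have := hk 1%N s m.+1 isT s01; by rewrite big_add1.
Qed.

End Covering.

(** * The three conditions hold almost everywhere *)

Section AlmostEverywhere.
Variable R : realType.
Local Notation mu := (@lebesgue_measure R).

Lemma covered_chernoff N (h : nat -> nat -> R) (kappa : nat -> R) (c : R) :
  (forall i s m, (1 <= i)%N -> 0 <= s <= 1 ->
     \sum_(1 <= k < m) digit_prob s k * expR (h i k) <= kappa i) ->
  covered [set t : R | unit_irr t /\ c <= digit_sum h N t]
    (expR (- c) * \prod_(1 <= i < N.+1) kappa i).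
Proof.
move=> hk; have h0 : 0 <= (0 : R) <= 1 by rewrite lexx ler01.
have det : `|0 * 0 - 1 * 1| = 1 :> R by rewrite mul0r mul1r sub0r normrN normr1.
have := covered_digit_sum N c hk (@ltr01 R) h0 det.
rewrite addr0 mulr1 invr1 mul1r; apply: covered_sub => t ht; exists t => //.
by rewrite /mobius mul0r mul1r add0r addr0 divr1.
Qed.

(** The integer part [M] of [y], or [1], satisfies [y < 2 * M], and the next digit
    is at least [M] with conditional probability at most [2 / M]. *)
Lemma sum_digit_prob_step (w y s : R) m : 0 <= w -> 0 < y -> 0 <= s <= 1 ->
  \sum_(1 <= k < m) digit_prob s k * expR (if y <= k%:R then w else 0)
    <= 1 + (expR w - 1) * (4 / y).
Proof.
move=> w0 y0 s01; have /andP[s0 s1] := s01.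
pose M := maxn 1 (Num.trunc y).
have M1 : (1 <= M)%N by exact: leq_maxl.
have yM : y < 2 * M%:R.
  apply: (lt_le_trans (truncnS_gt y)); rewrite -natrM ler_nat /M.
  by move: (Num.trunc y) => t; lia.
have ew : 0 <= expR w - 1 by rewrite subr_ge0 -[leLHS]expR0 ler_expR.
have tail : \sum_(1 <= k < m | (M <= k)%N) digit_prob s k <= 4 / y.
  apply: (@le_trans _ _ (\sum_(M <= k < m) digit_prob s k)).
    have [mM|Mm] := leqP m M.
      rewrite big_nat_cond big1 ?big_geq//.
      by move=> k /andP[/andP[_ km]]; rewrite leqNgt (leq_trans km mM).
    rewrite (@big_cat_nat _ _ _ M)//= ?(ltnW Mm)// big_nat_cond big1 ?add0r; last first.
      by move=> k /andP[/andP[_ km]]; rewrite leqNgt km.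
    by rewrite big_mkcond/=; apply: ler_sum => k _; case: ifP => // _; exact: digit_prob_ge0.
  apply: (le_trans (sum_digit_prob_le m s01 M1)).
  by rewrite ler_pdivrMr ?ltr0n// mulrAC ler_pdivlMr//; lra.
apply: (@le_trans _ _ (\sum_(1 <= k < m) digit_prob s k +
    (expR w - 1) * \sum_(1 <= k < m | (M <= k)%N) digit_prob s k)).
  rewrite mulr_sumr [X in _ + X]big_mkcond/= -big_split/=; apply: ler_sum_nat => k /andP[k1 _].
  have d0 := digit_prob_ge0 k s0.
  have X0 : 0 <= (expR w - 1) * digit_prob s k by exact: mulr_ge0.
  case: ifPn => yk; last by rewrite expR0; case: ifP => _; lra.
  have -> : (M <= k)%N.
    rewrite geq_max k1/=; have := truncn_itv (ltW y0) => /andP[h _].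
    by rewrite -(ler_nat R) (le_trans h).
  by lra.
by apply: lerD; [exact: sum_digit_prob1|exact: ler_wpM2l].
Qed.

Lemma ae_covered (A : nat -> set R) (f : nat -> R) C :
  (forall k, covered (A k) (f k)) -> (forall m, \sum_(0 <= k < m) f k <= C) ->
  {ae mu, forall x, \forall k \near \oo, ~ A k x}.
Proof.
move=> cA fC; pose H k := projT1 (cid (cA k)).
have HP k : [/\ measurable (H k), A k `<=` H k & (mu (H k) <= (f k)%:E)%E].
  by rewrite /H; case: cid.
have FF := ae_filter_ringOfSetsType mu.
have bc : {ae mu, forall x, \forall k \near \oo, ~ H k x}.
  by apply: (@borel_cantelli_bound _ _ R mu H f C) => // k; have [] := HP k.
apply: filterS bc => x; apply: filterS => k nH Ax; apply: nH.
by have [_ + _] := HP k; exact.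
Qed.

(** The digit of index [n] is at least [y = n `^ (4 / 3)] with probability
    [O(1 / y)], which is summable. *)
Lemma ae_digit_lt : {ae mu, forall x : R, unit_irr x ->
  \forall n \near \oo, (digit n x)%:R < n%:R `^ (4 / 3) :> R}.
Proof.
have FF := ae_filter_ringOfSetsType mu.
pose A n := [set x : R | unit_irr x /\ (n.+1%:R : R) `^ (4 / 3) <= (digit n.+1 x)%:R].
pose f n : R := 5 * n.+1%:R `^ (- (1 + 3^-1)).
have cA n : covered (A n) (f n).
  set y : R := n.+1%:R `^ (4 / 3).
  have y1 : 1 <= y by rewrite -[leLHS](powRr0 n.+1%:R) ler_powR ?ler1n// divr_ge0.
  have y0 : 0 < y by lra.
  (* With weight and threshold [ln y], Chernoff's bound is [O(1 / y)]. *)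
  have w0 : 0 <= ln y by exact: ln_ge0.
  pose h i k : R := if i == n.+1 then (if y <= k%:R then ln y else 0) else 0.
  pose kappa i : R := if i == n.+1 then 1 + (expR (ln y) - 1) * (4 / y) else 1.
  have hk i s m : (1 <= i)%N -> 0 <= s <= 1 ->
      \sum_(1 <= k < m) digit_prob s k * expR (h i k) <= kappa i.
    move=> i1 s01; rewrite /h /kappa; case: eqP => _; first exact: sum_digit_prob_step.
    under eq_bigr do rewrite expR0 mulr1.
    by apply: sum_digit_prob1; case/andP: s01.
  apply: covered_sub (covered_le _ (covered_chernoff n.+1 (ln y) hk)).
    move=> x [ux hx]; split => //; rewrite /digit_sum big_nat_recr//= /h eqxx hx.
    rewrite big_nat big1 ?add0r// => i /andP[_ iN].
    by rewrite ltn_eqF.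
  rewrite big_nat_recr//= big_nat big1; last first.
    by move=> i /andP[_ iN]; rewrite /kappa ltn_eqF.
  rewrite mul1r /kappa eqxx expRN lnK ?posrE//.
  have -> : f n = 5 / y.
    by rewrite /f /y -powRN; congr (_ * _ `^ _); field.
  rewrite mulrC ler_pM2r ?invr_gt0//.
  have : (y - 1) * (4 / y) <= 4 by rewrite mulrA ler_pdivrMr//; lra.
  by lra.
have fC m : \sum_(0 <= k < m) f k <= 5 * (1 + 3).
  rewrite /f -mulr_sumr ler_pM2l//.
  have := @pseries_le R 3^-1 m.+1; rewrite invrK invr_gt0 => /(_ (ltr0n _ _)).
  by rewrite big_add1.
apply: filterS (ae_covered cA fC) => x [N _ hN] ux.
exists N.+1 => // -[//|n] /= Nn.
by rewrite ltNge; apply/negP => h; apply: (hN n Nn).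
Qed.

Lemma prod_le_expR (g : nat -> R) m n : (forall i, 0 <= g i) ->
  \prod_(m <= i < n) (1 + g i) <= expR (\sum_(m <= i < n) g i).
Proof.
move=> g0; rewrite expR_sum; apply: ler_prod => i _.
by rewrite addr_ge0//= expR_ge1Dx.
Qed.

Definition digit_weight (i : nat) : R := ln i%:R / i%:R `^ (2 / 3).

Lemma digit_weight_ge0 i : 0 <= digit_weight i.
Proof.
case: i => [|i]; first by rewrite /digit_weight ln0// mul0r.
by rewrite divr_ge0 ?powR_ge0// ln_ge0// ler1n.
Qed.

Lemma sum_digit_weight_bound : exists Q : R, forall N,
  \sum_(1 <= i < N) (expR (digit_weight i) - 1) * (4 / i%:R `^ (1 / 2)) <= Q.
Proof.
pose E : R := expR (3 / 2).
have E0 : 0 < E by exact: expR_gt0.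
exists (48 * E * (1 + 12)) => N.
have q0 : 0 < 12^-1 :> R by rewrite invr_gt0.
have := pseries_le N q0; rewrite invrK => ps.
apply: le_trans (ler_wpM2l _ ps); last by rewrite mulr_ge0// ltW.
rewrite mulr_sumr; apply: ler_sum_nat => i /andP[i1 _].
have i0 : 0 < i%:R :> R by rewrite ltr0n.
have w0 := digit_weight_ge0 i.
have wE : expR (digit_weight i) - 1 <= digit_weight i * E.
  have w32 : digit_weight i <= 3 / 2.
    rewrite /digit_weight ler_pdivrMr ?powR_gt0//.
    have h : 0 < 2 / 3 :> R by rewrite divr_gt0.
    by have := ln_le_powR h i0; rewrite invf_div.
  have h1 : 1 + - digit_weight i <= expR (- digit_weight i) by exact: expR_ge1Dx.
  have h2 : expR (digit_weight i) <= E by rewrite ler_expR.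
  have h3 : expR (digit_weight i) * expR (- digit_weight i) = 1 by rewrite -expRD subrr expR0.
  have h4 := ler_wpM2l (expR_ge0 (digit_weight i)) h1; rewrite h3 in h4.
  have h5 := ler_wpM2l w0 h2; lra.
have l12 := ln_le_powR q0 i0; rewrite invrK in l12.
have p0 : 0 <= 4 / i%:R `^ (1 / 2) :> R by rewrite divr_ge0 ?powR_ge0.
apply: (le_trans (ler_wpM2r p0 wE)).
have pk s u : i%:R `^ (s + u) = i%:R `^ s * i%:R `^ u :> R.
  by rewrite powRD// (gt_eqF i0) implybT.
have -> : i%:R `^ (- (1 + 12^-1)) = i%:R `^ (12^-1) * (i%:R `^ (2 / 3))^-1 * (i%:R `^ (1 / 2))^-1 :> R.
  by rewrite -!powRN -!pk; congr (_ `^ _); field.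
rewrite /digit_weight.
set P := (_ `^ (2 / 3))^-1; set Q := (_ `^ (1 / 2))^-1.
have P0 : 0 <= P by rewrite invr_ge0 powR_ge0.
have Q0 : 0 <= Q by rewrite invr_ge0 powR_ge0.
have c0 : 0 <= 4 * E * P * Q by rewrite !mulr_ge0// ltW.
by have := ler_wpM2l c0 l12; lra.
Qed.

(** The exponential moments of the partial sums are bounded uniformly in their
    length, so the probability that the whole sum exceeds [c] is [O(expR (- c))]. *)
Lemma ae_digit_weight : {ae mu, forall x : R, unit_irr x -> exists c : R, forall N,
  digit_sum (fun i k => if i%:R `^ (1 / 2) <= (k%:R : R) then digit_weight i else 0) N x < c}.
Proof.
pose h (i k : nat) : R := if i%:R `^ (1 / 2) <= (k%:R : R) then digit_weight i else 0.
rewrite -/h.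
have [Q hQ] := sum_digit_weight_bound.
have hk i s m : (1 <= i)%N -> 0 <= s <= 1 ->
    \sum_(1 <= k < m) digit_prob s k * expR (h i k) <=
    1 + (expR (digit_weight i) - 1) * (4 / i%:R `^ (1 / 2)).
  move=> i1 s01; apply: sum_digit_prob_step => //; first exact: digit_weight_ge0.
  by rewrite powR_gt0// ltr0n.
have cN c N : covered [set t : R | unit_irr t /\ c <= digit_sum h N t] (expR (- c) * expR Q).
  apply: covered_le (covered_chernoff N c hk); rewrite ler_pM2l ?expR_gt0//.
  apply: (@le_trans _ _ (expR (\sum_(1 <= i < N.+1) (expR (digit_weight i) - 1) * (4 / i%:R `^ (1 / 2))))).
    apply: prod_le_expR => i; rewrite mulr_ge0 ?divr_ge0 ?powR_ge0// subr_ge0.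
    by rewrite -[leLHS]expR0 ler_expR digit_weight_ge0.
  by rewrite ler_expR.
have h0 i k : 0 <= h i k by rewrite /h; case: ifP => // _; exact: digit_weight_ge0.
have cU c : covered [set t : R | unit_irr t /\ exists N, c <= digit_sum h N t] (expR (- c) * expR Q).
  apply: covered_sub (covered_nondecreasing_bigcup _ (cN c)).
    by move=> t [ut [N hN]]; exists N.
  move=> m n mn t [ut ht]; split => //; apply: (le_trans ht).
  by apply: le_sum_widen => // i _.
have neg : mu.-negligible [set t : R | unit_irr t /\ forall c, exists N, c <= digit_sum h N t].
  apply: (@negligible_covered _ _ (fun n => expR (- n%:R) * expR Q)).
    by move=> n; apply: covered_sub (cU n%:R) => t [ut ht].
  move=> e e0; exists (Num.trunc (expR Q / e)).+1.
  set n := (Num.trunc _).+1.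
  have h1 : expR Q / e < n%:R by exact: truncnS_gt.
  have h2 : n%:R <= expR n%:R :> R by apply: le_trans (expR_ge1Dx _); rewrite lerDr.
  rewrite expRN mulrC ler_pdivrMr ?expR_gt0// mulrC -ler_pdivrMr//.
  exact: le_trans (ltW h1) h2.
apply: negligibleS neg => x /= nx; apply: contrapT => n2; apply: nx => ux.
apply: contrapT => nc; apply: n2; split => // c; apply: contrapT => nN.
by apply: nc; exists c => N; rewrite ltNge; apply/negP => hc; apply: nN; exists N.
Qed.

(** Chernoff's bound with the exponent [1/2], for which the moment of a digit is
    the expectation of its square root: this is finite, and restricting it to
    digits above [C] makes it as small as desired. *)
Lemma ae_digit_tail (eps : R) : 0 < eps -> exists C : nat, (1 <= C)%N /\
  {ae mu, forall x : R, unit_irr x -> \forall N \near \oo,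
    digit_sum (fun i k => if (C <= k)%N then 2^-1 * ln (k%:R : R) else 0) N x < eps * N%:R}.
Proof.
move=> e0.
(* The tail of the moment is bounded by [4 * d `^ (- 1/2)], which has to be at
   most [eps / 2]. *)
pose d := (Num.trunc ((8 / eps) ^+ 2)).+1.
have d0 : 0 < d%:R :> R by rewrite ltr0n.
have dE : 4 * d%:R `^ (- 2^-1) <= eps / 2.
  have h1 : (8 / eps) ^+ 2 <= d%:R by exact/ltW/truncnS_gt.
  have h2 : 8 / eps <= d%:R `^ (2^-1).
    have e80 : 0 <= 8 / eps by rewrite divr_ge0// ltW.
    by rewrite powR12_sqrt// -[leLHS](ger0_norm e80) -sqrtr_sqr ler_wsqrtr.
  rewrite powRN ler_pdivrMr ?powR_gt0//.
  have := ler_wpM2l (ltW e0) h2; rewrite mulrCA divff ?gt_eqF//; lra.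
exists d.+1; split=> //.
pose h (i k : nat) : R := if (d.+1 <= k)%N then 2^-1 * ln (k%:R : R) else 0.
rewrite -/h.
have hk i s m : (1 <= i)%N -> 0 <= s <= 1 ->
    \sum_(1 <= k < m) digit_prob s k * expR (h i k) <= 1 + eps / 2.
  move=> i1 s01; have /andP[s0 s1] := s01.
  apply: (@le_trans _ _ (\sum_(1 <= k < m) digit_prob s k +
     \sum_(1 <= k < m | (d.+1 <= k)%N) 2 * k%:R `^ (- (1 + 2^-1)))).
    rewrite [X in _ + X]big_mkcond/= -big_split/=; apply: ler_sum_nat => k /andP[k1 _].
    have d1 := digit_prob_ge0 k s0.
    have k0 : 0 < k%:R :> R by rewrite ltr0n.
    rewrite /h; case: ifP => _; last by rewrite expR0; lra.
    rewrite -ln_powR lnK ?posrE ?powR_gt0//.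
    have := ler_wpM2r (powR_ge0 k%:R 2^-1) (digit_prob_le s01 k1).
    have -> : 2 / k%:R ^+ 2 * k%:R `^ 2^-1 = 2 * k%:R `^ (- (1 + 2^-1)) :> R.
      rewrite -mulrA -powR_mulrn ?ltW// -powRN -powRD; last by rewrite (gt_eqF k0) implybT.
      by congr (_ * _ `^ _); field.
    by lra.
  apply: lerD; first exact: sum_digit_prob1.
  apply: le_trans dE.
  have q0 : 0 < 2^-1 :> R by rewrite invr_gt0.
  have tele M : \sum_(d.+1 <= k < d.+1 + M) 2 * k%:R `^ (- (1 + 2^-1)) <=
      4 * (d%:R `^ (- 2^-1) - (d + M)%:R `^ (- 2^-1)) :> R.
    elim: M => [|M ih]; first by rewrite addn0 big_geq// addn0 subrr mulr0.
    rewrite addnS big_nat_recr ?leq_addr//=.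
    have := @powRN_step R 2^-1 (d + M) q0 (isT).
    by rewrite addnS; lra.
  apply: (@le_trans _ _ (\sum_(d.+1 <= k < d.+1 + m) 2 * k%:R `^ (- (1 + 2^-1)))).
    apply: (@le_trans _ _ (\sum_(1 <= k < d.+1 + m | (d.+1 <= k)%N) 2 * k%:R `^ (- (1 + 2^-1)))).
      rewrite big_mkcond/= [leRHS]big_mkcond/=; apply: le_sum_widen; last exact: leq_addl.
      by move=> k _; case: ifP => // _; rewrite mulr_ge0// powR_ge0.
    rewrite (@big_cat_nat _ _ _ d.+1)//= ?leq_addr// big_nat_cond big1 ?add0r; last first.
      by move=> k /andP[/andP[_ km]]; rewrite leqNgt km.
    rewrite big_mkcond/= big_nat [leRHS]big_nat; apply: ler_sum => k /andP[dk _].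
    by rewrite dk.
  apply: (le_trans (tele m)).
  by have := powR_ge0 (d + m)%:R (- 2^-1 : R); lra.
pose A N := [set t : R | unit_irr t /\ eps * N%:R <= digit_sum h N t].
pose rr := expR (- (eps / 2)).
have r1 : rr < 1 by rewrite -[ltRHS]expR0 ltr_expR oppr_lt0 divr_gt0.
have r0 : 0 < rr by exact: expR_gt0.
have cA N : covered (A N) (rr ^+ N).
  apply: covered_le (covered_chernoff N (eps * N%:R) hk).
  rewrite prodr_const_nat subSS subn0.
  apply: (@le_trans _ _ (expR (- (eps * N%:R)) * expR (eps / 2) ^+ N)).
    rewrite ler_pM2l ?expR_gt0// lerXn2r ?nnegrE ?expR_ge0//; last exact: expR_ge1Dx.
    by rewrite addr_ge0// divr_ge0// ltW.
  rewrite /rr -!expRM_natl -expRD ler_expR; lra.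
have fC m : \sum_(0 <= k < m) rr ^+ k <= (1 - rr)^-1.
  have r10 : 0 < 1 - rr by lra.
  have -> : \sum_(0 <= k < m) rr ^+ k = (1 - rr ^+ m) / (1 - rr).
    elim: m => [|m ih]; first by rewrite big_geq// expr0 subrr mul0r.
    by rewrite big_nat_recr//= ih exprS; field; rewrite gt_eqF.
  rewrite ler_pdivrMr// mulVf ?gt_eqF// gerBl exprn_ge0// ltW//.
have FF := ae_filter_ringOfSetsType mu.
apply: filterS (ae_covered cA fC) => x hx ux.
apply: filterS hx => N nA; rewrite ltNge; apply/negP => hN; apply: nA; split => //.
Qed.

End AlmostEverywhere.

Section FullMeasure.
Variable R : realType.
Local Notation mu := (@lebesgue_measure R).

Lemma cvg_limsup_tail (a : nat -> nat) : (forall i, (1 <= i)%N -> (1 <= a i)%N) ->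
  (forall eps : R, 0 < eps -> exists C : nat, \forall N \near \oo,
     \sum_(1 <= i < N.+1) (if (C <= a i)%N then 2^-1 * ln ((a i)%:R : R) else 0) <= eps * N%:R) ->
  limn_esup (fun N : nat =>
            (N%:R^-1 *
              (\sum_(1 <= i < N.+1) ln ((a i)%:R : R)
               - \sum_(1 <= i < N.+1 | (a i)%:R < C) ln ((a i)%:R : R)))%:E)
            @[C --> (+oo : set_system R)] --> (0%:E : \bar R).
Proof.
move=> a1 tail.
pose u (C : R) (N : nat) : R := N%:R^-1 * \sum_(1 <= i < N.+1) (if (a i)%:R < C then 0 else ln (a i)%:R).
have uE C : (fun N : nat => (N%:R^-1 *
     (\sum_(1 <= i < N.+1) ln ((a i)%:R : R)
      - \sum_(1 <= i < N.+1 | ((a i)%:R < C)%R) ln ((a i)%:R : R)))%:E) = (fun N => (u C N)%:E).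
  apply/funext => N; congr (_ * _)%:E.
  rewrite [X in _ - X]big_mkcond/= -sumrB; apply: eq_bigr => i _.
  by case: ifP => _; rewrite ?subrr ?subr0.
under eq_fun do rewrite uE.
have ln0' i : 0 <= ln ((a i)%:R : R).
  by case: (a i) => [|k]; [rewrite ln0|rewrite ln_ge0// ler1n].
have u0 C N : 0 <= u C N.
  by rewrite mulr_ge0 ?invr_ge0//; apply: sumr_ge0 => i _; case: ifP.
have sup0 C : (0 <= limn_esup (fun N => (u C N)%:E))%E.
  apply: limf_esup_ge0 => [|N]; last by rewrite lee_fin.
  by move=> [N _ /(_ N (leqnn _))].
have small e : 0 < e -> exists M : R, forall C, M < C -> (limn_esup (fun N => (u C N)%:E) <= e%:E)%E.
  move=> e0; have [C0 [N0 _ hN0]] := tail (e / 2) (divr_gt0 e0 (ltr0n _ 2)).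
  exists C0%:R => C C0C; apply: le_limn_esup; exists N0.+1 => // N /= N0N.
  have Np : 0 < N%:R :> R by rewrite ltr0n (leq_ltn_trans _ N0N).
  rewrite lee_fin /u mulrC ler_pdivrMr//.
  have h := hN0 N (ltnW N0N); rewrite /= in h.
  suff : \sum_(1 <= i < N.+1) (if (a i)%:R < C then 0 else ln ((a i)%:R : R)) <=
     2 * \sum_(1 <= i < N.+1) (if (C0 <= a i)%N then 2^-1 * ln ((a i)%:R : R) else 0) by lra.
  rewrite mulr_sumr; apply: ler_sum => i _; have := ln0' i.
  case: ltP => Ca; case: leqP => C0a; rewrite ?mulr0 ?mulrA ?divff ?mul1r//.
  by move: C0a; rewrite -(ltr_nat R) => h1; lra.
apply/fine_cvgP; split.
  have [M hM] := small 1 ltr01; exists M; split; first exact: num_real.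
  move=> C /hM h; rewrite ge0_fin_numE//; exact: le_lt_trans h (ltry _).
apply/cvgrPdist_le => e e0; have [M hM] := small e e0.
exists M; split; first exact: num_real.
move=> C /hM h; rewrite sub0r normrN /= ger0_norm ?fine_ge0//.
by rewrite -lee_fin fineK// ge0_fin_numE// (le_lt_trans h (ltry _)).
Qed.

Lemma ae_calA : {ae mu, forall x : R, unit_irr x -> calA x}.
Proof.
have FF := ae_filter_ringOfSetsType mu.
have tailP m : exists C : nat, {ae mu, forall x : R, unit_irr x -> \forall N \near \oo,
    digit_sum (fun i k => if (C <= k)%N then 2^-1 * ln (k%:R : R) else 0) N x < m.+1%:R^-1 * N%:R}.
  have m0 : 0 < m.+1%:R^-1 :> R by rewrite invr_gt0.
  by have [C [_ h]] := ae_digit_tail m0; exists C.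
pose C m := projT1 (cid (tailP m)).
have CP : {ae mu, forall x : R, forall m, unit_irr x -> \forall N \near \oo,
    digit_sum (fun i k => if (C m <= k)%N then 2^-1 * ln (k%:R : R) else 0) N x < m.+1%:R^-1 * N%:R}.
  by apply: ae_foralln => m; rewrite /C; case: cid.
apply: filterS (filterI (@ae_digit_lt R) (filterI (@ae_digit_weight R) CP)) => x [h1 [h3 h2]] ux.
have [/andP[x0 x1] xi] := ux.
split => //; first by rewrite ltW.
have a1 i : (1 <= i)%N -> (1 <= digit i x)%N by exact: digit_gt0.
exists (fun n => digit n x); split.
- exact: digit_expansion.
- exact: h1.
- apply: cvg_limsup_tail => // eps e0.
  pose m := Num.trunc eps^-1.
  have me : m.+1%:R^-1 <= eps.
    rewrite -[leRHS]invrK lef_pV2 ?posrE ?invr_gt0 ?ltr0n//.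
    exact/ltW/truncnS_gt.
  exists (C m); apply: filterS (h2 m ux) => N /ltW hN.
  by apply: (le_trans hN); rewrite ler_wpM2r.
- have [c hc] := h3 ux.
  apply: (@le_lt_trans _ _ c%:E); last exact: ltry.
  apply: lime_le.
    apply: is_cvg_nneseries => n n1 _; rewrite lee_fin.
    by rewrite divr_ge0 ?powR_ge0// ln_ge0// ler1n.
  apply: nearW => N; rewrite sumEFin lee_fin; apply: le_trans (ltW (hc N)).
  rewrite /digit_sum big_mkcond/=.
  apply: (@le_trans _ _ (\sum_(1 <= i < N) (if i%:R `^ (1 / 2) <= (digit i x)%:R :> R then digit_weight R i else 0))).
    apply: ler_sum => i _; case: ifPn => h; first by rewrite (ltW h).
    by case: ifP => // _; exact: digit_weight_ge0.
  apply: le_sum_widen => // i _; case: ifP => // _; exact: digit_weight_ge0.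
Qed.

Theorem negligible_not_calA : mu.-negligible ([set x : R | 0 <= x < 1] `\` @calA R).
Proof.
have rat0 : mu.-negligible (@rational R).
  by apply/negligible_outer_measure; exact: lebesgue_measure_rat.
apply: negligibleS (negligibleU ae_calA rat0) => x [/= x01 nA].
have [xr|xi] := pselect (rational x); first by right.
left => h; apply: nA; apply: h; split => //.
have /andP[x0 x1] := x01; rewrite x1 andbT lt_neqAle x0 andbT eq_sym.
exact: irrational_neq0.
Qed.

End FullMeasure.

Theorem theorem1p1 (R : realType) :
  (@lebesgue_measure R).-negligible ([set x : R | 0 <= x < 1] `\` @calA R) /\
  (forall alpha : R, calA alpha ->
   forall r : nat -> R,
     (forall i j : nat, (1 <= i)%N -> (i <= j)%N -> j%:R * r j <= i%:R * r i) ->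
     (\sum_(1 <= i < N.+1) r i) @[N --> \oo] --> (+oo : set_system R) ->
   forall a : R, 0 <= a < 1 ->
   {ae @lebesgue_measure R, forall x : R, 0 <= x < 1 ->
     (((\sum_(1 <= i < N.+1)
          \1_(circle_ball a (r i)) (iter i (rotation alpha) x))
       / (\sum_(1 <= i < N.+1) 2 * r i)) @[N --> \oo] --> (1 : R))}).
Proof.
split; first exact: negligible_not_calA.
exact: visits_strong_law.
Qed.
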